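(* Let $(G_n)_{n}$ be a sequence of rank-one inhomogeneous random graphs satisfying Assumption A for some measure $\nu$ on $(0,\infty)$ (see context). Let $\mathcal V\subseteq V_n$ be a set of vertices. Then for all $\ell\in\mathbb N$ the neighbourhoods around $v\in\mathcal V$ can be coupled to independent limiting trees $\mathcal T(v)\sim T(W_v,\nu)$ such that for all $n$ $$\begin{aligned}\mathbb P_n\Bigl(\bigcup_{v\in\mathcal V}\{B_\ell(v)\not\cong\mathcal T_\ell(v)\}\Bigr)\le{}&\frac{\Gamma_{2,n}}{n\vartheta}\sum_{v\in\mathcal V}W_v^2+\Gamma_{1,n}\sum_{v\in\mathcal V}W_v\mathbf 1_{\{W_v>\sqrt{n\vartheta}\}}\\&+(\Gamma_{2,n}+1)^\ell\Bigl(\frac{\Gamma_{3,n}}{n\vartheta}+\kappa_{1,n}+\kappa_{2,n}+\frac{2+\Gamma_{1,n}}{k_n}+\frac{k_n}{n\vartheta}\Bigr)\sum_{v\in\mathcal V}W_v\\&+|\mathcal V|\frac1{k_n}+\frac{k_n^2}{n\vartheta\Gamma_{1,n}}+\sum_{v\in\mathcal V}W_v\,\alpha_n\Bigl(\frac1\vartheta+(\Gamma_2+1)^{\ell-1}\Bigl(\frac{\Gamma_{2,n}}{\vartheta\Gamma_{1,n}}+1\Bigr)\Bigr),\end{aligned}$$ where $(k_n)_n\subseteq(0,\infty)$ is an arbitrary sequence of positive real numbers.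
   Context: **Graph model.** $V_n=\{1,\dots,n\}$. Each $v\in V_n$ carries a possibly random connectivity weight $W_v=W_v^n\in(0,\infty)$. $\mathcal F_n=\sigma(W_1,\dots,W_n)$; $\mathbb P_n,\mathbb E_n$ are conditional on $\mathcal F_n$. $\Lambda_n=\sum_{u\in V_n}W_u$. Given $\mathcal F_n$, the edges $\{u,v\}$, $u\neq v$, are present independently with probability $p_{uv}=\min(W_uW_v/(n\vartheta),1)$; the resulting graph is $G_n$. **Assumption A (for a probability measure $\nu$ on $(0,\infty)$ with mean in $(0,\infty)$).** Let $\nu_n=\frac1n\sum_{v}\mathbf 1_{\{W_v\in\cdot\}}$, $\hat\nu_n=\frac1{\Lambda_n}\sum_vW_v\mathbf 1_{\{W_v\in\cdot\}}$, and $\hat\nu(A)=\mathbb E[W\mathbf 1_{\{W\in A\}}]/\mathbb E[W]$ for $W\sim\nu$. There are $\mathcal F_n$-measurable $\alpha_n\to0$ in probability with $\mathcal W(\nu_n,\nu)\le\alpha_n$ and $\mathcal W(\hat\nu_n,\hat\nu)\le\alpha_n$, where $\mathcal W$ is the 1-Wasserstein distance, and $\frac1n\sum_{u\in V_n}W_u^3$ is bounded in probability. Under this assumption $\vartheta=\mathbb E[W]$, $W\sim\nu$. **Moments.** $\Gamma_{p,n}=\frac1{n\vartheta}\sum_{u\in V_n}W_u^p$, $\kappa_{p,n}=\frac1{n\vartheta}\sum_{u\in V_n}W_u^p\mathbf 1_{\{W_u>\sqrt{n\vartheta}\}}$, $\Gamma_p=\mathbb E[W^p]/\vartheta$ with $W\sim\nu$.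 **Neighbourhoods and trees.** $B_\ell(v)$ is the subgraph of $G_n$, rooted at $v$, formed by all paths starting at $v$ with at most $\ell$ edges. $\cong$ is isomorphism of rooted graphs. $T(W,\nu)$ is the Galton–Watson tree whose root has $\mathrm{Poi}(W)$ children and in which all other individuals have independent mixed Poisson offspring numbers with mixing distribution $\hat\nu$ (i.e. $\mathrm{Poi}(\hat W)$ given $\hat W\sim\hat\nu$). $\mathcal T_\ell(v)$ is $\mathcal T(v)$ cut at height $\ell$. The coupling, laws and independence are understood conditionally on $\mathcal F_n$. *)

(* Defs.v *)
From HB Require Import structures.
From mathcomp Require Import all_boot all_order all_algebra finmap.
From mathcomp Require Import all_classical all_reals all_analysis.
From mathcomp Require Import measurable_realfun.

Set Implicit Arguments.
Unset Strict Implicit.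
Unset Printing Implicit Defensive.

Import Order.TTheory GRing.Theory Num.Theory.
Import numFieldNormedType.Exports.

Local Open Scope classical_set_scope.
Local Open Scope ring_scope.

(* The 1-Wasserstein distance, as an infimum over couplings. The arguments are
   set functions so that empirical measures can be given by their formula. *)
Definition wasserstein1 (R : realType) (mu nu : set R -> \bar R) : \bar R :=
  ereal_inf [set (\int[pi]_z (`|z.1 - z.2|)%:E)%E | pi in
    [set pi : probability (R * R)%type R |
      forall A : set R, measurable A ->
        pi (A `*` [set: R]) = mu A /\ pi ([set: R] `*` A) = nu A]].

Definition mean (R : realType) (nu : probability R R) : R :=
  fine (\int[nu]_x x%:E)%E.

Section size_biased.
Context (R : realType) (nu : probability R R).

(* For [nu] carried by the positive half-line this is
   A |-> E[W 1_{W \in A}] / E[W]; the maximum only serves to obtain a measure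
   for every [nu]. *)
Definition size_biased (A : set R) : \bar R :=
  (\int[nu]_(x in A) (Num.max 0 (x / mean nu))%:E)%E.

Let size_biased0 : size_biased set0 = 0%E.
Proof. by rewrite /size_biased integral_set0. Qed.

Let size_biased_ge0 A : (0 <= size_biased A)%E.
Proof. by apply: integral_ge0 => x _; rewrite lee_fin le_max lexx. Qed.

Let size_biased_sigma_additive : semi_sigma_additive size_biased.
Proof.
apply: semi_sigma_additive_nng_induced => [|x].
  apply/measurable_EFinP; apply: measurable_maxr => //.
  exact: measurable_funM.
by rewrite lee_fin le_max lexx.
Qed.

HB.instance Definition _ := isMeasure.Build _ _ _ size_biased
  size_biased0 size_biased_ge0 size_biased_sigma_additive.

End size_biased.

(* Gamma_p. Under [assumptionA] the integral is finite for [p <= 2]: the measures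
   [empirical_size_biased] have finite mean and are at finite Wasserstein
   distance from [size_biased nu], whose mean is Gamma_2. *)
Definition limit_moment (R : realType) (nu : probability R R) (p : nat) : R :=
  fine (\int[nu]_x (x ^+ p)%:E)%E / mean nu.

Section weights.
Context (R : realType) (n : nat) (w : 'I_n -> R).

Definition empirical (A : set R) : \bar R :=
  (n%:R^-1 * \sum_(v < n) \1_A (w v))%:E.

Definition empirical_size_biased (A : set R) : \bar R :=
  ((\sum_(u < n) w u)^-1 * \sum_(v < n) w v * \1_A (w v))%:E.

(* Gamma_{p,n}; [trunc_moment] is kappa_{p,n}. *)
Definition moment (theta : R) (p : nat) : R :=
  (n%:R * theta)^-1 * \sum_(u < n) w u ^+ p.

Definition trunc_moment (theta : R) (p : nat) : R :=
  (n%:R * theta)^-1 *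
  \sum_(u < n) w u ^+ p * (Num.sqrt (n%:R * theta) < w u)%R%:R.

Definition edge_prob (theta : R) (u v : 'I_n) : R :=
  Num.min (w u * w v / (n%:R * theta)) 1.

End weights.

Section assumptionA.
Context (d : measure_display) (Omega : measurableType d) (R : realType)
  (P : probability Omega R).

Definition weights_sigmaType (n : nat) (W : 'I_n -> {RV P >-> R}) :=
  g_sigma_algebraType (g_sigma_preimage (fun v => W v : Omega -> R)).

Record assumptionA (W : forall n, 'I_n -> {RV P >-> R}) (nu : probability R R)
    (alpha : nat -> Omega -> R) : Prop := AssumptionA {
  weight_gt0 : forall n (v : 'I_n) omega, 0 < W n v omega;
  nu_pos : nu `]0, +oo[%classic = 1%E;
  nu_mean : (0 < \int[nu]_x x%:E < +oo)%E;
  alpha_measurable : forall n, (0 < n)%N ->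
    measurable_fun [set: weights_sigmaType (W n)] (alpha n);
  alpha_cvg0 : forall e : R, 0 < e ->
    P [set omega | e < `|alpha n omega|] @[n --> \oo] --> 0%E;
  wasserstein_le : forall n, (0 < n)%N -> {ae P, forall omega,
    (wasserstein1 (empirical (fun v => W n v omega)) nu
      <= (alpha n omega)%:E)%E};
  wasserstein_size_biased_le : forall n, (0 < n)%N -> {ae P, forall omega,
    (wasserstein1 (empirical_size_biased (fun v => W n v omega))
      (size_biased nu) <= (alpha n omega)%:E)%E};
  third_moment_tight : forall e : R, 0 < e -> exists K : R,
    forall n, (0 < n)%N ->
      (P [set omega | (K < n%:R^-1 * \sum_(u < n) W n u omega ^+ 3)%R]
        <= e%:E)%E }.

End assumptionA.

Record rooted_graph (T : Type) := RootedGraph {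
  rg_root : T;
  rg_verts : set T;
  rg_edge : T -> T -> Prop }.

Definition rg_iso (T U : Type) (g : rooted_graph T) (h : rooted_graph U) :=
  exists f : T -> U,
    [/\ set_bij (rg_verts g) (rg_verts h) f,
        f (rg_root g) = rg_root h &
        forall x y, rg_verts g x -> rg_verts g y ->
          (rg_edge g x y <-> rg_edge h (f x) (f y))].

Section neighbourhood.
Context (n : nat) (G : rel 'I_n) (l : nat) (v : 'I_n).

Definition short_path (p : seq 'I_n) : Prop :=
  [/\ path G v p, uniq (v :: p) & (size p <= l)%N].

(* The subgraph formed by these paths: an edge of [G] none of them traverses,
   such as one between two vertices at distance [l] from [v], is left out. *)
Definition neighbourhood : rooted_graph 'I_n := RootedGraph v
  [set x | exists2 p, short_path p & x \in v :: p]
  (fun x y => exists2 p, short_path p &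
    infix [:: x; y] (v :: p) || infix [:: y; x] (v :: p)).

End neighbourhood.

(* Ulam-Harris trees: the node [u : seq nat] has children [rcons u i]. *)
Definition tree_cut (t : set (seq nat)) (l : nat) : rooted_graph (seq nat) :=
  RootedGraph [::] [set u | t u /\ (size u <= l)%N]
    (fun x y => [/\ t x /\ (size x <= l)%N, t y /\ (size y <= l)%N &
       exists i, y = rcons x i \/ x = rcons y i]).

(* [N u] is the number of children of the potential individual [u]; only its
   values at the nodes of the resulting tree matter. *)
Definition tree_of_offspring (N : seq nat -> nat) : set (seq nat) :=
  [set u | forall s i, prefix (rcons s i) u -> (i < N s)%N].

Section random_objects.
Context (d : measure_display) (S : measurableType d) (R : realType)
  (Q : {measure set S -> \bar R}).

Definition independent_events (I : choiceType) (D : set I) (E : I -> set S) :=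
  forall J : {fset I}, [set` J] `<=` D ->
    Q (\bigcap_(i in [set` J]) E i) = (\prod_(i <- J) Q (E i))%E.

Definition independent_nat_RVs (I : choiceType) (D : set I)
    (X : I -> S -> nat) :=
  forall A : I -> set nat, independent_events D (fun i => X i @^-1` A i).

Definition rank_one_graph (n : nat) (theta : R) (w : 'I_n -> R)
    (G : S -> rel 'I_n) : Prop :=
  [/\ forall s, symmetric (G s) /\ irreflexive (G s),
      forall u v, measurable [set s | G s u v],
      forall u v, u != v -> Q [set s | G s u v] = (edge_prob w theta u v)%:E &
      independent_events [set e : 'I_n * 'I_n | (e.1 < e.2)%N]
        (fun e => [set s | G s e.1 e.2])].

(* [(T v)_(v in V)] are independent and [T v] is a T(w v, nu) tree: the
   offspring numbers [N v u] of all potential individuals [u] of all these trees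
   are independent, Poisson for the roots and mixed Poisson otherwise. *)
Definition independent_gw_trees (n : nat) (nu : probability R R)
    (w : 'I_n -> R) (V : {set 'I_n}) (T : 'I_n -> S -> set (seq nat)) : Prop :=
  exists N : 'I_n -> seq nat -> S -> nat,
  [/\ forall v u, v \in V -> measurable_fun [set: S] (N v u),
      forall v k, v \in V ->
        Q [set s | N v [::] s = k] = (poisson_pmf (w v) k)%:E,
      forall v u k, v \in V -> u != [::] ->
        Q [set s | N v u s = k]
          = (\int[size_biased nu]_x (poisson_pmf x k)%:E)%E,
      independent_nat_RVs [set i : 'I_n * seq nat | i.1 \in V]
        (fun i => N i.1 i.2) &
      forall v s, v \in V -> T v s = tree_of_offspring (fun u => N v u s)].

Definition coupling_failure (n : nat) (l : nat) (V : {set 'I_n})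
    (G : S -> rel 'I_n) (T : 'I_n -> S -> set (seq nat)) : set S :=
  \bigcup_(v in [set` V])
    [set s | ~ rg_iso (neighbourhood (G s) l v) (tree_cut (T v s) l)].

End random_objects.

(* The exponent [l%:Z - 1] is an integer, so that [l = 0] is meaningful. *)
Definition coupling_bound (R : realType) (nu : probability R R) (n : nat)
    (w : 'I_n -> R) (V : {set 'I_n}) (l : nat) (alpha k : R) : R :=
  let theta := mean nu in
  let nt := n%:R * theta in
  let Gam := moment w theta in
  let kap := trunc_moment w theta in
  let Gam2 := limit_moment nu 2 in
  Gam 2%N / nt * \sum_(v in V) w v ^+ 2
  + Gam 1%N * \sum_(v in V) w v * (Num.sqrt nt < w v)%R%:R
  + (Gam 2%N + 1) ^+ l
    * (Gam 3%N / nt + kap 1%N + kap 2%N + (2 + Gam 1%N) / k + k / nt)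
    * \sum_(v in V) w v
  + #|V|%:R * k^-1
  + k ^+ 2 / (nt * Gam 1%N)
  + (\sum_(v in V) w v) * alpha
    * (theta^-1
       + (Gam2 + 1) ^ (l%:Z - 1) * (Gam 2%N / (theta * Gam 1%N) + 1)).

(* Main.v *)
Require Import Defs.
From HB Require Import structures.
From mathcomp Require Import all_boot all_order all_algebra finmap.
From mathcomp Require Import all_classical all_reals all_analysis.
From mathcomp Require Import measurable_realfun ring lra.

(* The neighbourhoods of all v in V are explored simultaneously, breadth first; a
   history h records for each expanded vertex its new neighbours in an order
   chosen uniformly at random. Independently of any randomness, give h the mass
   mu(h), a product over the steps of truncated densities: the overlap of
   Ber(w_x w_z / (n theta)) and Poi(w_x w_z / (n theta)) over the candidates z,
   times the overlap of Poi(Gamma_{1,n} w_x) with the limiting offspring law. The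
   mass mu is dominated both by the law of the history of the graph and by that of
   the independent trees with w-biased labels, so graph and trees can be coupled so
   as to share the history h with probability mu(h), and a shared history gives
   isomorphic neighbourhoods. The failure probability is then at most
   1 - sum_h mu(h), which is bounded by propagating the expected loss per vertex
   through the generations; the offspring loss is controlled by the Wasserstein
   distances because a |-> Poi(a) is 1-Lipschitz in total variation.
   For the coupling to be a kernel, the offspring numbers are read off one uniform
   variable by successive inversion, and given them the graph has an explicit law:
   a finite mixture whose last component restores the graph marginal. *)

Set Implicit Arguments.
Unset Strict Implicit.
Unset Printing Implicit Defensive.

Import Order.TTheory GRing.Theory Num.Theory.
Import numFieldNormedType.Exports.

Local Open Scope ring_scope.

(** The obstacle is that the probability of a collision depends on the weight already explored,
    which is random. The threshold [kk] deals with this: each vertex entering the explored set is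
    charged w/[kk]. While the explored weight is at most [kk], expanding x collides with probability
    at most w_x [kk]/(n theta); beyond [kk] the charges exceed 1 and the lower bound is trivial.
    This is the origin of 1/k_n and k_n/(n theta). The children of x have Gamma_{1,n} w_x as mean
    number and w-biased labels, so their mean total weight is Gamma_{2,n} w_x: graph losses grow by
    Gamma_{2,n} per generation. The offspring loss is passed on by accepted children only and grows
    by the limiting mean Gamma_2. Neighbours are put in random order because Ulam-Harris trees are
    ordered; the resulting 1/m! is the one in the Poisson weights. The limiting trees carry no
    labels. The labels of a history are hidden variables there, and their conditional weights given
    the offspring numbers sum to at most 1. *)

Section exploration.
Context (I : finType).

(* A node of the forest being explored: its label, the label of its parent, its
   address (root and Ulam-Harris word) and the number of generations that
   remain to be explored below it. *)
Definition node := (I * option I * (I * seq nat) * nat)%type.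

Definition lab (nd : node) : I := nd.1.1.1.
Definition par (nd : node) : option I := nd.1.1.2.
Definition addr (nd : node) : I * seq nat := nd.1.2.
Definition dep (nd : node) : nat := nd.2.

Definition step := (node * seq I)%type.

Definition kids (s : step) : seq node :=
  [seq (p.1, Some (lab s.1),
        ((addr s.1).1, rcons (addr s.1).2 p.2), (dep s.1).-1)
     | p <- zip s.2 (iota 0 (size s.2))].

(** Listing by length allows comparison with sums over tuples, that is, with independent labels; a
    list without repetition has at most [#|I|] entries. *)
Definition cands (A : {set I}) : seq (seq I) :=
  [seq ys <- flatten [seq [seq val t | t <- enum {: m.-tuple I}]
                         | m <- iota 0 #|I|.+1]
     | uniq ys && all [predC A] ys].

(* [t] is fuel; the exploration is complete as soon as
   [size q + #|~: A| <= t]. *)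
Fixpoint runs (t : nat) (q : seq node) (A : {set I}) : seq (seq step) :=
  if t is t'.+1 then
    if q is nd :: q' then
      if dep nd == 0%N then runs t' q' A else
      flatten [seq [seq (nd, ys) :: h
                      | h <- runs t' (q' ++ kids (nd, ys)) (A :|: [set:: ys])]
                 | ys <- cands A]
    else [:: [::]]
  else [:: [::]].

Lemma cands_uniq A ys : ys \in cands A -> uniq ys.
Proof. by rewrite mem_filter => /andP[/andP[]]. Qed.

Lemma cands_disj A ys y : ys \in cands A -> y \in ys -> y \notin A.
Proof. by rewrite mem_filter => /andP[/andP[_ /allP h] _] /h. Qed.

Lemma size_kids s : size (kids s) = size s.2.
Proof. by rewrite size_map size_zip size_iota minnn. Qed.

Lemma lab_kids s : map lab (kids s) = s.2.
Proof.
by rewrite -map_comp -[RHS](@unzip1_zip _ _ _ (iota 0 (size s.2))) ?size_iota.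
Qed.

Lemma card_cands A ys : ys \in cands A ->
  (#|A :|: [set:: ys]| = #|A| + size ys)%N.
Proof.
move=> ysA; have dys := cands_disj ysA.
rewrite cardsU disjoint_setI0 ?cards0 ?subn0 ?cardsE ?(card_uniqP (cands_uniq ysA))//.
by apply/pred0P => z /=; apply/negbTE/negP; rewrite inE => /andP[zA /dys]; rewrite zA.
Qed.

(** The new vertices leave the complement of [A] exactly as they join the queue, so each expansion
    lowers the total by the expanded node. *)
Lemma fuel_kids t nd (q : seq node) A ys : ys \in cands A ->
  (size q + #|~: A| <= t)%N ->
  (size (q ++ kids (nd, ys)) + #|~: (A :|: [set:: ys])| <= t)%N.
Proof.
move=> ysA; rewrite size_cat size_kids /=; have := cardsC A.
have := cardsC (A :|: [set:: ys]); rewrite (card_cands ysA) -addnA => <- /addnI e.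
by rewrite -addnA -e.
Qed.

Section sums.
Context (R : realType).

Lemma sum_runs0 (F : seq step -> R) q A :
  \sum_(h <- runs 0 q A) F h = F [::].
Proof. by rewrite big_seq1. Qed.

Lemma sum_runs_nil (F : seq step -> R) t A :
  \sum_(h <- runs t [::] A) F h = F [::].
Proof. by case: t => [|t]; rewrite big_seq1. Qed.

Lemma sum_runs_leaf (F : seq step -> R) t nd q A : dep nd = 0%N ->
  \sum_(h <- runs t.+1 (nd :: q) A) F h = \sum_(h <- runs t q A) F h.
Proof. by move=> /= ->. Qed.

Lemma sum_runs_cons (w : step -> R) t nd q A : dep nd != 0%N ->
  \sum_(h <- runs t.+1 (nd :: q) A) \prod_(s <- h) w s =
  \sum_(ys <- cands A) w (nd, ys) *
    \sum_(h <- runs t (q ++ kids (nd, ys)) (A :|: [set:: ys])) \prod_(s <- h) w s.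
Proof.
move=> /= /negPf ->; rewrite big_flatten big_map; apply: eq_bigr => ys _.
by rewrite big_map mulr_sumr; apply: eq_bigr => h _; rewrite big_cons.
Qed.

(** Dropping distinctness and the avoidance of [A] passes from sampling without replacement to
    sampling with replacement. *)
Lemma sum_cands_le A (F : seq I -> R) : (forall ys, 0 <= F ys) ->
  \sum_(ys <- cands A) F ys <=
  \sum_(m < #|I|.+1) \sum_(t : m.-tuple I) F t.
Proof.
move=> F0; rewrite big_filter big_flatten big_map -val_enum_ord big_map big_enum.
rewrite [leRHS](eq_bigr (fun m : 'I_#|I|.+1 =>
    \sum_(ys <- [seq val t | t <- enum {: m.-tuple I}]) F ys)); last first.
  by move=> m _; rewrite big_map big_enum.
apply: ler_sum => m _; rewrite big_mkcond; apply: ler_sum => ys _.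
by case: ifP.
Qed.

(** A set of size m is listed in m! orders, which cancels the factorial. *)
Lemma sum_cands_set A (H : {set I} -> R) :
  \sum_(ys <- cands A) H [set:: ys] / (size ys)`!%:R =
  \sum_(J : {set I} | [disjoint J & A]) H J.
Proof.
rewrite big_filter big_flatten big_map -val_enum_ord big_map big_enum /=.
pose P (J : {set I}) := [disjoint J & A].
transitivity (\sum_(m < #|I|.+1) \sum_(J : {set I} | P J && (#|J| == m)) H J).
  apply: eq_bigr => m _; rewrite big_map big_enum_cond /=.
  rewrite (partition_big (fun t : m.-tuple I => [set:: val t])
    (fun J => P J && (#|J| == m))) /=; last first.
    move=> t /andP[ut /allP tA]; rewrite cardsE (card_uniqP ut) size_tuple eqxx.
    rewrite andbT; apply/pred0P => x; rewrite /= inE.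
    by apply/negbTE/negP => /andP[/tA /= /negP].
  apply: eq_bigr => J /andP[JA /eqP Jm].
  transitivity (\sum_(t : m.-tuple I | all [in J] t && uniq t) H J / m`!%:R).
    apply: eq_big => [t|t /andP[_ /eqP ->]]; last by rewrite size_tuple.
    apply/idP/idP => [/andP[/andP[-> _] /eqP <-]|/andP[/allP tJ ut]].
      by rewrite andbT; apply/allP => x; rewrite inE.
    rewrite ut /=; apply/andP; split.
      apply/allP => x /tJ xJ /=; apply/negP => xA.
      by move/pred0P: JA => /(_ x); rewrite /= xJ xA.
    rewrite eqEcard; apply/andP; split.
      by apply/fintype.subsetP => x; rewrite inE => /tJ.
    by rewrite cardsE (card_uniqP ut) size_tuple Jm.
  rewrite sumr_const.
  have -> : #|[pred t : m.-tuple I | all [in J] t && uniq t]| = (m`!)%N.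
    by have := card_uniq_tuples m [in J]; rewrite cardsE Jm ffactnn.
  by rewrite -[LHS]mulr_natr divfK// pnatr_eq0 -lt0n fact_gt0.
rewrite (partition_big (fun J : {set I} => inord #|J| : 'I_#|I|.+1) predT) //=.
apply: eq_bigr => m _; apply: eq_bigl => J; rewrite -val_eqE /= inordK//.
by rewrite ltnS max_card.
Qed.

End sums.
End exploration.

Arguments lab {I} nd.
Arguments par {I} nd.
Arguments addr {I} nd.
Arguments dep {I} nd.

(** * Mass of the explorations *)

Section bernoulli_poisson.
Context (R : realType).

(* The overlap of the Bernoulli law with parameter [min x 1] and the Poisson law
   with mean [x], at the values [1] and [0]. *)
Definition overlap (x : R) (b : bool) : R :=
  if b then x * expR (- x) else Num.max 0 (1 - x).

Lemma overlap_ge0 x b : 0 <= x -> 0 <= overlap x b.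
Proof.
by move=> x0; case: b => /=; rewrite ?le_max ?lexx// mulr_ge0// expR_ge0.
Qed.

Lemma overlap_true_le x : 0 <= x -> overlap x true <= Num.min x 1.
Proof.
move=> x0; rewrite le_min /=; apply/andP; split.
  by rewrite -[leRHS]mulr1 ler_wpM2l// -expR0 ler_expR; lra.
rewrite -(expRxMexpNx_1 x) ler_wpM2r ?expR_ge0//.
by rewrite (le_trans _ (expR_ge1Dx _))//; lra.
Qed.

Lemma overlap_false_le x : overlap x false <= expR (- x).
Proof. by rewrite ge_max expR_ge0 (le_trans _ (expR_ge1Dx _)). Qed.

Lemma overlap_falseE x : overlap x false = 1 - Num.min x 1.
Proof. by rewrite /overlap; case: leP => ?; case: leP => ?; lra. Qed.

Lemma overlap_le1 x b : 0 <= x -> overlap x b <= 1.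
Proof.
move=> x0; case: b.
  by rewrite (le_trans (overlap_true_le x0))// ge_min lexx orbT.
by rewrite /= ge_max ler01 gerBl.
Qed.

Lemma overlap_sum_le1 x : 0 <= x -> overlap x true + overlap x false <= 1.
Proof.
by move=> x0; have := overlap_true_le x0; rewrite overlap_falseE; lra.
Qed.

(** Since exp(-x) >= 1 - x, the sum is at least x(1 - x) + (1 - x) = 1 - x^2 when x <= 1; for x > 1
    the left side is negative. The defect x^2 is the price of replacing an edge by a Poisson number
    of children. *)
Lemma overlap_sum_ge x : 0 <= x -> 1 - x ^+ 2 <= overlap x true + overlap x false.
Proof.
move=> x0; have h0 := overlap_ge0 true x0.
have [x1|x1] := leP x 1; last first.
  have h1 := overlap_ge0 false x0; have : 1 - x ^+ 2 <= 0 by nra.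
  by lra.
have : x * (1 - x) <= overlap x true.
  by rewrite /= ler_wpM2l// (le_trans _ (expR_ge1Dx _)).
have : 1 - x <= overlap x false by rewrite /= le_max lexx orbT.
by rewrite expr2; lra.
Qed.

(** Weierstrass product inequality, the union bound in product form. *)
Lemma prodr_ge_subsum (I : Type) (r : seq I) (P : pred I) (c : I -> R) :
  (forall i, P i -> 0 <= c i <= 1) ->
  1 - \sum_(i <- r | P i) (1 - c i) <= \prod_(i <- r | P i) c i.
Proof.
move=> c01; elim: r => [|i r IH]; first by rewrite !big_nil subr0.
rewrite !big_cons; case: ifP => // Pi; have /andP[c0 c1] := c01 _ Pi.
have p1 : \prod_(j <- r | P j) c j <= 1 by apply: prodr_ile1.
have p0 : 0 <= \prod_(j <- r | P j) c j by apply: prodr_ge0 => j /c01 /andP[].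
nra.
Qed.

End bernoulli_poisson.

Section tuple_sums.
Context (I : finType) (R : realType).

Lemma sum_tuple_prod m (F : 'I_m -> I -> R) :
  \sum_(t : m.-tuple I) \prod_(i < m) F i (tnth t i) = \prod_(i < m) \sum_y F i y.
Proof.
rewrite bigA_distr_bigA (reindex (@tuple_of_finfun I m))/=; last first.
  by exists (@finfun_of_tuple I m) => ? _; [exact: tuple_of_finfunK|exact: finfun_of_tupleK].
by apply: eq_bigr => f _; apply: eq_bigr => i _; rewrite tnth_mktuple.
Qed.

Context (p : I -> R).
Hypothesis sum_p : \sum_y p y = 1.

Lemma sum_tuple_prob m :
  \sum_(t : m.-tuple I) \prod_(y <- t) p y = 1.
Proof.
under eq_bigr => t _ do rewrite big_tuple.
by rewrite (sum_tuple_prod (fun=> p)) big1.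
Qed.

Lemma sum_tuple_mean m (f : I -> R) :
  \sum_(t : m.-tuple I) (\prod_(y <- t) p y) * \sum_(y <- t) f y =
  m%:R * \sum_y p y * f y.
Proof.
under eq_bigr => t _ do rewrite !big_tuple mulr_sumr.
rewrite exchange_big/= mulr_natl -[in RHS](card_ord m) -sumr_const.
apply: eq_bigr => i _.
(* The factor [f] is absorbed into the weight of coordinate i, so that the sum over tuples still
   factorises. *)
pose F (j : 'I_m) y := p y * (if j == i then f y else 1).
transitivity (\sum_(t : m.-tuple I) \prod_(j < m) F j (tnth t j)).
  apply: eq_bigr => t _; rewrite big_split/= -big_mkcond/= big_pred1_eq//.
rewrite sum_tuple_prod (bigD1 i)//= [X in _ * X]big1 ?mulr1.
  by apply: eq_bigr => y _; rewrite /F eqxx.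
by move=> j /negPf ji; rewrite /F ji -[RHS]sum_p; apply: eq_bigr => y _; rewrite mulr1.
Qed.

End tuple_sums.

(** * Lower bound for the total mass by a potential argument *)

Section lower_bound.
Context (I : finType) (R : realType) (w : I -> R) (nt kk : R).
Hypotheses (w_gt0 : forall x, 0 < w x) (nt_gt0 : 0 < nt) (kk_gt0 : 0 < kk).

Let Lam := \sum_x w x.
Let lam x y := w x * w y / nt.
Let ofs x := poisson_pmf (Lam / nt * w x).

Context (acc : bool -> I -> nat -> R).
Hypothesis acc01 : forall b x m, 0 <= acc b x m <= 1.

(* A lower bound both for the probability that [x] acquires the new neighbours
   [ys], in uniform random order, and for the probability that Poi(Gamma_{1,n} w_x)
   children carry the labels [ys]. The factor [acc] added in [step_weight] is the
   density, truncated at 1, of the limiting offspring law with respect to that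
   Poisson law. *)
Definition arrange_weight (x : I) (ys : seq I) : R :=
  (\prod_z overlap (lam x z) (z \in ys)) / (size ys)`!%:R.

Definition step_weight (s : step I) : R :=
  acc (par s.1 == None) (lab s.1) (size s.2) * arrange_weight (lab s.1) s.2.

Let lam_ge0 x y : 0 <= lam x y.
Proof. by rewrite divr_ge0 ?mulr_ge0 ?ltW. Qed.

Let sum_lam x : \sum_y lam x y = Lam / nt * w x.
Proof.
rewrite /Lam mulrAC mulr_suml mulr_suml; apply: eq_bigr => y _.
by rewrite /lam (mulrC (w x)).
Qed.

Lemma arrange_weight_ge0 x ys : 0 <= arrange_weight x ys.
Proof. by rewrite divr_ge0// prodr_ge0// => z _; exact: overlap_ge0. Qed.

Lemma step_weight_ge0 s : 0 <= step_weight s.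
Proof. by rewrite mulr_ge0 ?arrange_weight_ge0//; case/andP: (acc01 (par s.1 == None) (lab s.1) (size s.2)). Qed.

(** Poisson splitting: a Poisson number of children with independent w-biased labels amounts to
    independent Poi([lam x z]) numbers of children labelled z. Each z thus receives its own factor
    exp(-[lam x z]), to be compared with its overlap. *)
Lemma arrange_weight_le x ys : uniq ys ->
  arrange_weight x ys <= ofs x (size ys) * \prod_(y <- ys) (w y / Lam).
Proof.
move=> uys.
have [x0 Lam_gt0] : 0 < w x /\ 0 < Lam.
  split=> //; rewrite /Lam (bigD1 x)//= ltr_pwDl// sumr_ge0// => y _.
  exact: ltW.
have G0 : 0 < Lam / nt * w x by rewrite mulr_gt0// divr_gt0.
rewrite /ofs /poisson_pmf G0 /arrange_weight.
have -> : Lam / nt * w x = \sum_z lam x z by rewrite sum_lam.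
have -> : forall a b c d : R, a / b * c * d = (a * d * c) / b.
  by move=> a b c d; ring.
rewrite ler_wpM2r ?invr_ge0//.
have -> : (\sum_z lam x z) ^+ size ys * \prod_(y <- ys) (w y / Lam) =
    \prod_(y <- ys) lam x y.
  rewrite -[_ ^+ _]iter_mulr_1 -(count_predT ys) -big_const_seq -big_split/=; apply: eq_bigr => y _.
  rewrite sum_lam /lam; field; rewrite ?gt_eqF//.
rewrite -sumrN expR_sum (bigID [in ys])/= [X in _ <= _ * X](bigID [in ys])/=.
rewrite mulrA (big_uniq _ uys) -big_split/=.
apply: ler_pM; rewrite ?prodr_ge0//=.
- by move=> z zy; exact: overlap_ge0.
- by move=> z zy; exact: overlap_ge0.
- by apply: ler_prod => z zy; rewrite zy /= lexx mulr_ge0 ?expR_ge0.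
- apply: ler_prod => z /negPf zy; rewrite zy; apply/andP; split.
    exact: (overlap_ge0 false).
  exact: overlap_false_le.
Qed.

Let arrange_weightE x ys : arrange_weight x ys =
  (fun J : {set I} => \prod_z overlap (lam x z) (z \in J)) [set:: ys] /
    (size ys)`!%:R.
Proof. by congr (_ / _); apply: eq_bigr => z _; rewrite inE. Qed.

(** Once the orders cancel the factorial, the sum over sets is the expansion of a product over
    vertices, where a vertex of [A] can only be absent. *)
Let sum_arrange A x : \sum_(ys <- cands A) arrange_weight x ys =
  \prod_z ((if z \in A then 0 else overlap (lam x z) true) +
             overlap (lam x z) false).
Proof.
rewrite (eq_bigr _ (fun ys _ => arrange_weightE x ys)).
rewrite (sum_cands_set A (fun J => \prod_z overlap (lam x z) (z \in J))) bigA_distr [RHS](bigID (fun J : {set I} => [disjoint J & A]))/=.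
rewrite [X in _ + X]big1 ?addr0.
  apply: eq_bigr => J JA; apply: eq_bigr => z _; case: ifPn => // zJ.
  by rewrite (disjointFr JA zJ).
by move=> J /pred0Pn[z /= /andP[zJ zA]]; rewrite (bigD1 z)//= zJ zA mul0r.
Qed.

Lemma sum_arrange_le1 A x : \sum_(ys <- cands A) arrange_weight x ys <= 1.
Proof.
rewrite sum_arrange prodr_ile1// => z _.
have := overlap_ge0 true (lam_ge0 x z); have := overlap_ge0 false (lam_ge0 x z).
have := overlap_sum_le1 (lam_ge0 x z).
by case: ifP => _ ? ? ?; apply/andP; split; lra.
Qed.

(** The squares are the Bernoulli-Poisson mismatch at each z; the sum over [A] is the probability of
    running into explored vertices. *)
Lemma sum_arrange_ge (A : {set I}) x : 1 - \sum_z lam x z ^+ 2 - \sum_(z in A) lam x z <=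
  \sum_(ys <- cands A) arrange_weight x ys.
Proof.
rewrite sum_arrange; apply: le_trans (prodr_ge_subsum _ _); last first.
  move=> z _.
  have := overlap_ge0 true (lam_ge0 x z); have := overlap_ge0 false (lam_ge0 x z).
  have := overlap_sum_le1 (lam_ge0 x z).
  by case: ifP => _ ? ? ?; apply/andP; split; lra.
rewrite -addrA lerD2l -opprD lerN2 [X in _ <= _ + X]big_mkcond/= -big_split/=.
apply: ler_sum => z _; have := lam_ge0 x z; have := sqr_ge0 (lam x z).
have := overlap_sum_ge (lam_ge0 x z).
have : 1 - lam x z <= overlap (lam x z) false by rewrite /= le_max lexx orbT.
by rewrite /overlap; case: ifP => _ ? ? ? ?; lra.
Qed.

Let sum_prob : 0 < Lam -> \sum_y w y / Lam = 1.
Proof. by move=> L0; rewrite -mulr_suml divff// gt_eqF. Qed.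

Lemma sum_weight_gt0 (x : I) : 0 < \sum_y w y.
Proof. by rewrite (bigD1 x)//= ltr_pwDl// sumr_ge0// => y _; exact: ltW. Qed.

Let Lam_gt0 (x : I) : 0 < Lam := sum_weight_gt0 x.

(** Domination by the labelled Poisson tree: [h] tests the offspring number, [F] the labels drawn
    independently given that number. *)
Lemma sum_arrange_le A x (h : nat -> R) (F : seq I -> R) :
  (forall m, 0 <= h m) -> (forall ys, 0 <= F ys) ->
  \sum_(ys <- cands A) arrange_weight x ys * h (size ys) * F ys <=
  \sum_(m < #|I|.+1) ofs x m * h m *
    \sum_(t : m.-tuple I) (\prod_(y <- t) (w y / Lam)) * F t.
Proof.
move=> h0 F0.
have ofs0 m : 0 <= ofs x m by exact: poisson_pmf_ge0.
have pr0 ys : 0 <= \prod_(y <- ys) (w y / Lam).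
  by apply: prodr_ge0 => y _; rewrite divr_ge0 ?ltW// (Lam_gt0 x).
apply: (@le_trans _ _ (\sum_(ys <- cands A) ofs x (size ys) *
   (\prod_(y <- ys) (w y / Lam)) * h (size ys) * F ys)).
  rewrite !big_seq; apply: ler_sum => ys /cands_uniq uys.
  by rewrite ler_wpM2r// ler_wpM2r// arrange_weight_le.
apply: le_trans (sum_cands_le _ _) _ => [ys|]; first by rewrite !mulr_ge0.
apply: ler_sum => m _; rewrite mulr_sumr; apply: ler_sum => t _.
by rewrite size_tuple le_eqVlt; apply/orP; left; apply/eqP; ring.
Qed.

Lemma sum_arrange_size_le A x (h : nat -> R) : (forall m, 0 <= h m) ->
  \sum_(ys <- cands A) arrange_weight x ys * h (size ys) <=
  \sum_(m < #|I|.+1) ofs x m * h m.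
Proof.
move=> h0; have := @sum_arrange_le A x h (fun=> 1) h0 (fun=> ler01).
under eq_bigr do rewrite mulr1; move=> /le_trans; apply.
apply: ler_sum => m _; under eq_bigr do rewrite mulr1.
by rewrite sum_tuple_prob ?mulr1// sum_prob// (Lam_gt0 x).
Qed.

Lemma sum_arrange_mean_le A x (h : nat -> R) (f : I -> R) :
  (forall m, 0 <= h m) -> (forall y, 0 <= f y) ->
  \sum_(ys <- cands A) arrange_weight x ys * h (size ys) * \sum_(y <- ys) f y <=
  (\sum_(m < #|I|.+1) ofs x m * h m * m%:R) * \sum_y w y / Lam * f y.
Proof.
move=> h0 f0; apply: le_trans (sum_arrange_le _ _ h0 _) _.
  by move=> ys; rewrite sumr_ge0.
rewrite mulr_suml; apply: ler_sum => m _.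
by rewrite sum_tuple_mean ?mulrA// sum_prob// (Lam_gt0 x).
Qed.

(** [cst b x d] bounds the loss caused by a pending vertex x with d generations left, [b] marking
    roots. The terms of [cst_step] are the Bernoulli-Poisson mismatch, collisions with an explored
    set of weight at most [kk], rejected offspring numbers, and for each accepted child its charge
    w/[kk] plus its own cost. *)
Context (cst : bool -> I -> nat -> R).
Hypothesis cst_ge0 : forall b x d, 0 <= cst b x d.
Hypothesis cst_step : forall b x d,
  \sum_z lam x z ^+ 2 + w x * kk / nt +
  \sum_(m < #|I|.+1) ofs x m * (1 - acc b x m) +
  (\sum_(m < #|I|.+1) ofs x m * acc b x m * m%:R) *
    \sum_y w y / Lam * (w y / kk + cst false y d) <= cst b x d.+1.

(** The potential is the charge of the explored set plus the costs of the pending nodes. By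
    [cst_step] the cost of the expanded node pays both for the mass lost in the step and for the
    expected potential of its children. *)
Lemma runs_weight_ge t q A : (size q + #|~: A| <= t)%N ->
  (forall nd, nd \in q -> lab nd \in A) ->
  1 - (\sum_(x in A) w x) / kk -
    \sum_(nd <- q) cst (par nd == None) (lab nd) (dep nd) <=
  \sum_(h <- runs t q A) \prod_(s <- h) step_weight s.
Proof.
have wA0 (A' : {set I}) : 0 <= (\sum_(x in A') w x) / kk.
  by apply: divr_ge0; [apply: sumr_ge0 => x _|]; exact: ltW.
elim: t q A => [|t IH] [|nd q] A; rewrite ?ltn0//.
- by rewrite sum_runs_nil !big_nil subr0 gerBl.
- by rewrite sum_runs_nil !big_nil subr0 gerBl.
rewrite addSn ltnS => szt' qA; have szt : (size q + #|~: A| <= t)%N := szt'.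
clear szt'; have [d0|dn0] := eqVneq (dep nd) 0%N.
  rewrite sum_runs_leaf//; apply: le_trans (IH _ _ szt _).
    by rewrite lerD2l lerN2 big_cons lerDr.
  by move=> nd' h; apply: qA; rewrite inE h orbT.
(* Above the threshold the charge alone exceeds 1, so the bound to prove is nonpositive. *)
have [WA|WA] := ltP kk (\sum_(x in A) w x).
  apply: (@le_trans _ _ 0); last first.
    apply: sumr_ge0 => h _; apply: prodr_ge0 => s _; exact: step_weight_ge0.
  rewrite subr_le0 (le_trans _ (sumr_ge0 _ _))// subr_le0 ler_pdivlMr// mul1r.
  exact: ltW.
rewrite sum_runs_cons//.
set x := lab nd; set b := par nd == None.
have [d dE] : {d | dep nd = d.+1} by exists (dep nd).-1; rewrite prednK// lt0n.
pose f y := w y / kk + cst false y d.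
have f0 y : 0 <= f y by rewrite addr_ge0// divr_ge0 ?ltW.
pose base := (\sum_(x in A) w x) / kk +
  \sum_(nd <- q) cst (par nd == None) (lab nd) (dep nd).
have base0 : 0 <= base.
  by apply: addr_ge0; [exact: wA0 | apply: sumr_ge0 => *; exact: cst_ge0].
have acc0 m : 0 <= acc b x m by case/andP: (acc01 b x m).
have acc1 m : 0 <= 1 - acc b x m by rewrite subr_ge0; case/andP: (acc01 b x m).
apply: (@le_trans _ _ (\sum_(ys <- cands A) step_weight (nd, ys) *
    (1 - base - \sum_(y <- ys) f y))); last first.
  rewrite !big_seq; apply: ler_sum => ys ysA.
  rewrite ler_wpM2l ?step_weight_ge0//.
  have uys := cands_uniq ysA; have dys := cands_disj ysA.
  have wU : \sum_(x in A :|: [set:: ys]) w x =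
      \sum_(x in A) w x + \sum_(y <- ys) w y.
    rewrite (big_uniq _ uys) -bigU/=; last first.
      by apply/pred0P => z /=; apply/negbTE/negP => /andP[zA /dys]; rewrite zA.
    by apply: eq_bigl => z; rewrite !inE.
  apply: le_trans (IH _ _ _ _).
  - rewrite big_cat/= /base le_eqVlt; apply/orP; left; apply/eqP.
    rewrite wU.
    have -> : \sum_(nd' <- kids (nd, ys)) cst (par nd' == None) (lab nd') (dep nd')
        = \sum_(y <- ys) cst false y d.
      transitivity (\sum_(y <- map (@lab I) (kids (nd, ys))) cst false y d);
        last by rewrite lab_kids.
      rewrite !big_map; apply: eq_bigr => p _ /=.
      by rewrite /dep /= -/(dep nd) dE.
    by rewrite /f big_split/= -mulr_suml; field; rewrite gt_eqF.
  - exact: fuel_kids.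
  - move=> nd'; rewrite mem_cat inE => /orP[nd'q|].
      by rewrite qA// inE nd'q orbT.
    by move=> /(map_f lab); rewrite lab_kids inE => ->; rewrite orbT.
rewrite (eq_bigr (fun ys => arrange_weight x ys * (1 - base) -
    arrange_weight x ys * (1 - acc b x (size ys)) * (1 - base) -
    arrange_weight x ys * acc b x (size ys) * \sum_(y <- ys) f y)); last first.
  by move=> ys _; rewrite /step_weight /= -/b -/x; ring.
rewrite !sumrB -!mulr_suml.
have cs : \sum_z lam x z ^+ 2 + w x * kk / nt +
    \sum_(m < #|I|.+1) ofs x m * (1 - acc b x m) +
    (\sum_(m < #|I|.+1) ofs x m * acc b x m * m%:R) *
      \sum_y w y / Lam * f y <= cst b x d.+1 := cst_step b x d.
have h1 := sum_arrange_size_le A x acc1.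
have h2 := sum_arrange_mean_le A x acc0 f0.
have h3 := sum_arrange_ge A x.
have h4 := sum_arrange_le1 A x.
have h5 : \sum_(z in A) lam x z <= w x * kk / nt.
  rewrite /lam -mulr_suml -mulr_sumr ler_pM2r ?invr_gt0// ler_pM2l//.
rewrite big_cons -/x -/b dE -/base.
have S1 : 0 <= \sum_(ys <- cands A) arrange_weight x ys * (1 - acc b x (size ys)).
  by apply: sumr_ge0 => ys _; rewrite mulr_ge0// arrange_weight_ge0.
have -> : forall a c e : R, 1 - a - (c + e) = 1 - c - (a + e) by move=> *; ring.
rewrite -/base.
(* The old potential e gets multiplied by the mass s0 <= 1 of the step, hence counts at most once;
   the product s1 e has a favourable sign. *)
have arith (c e s0 s1 s2 s3 s4 l2 la g : R) : s1 <= s2 -> s4 <= s3 ->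
    1 - l2 - la <= s0 -> s0 <= 1 -> la <= g -> 0 <= s1 -> 0 <= e ->
    l2 + g + s2 + s3 <= c ->
    1 - c - e <= s0 * (1 - e) - s1 * (1 - e) - s4.
  move=> ? ? ? s01 ? s10 e0 ?; have : 0 <= (1 - s0) * e by rewrite mulr_ge0 ?subr_ge0.
  by have : 0 <= s1 * e by [rewrite mulr_ge0]; lra.
exact: (arith _ _ _ _ _ _ _ _ _ _ h1 h2 h3 h4 h5 S1 base0 cs).
Qed.

End lower_bound.

(** * Histories of the graph and of the trees *)

Section histories.
Context (I : finType).
Implicit Types (h : seq (step I)).

Definition slab (s : step I) : I := lab s.1.

Definition offspring h (x : I) : seq I :=
  flatten [seq s.2 | s <- h & slab s == x].

Lemma offspringE h s : uniq (map slab h) -> s \in h ->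
  offspring h (slab s) = s.2.
Proof.
elim: h => //= s' h IH /andP[s'h uh]; rewrite inE => /predU1P[->|sh].
  rewrite /offspring /= eqxx /= -[RHS]cats0; congr cat.
  rewrite (_ : seq.filter _ _ = [::])//; apply/eqP; rewrite -size_eq0 size_filter.
  rewrite -leqn0 leqNgt -has_count; apply/hasPn => s'' s''h.
  by apply: contra s'h => /eqP <-; apply/mapP; exists s''.
rewrite /offspring /= ifN; first exact: IH.
by apply: contra s'h => /eqP ->; apply/mapP; exists s.
Qed.

Lemma offspring_nil h x : x \notin map slab h -> offspring h x = [::].
Proof.
move=> xh; rewrite /offspring (_ : seq.filter _ _ = [::])//; apply/eqP.
rewrite -size_eq0 size_filter -leqn0 leqNgt -has_count; apply/hasPn => s sh.
by apply: contra xh => /eqP <-; apply/mapP; exists s.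
Qed.

End histories.

(** * Histories under the law of the graph *)

Section graph.
Context (n : nat).

Definition graph := {ffun 'I_n * 'I_n -> bool}.

Definition adj (g : graph) : rel 'I_n := fun u v =>
  if (u < v)%N then g (u, v) else if (v < u)%N then g (v, u) else false.

Lemma adj_sym g : symmetric (adj g).
Proof. by move=> u v; rewrite /adj; case: ltngtP. Qed.

Lemma adj_irrefl g : irreflexive (adj g).
Proof. by move=> u; rewrite /adj ltnn. Qed.

(* The neighbours of an expanded vertex, apart from its parent, are exactly the
   children recorded in the step. *)
Definition conform (g : graph) (s : step 'I_n) : bool :=
  [forall z, (z != slab s) && (par s.1 != Some z) ==>
             (adj g (slab s) z == (z \in s.2))].

Context (R : realType).

Definition order_weight (g : graph) (s : step 'I_n) : R :=
  (conform g s)%:R / (size s.2)`!%:R.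

Lemma order_weight_ge0 g s : 0 <= order_weight g s.
Proof. by rewrite divr_ge0. Qed.

(** Given the graph, the set of new neighbours is forced: [A] contains the vertex and its parent, so
    conformity decides every vertex outside [A]. The orders of this one set weigh at most 1
    together. *)
Lemma runs_order_weight_le1 g t (q : seq (node 'I_n)) (A : {set 'I_n}) :
  (forall nd, nd \in q -> lab nd \in A /\
     forall z, par nd = Some z -> z \in A) ->
  \sum_(h <- runs t q A) \prod_(s <- h) order_weight g s <= 1.
Proof.
elim: t q A => [|t IH] q A qA; first by rewrite sum_runs0 big_nil.
case: q => [|nd q] in qA *; first by rewrite sum_runs_nil big_nil.
have [ndA parA] := qA nd (mem_head _ _).
have qA' nd' : nd' \in q -> lab nd' \in A /\ forall z, par nd' = Some z -> z \in A.
  by move=> nd'q; apply: qA; rewrite inE nd'q orbT.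
have [d0|dn0] := eqVneq (dep nd) 0%N; first by rewrite sum_runs_leaf// IH.
rewrite sum_runs_cons//.
apply: (@le_trans _ _ (\sum_(ys <- cands A) order_weight g (nd, ys))).
  rewrite !big_seq; apply: ler_sum => ys ysA.
  rewrite ler_piMr ?order_weight_ge0// IH// => nd'; rewrite mem_cat => /orP[|].
    move=> /qA'[h1 h2]; split; first by rewrite inE h1.
    by move=> z /h2 zA; rewrite inE zA.
  move=> nd'k; split.
    by move: (map_f lab nd'k); rewrite lab_kids !inE => ->; rewrite orbT.
  by case/mapP: nd'k => p _ -> z [<-]; rewrite inE ndA.
pose H (J : {set 'I_n}) : R :=
  [forall z, (z != lab nd) && (par nd != Some z) ==>
     (adj g (lab nd) z == (z \in J))]%:R.
have -> : \sum_(ys <- cands A) order_weight g (nd, ys) =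
    \sum_(ys <- cands A) H [set:: ys] / (size ys)`!%:R.
  apply: eq_bigr => ys _; rewrite /order_weight /conform/= /H; congr (_%:R / _).
  by congr nat_of_bool; apply: eq_forallb => z; rewrite inE.
rewrite sum_cands_set.
pose J0 := [set z | (z \notin A) && adj g (lab nd) z].
have HJ (J : {set 'I_n}) : [disjoint J & A] -> J != J0 -> H J = 0.
  move=> JA JJ0; rewrite /H; case: forallP => // h; exfalso; move/eqP: JJ0; apply.
  apply/setP => z; rewrite inE; case: (boolP (z \in A)) => zA /=.
    by apply/negP => zJ; move: (disjointFr JA zJ); rewrite zA.
  apply/esym/eqP; have /implyP := h z; apply; apply/andP; split.
    by apply: contraNneq zA => ->.
  by apply/eqP => /parA; apply/negP.
have H1 J : H J <= 1 by rewrite /H lern1; case: [forall _, _].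
have [J0A|J0A] := boolP [disjoint J0 & A].
  by rewrite (bigD1 J0)//= [X in _ + X]big1 ?addr0// => J /andP[]; exact: HJ.
by rewrite big1// => J JA; apply: HJ => //; apply: contraNneq J0A => <-.
Qed.

Context (w : 'I_n -> R) (theta : R).
Hypotheses (w_gt0 : forall x, 0 < w x) (theta_gt0 : 0 < theta) (n_gt0 : (0 < n)%N).

Let nt := n%:R * theta.
Let p (e : 'I_n * 'I_n) := edge_prob w theta e.1 e.2.

Definition graph_prob (g : graph) : R :=
  \prod_e (if g e then p e else 1 - p e).

Let nt_gt0 : 0 < nt. Proof. by rewrite mulr_gt0// ltr0n. Qed.

Let p01 e : 0 <= p e <= 1.
Proof.
rewrite /p /edge_prob le_min ler01 ge_min lexx orbT !andbT.
by rewrite divr_ge0 ?mulr_ge0 ?ler0n// ltW.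
Qed.

Lemma graph_prob_ge0 g : 0 <= graph_prob g.
Proof.
apply: prodr_ge0 => e _; have /andP[? ?] := p01 e.
by case: ifP => // _; rewrite subr_ge0.
Qed.

Lemma graph_prob_cylinder (E : pred ('I_n * 'I_n)) (b : 'I_n * 'I_n -> bool) :
  \sum_(g : graph | [forall e, E e ==> (g e == b e)]) graph_prob g =
  \prod_(e | E e) (if b e then p e else 1 - p e).
Proof.
(* Values that disagree with [b] get weight 0, which turns the sum over the cylinder into a full sum
   that factorises. *)
pose F e (c : bool) : R :=
  if E e && (c != b e) then 0 else if c then p e else 1 - p e.
transitivity (\prod_e \sum_c F e c).
  rewrite bigA_distr_bigA [RHS](bigID (fun g : graph => [forall e, E e ==> (g e == b e)]))/=.
  rewrite [X in _ = _ + X]big1 ?addr0.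
    apply: eq_bigr => g /forallP gb; apply: eq_bigr => e _; rewrite /F.
    by have := gb e; case: (E e) => //= ->.
  move=> g /forallPn[e]; rewrite negb_imply => /andP[Ee ge].
  by rewrite (bigD1 e)//= /F Ee ge mul0r.
rewrite [RHS]big_mkcond; apply: eq_bigr => e _; rewrite big_bool /F.
by case: (E e); case: (b e) => /=; rewrite ?addr0 ?add0r// addrC subrK.
Qed.

Lemma sum_graph_prob : \sum_g graph_prob g = 1.
Proof.
have := graph_prob_cylinder pred0 predT; rewrite big_pred0// => <-.
by apply: eq_bigl => g; apply/esym/forallP.
Qed.

Definition history_prob (h : seq (step 'I_n)) : R :=
  \sum_g graph_prob g * \prod_(s <- h) order_weight g s.

(** The graphs that realise [h] on all pairs meeting an expanded vertex form a cylinder, whose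
    probability has one factor per pair. The left side has one factor per expanded endpoint; all are
    at most 1, so one per pair may be kept. *)
Lemma history_prob_ge (h : seq (step 'I_n)) : uniq (map (@slab _) h) ->
  (forall s s', s \in h -> s' \in h -> slab s \in s'.2 ->
     par s.1 = Some (slab s')) ->
  \prod_(s <- h) arrange_weight w nt (slab s) s.2 <= history_prob h.
Proof.
move=> uh par_h.
pose D x := x \in map (@slab _) h.
pose lam x y := w x * w y / nt.
have lam0 x y : 0 <= lam x y by rewrite divr_ge0 ?mulr_ge0 ?ler0n// ltW.
have lamC x y : lam x y = lam y x by rewrite /lam (mulrC (w x)).
pose ch := offspring h.
pose val (e : 'I_n * 'I_n) := (e.2 \in ch e.1) || (e.1 \in ch e.2).
pose E (e : 'I_n * 'I_n) := (e.1 < e.2)%N && (D e.1 || D e.2).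
have chD x y : y \in ch x -> D x.
  by apply: contraTT => /offspring_nil; rewrite /ch => ->.
have adjE (g : graph) : [forall e, E e ==> (g e == val e)] ->
    forall x z, D x || D z -> x != z -> adj g x z = val (x, z).
  move=> /forallP gE x z xz; rewrite /adj neq_ltn.
  case: ltngtP => // xz' _.
    by have := gE (x, z); rewrite /E /= xz' xz => /eqP.
  by have := gE (z, x); rewrite /E /= xz' orbC xz => /eqP ->; rewrite /val orbC.
have confE (g : graph) : [forall e, E e ==> (g e == val e)] -> forall s, s \in h -> conform g s.
  move=> gE s sh; apply/forallP => z; apply/implyP => /andP[zs pz].
  have Ds : D (slab s) by apply: map_f.
  rewrite (adjE _ gE) ?Ds// 1?eq_sym// /val /= /ch offspringE//.
  (* If the expanded vertex were itself a child of z, then z would be its parent, which conformity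
     exempts. *)
  case: (boolP (slab s \in _)) => [sz|_]; rewrite ?orbF// orbT eq_sym; exfalso.
  have /mapP[s' s'h zE] := chD _ _ sz; move: sz; rewrite /ch zE offspringE// => sz.
  by move: pz; rewrite (par_h _ _ sh s'h sz) zE eqxx.
have -> : \prod_(s <- h) arrange_weight w nt (slab s) s.2 =
    (\prod_(s <- h) \prod_z overlap (lam (slab s) z) (z \in s.2)) *
    \prod_(s <- h) ((size s.2)`!%:R)^-1 by rewrite -big_split.
apply: (@le_trans _ _ (\sum_(g : graph | [forall e, E e ==> (g e == val e)])
    graph_prob g * \prod_(s <- h) ((size s.2)`!%:R)^-1)); last first.
  rewrite /history_prob [leRHS](bigID (fun g : graph => [forall e, E e ==> (g e == val e)]))/=.
  rewrite -[leLHS]addr0 lerD//; last first.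
    by apply: sumr_ge0 => g _; rewrite mulr_ge0 ?graph_prob_ge0 ?prodr_ge0// => s _; exact: order_weight_ge0.
  apply: ler_sum => g gE; rewrite ler_wpM2l ?graph_prob_ge0//.
  rewrite !big_seq; apply: ler_prod => s sh; rewrite invr_ge0 ler0n /=.
  by rewrite /order_weight confE// mul1r.
rewrite -mulr_suml graph_prob_cylinder.
have fact0 : 0 <= \prod_(s <- h) ((size s.2)`!%:R : R)^-1.
  by apply: prodr_ge0 => s _; rewrite invr_ge0.
rewrite ler_wpM2r//.
pose c x z := if D x then overlap (lam x z) (z \in ch x) else 1.
have c0 x z : 0 <= c x z by rewrite /c; case: ifP => // _; exact: overlap_ge0.
have c1 x z : c x z <= 1 by rewrite /c; case: ifP => // _; exact: overlap_le1.
have -> : \prod_(s <- h) \prod_z overlap (lam (slab s) z) (z \in s.2) =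
    \prod_e c e.1 e.2.
  rewrite -(pair_bigA _ c)/=.
  transitivity (\prod_(x <- map (@slab _) h) \prod_z c x z).
    rewrite big_map !big_seq; apply: eq_bigr => s sh; apply: eq_bigr => z _.
    by rewrite /c /D map_f// /ch offspringE.
  rewrite (big_uniq _ uh) [RHS](bigID D)/= [X in _ = _ * X]big1 ?mulr1//.
  by move=> x /negPf xD; rewrite big1// => z _; rewrite /c xD.
(* Decreasing pairs are reflected onto increasing ones; diagonal factors are at most 1. *)
rewrite (bigID (fun e : 'I_n * 'I_n => (e.1 < e.2)%N))/=.
rewrite [X in _ * X](bigID (fun e : 'I_n * 'I_n => (e.2 < e.1)%N))/=.
apply: (@le_trans _ _ (\prod_(e : 'I_n * 'I_n | (e.1 < e.2)%N)
   (c e.1 e.2 * c e.2 e.1))).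
  rewrite big_split/= ler_wpM2l ?prodr_ge0//.
  apply: (@le_trans _ _ (\prod_(e : 'I_n * 'I_n | (e.2 < e.1)%N) c e.1 e.2)).
    rewrite (eq_bigl (fun e : 'I_n * 'I_n => (e.2 < e.1)%N)); last first.
      by move=> e; case: ltngtP.
    rewrite ler_piMr ?prodr_ge0// prodr_ile1// => e _.
    by rewrite c0 c1.
  rewrite (reindex (fun e : 'I_n * 'I_n => (e.2, e.1)))//=.
  by exists (fun e : 'I_n * 'I_n => (e.2, e.1)) => -[].
(* If one endpoint is a child of the other, the parent's factor is kept; otherwise that of an
   expanded endpoint. *)
rewrite /E big_mkcondr; apply: ler_prod => e elt; rewrite mulr_ge0//=.
have ov_true : overlap (lam e.1 e.2) true <= p e by exact: overlap_true_le.
have ov_false : overlap (lam e.1 e.2) false = 1 - p e by exact: overlap_falseE.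
case: ifPn => [De|]; last first.
  by rewrite negb_or => /andP[/negPf D1 /negPf D2]; rewrite /c D1 D2 mulr1.
case: ifPn => [/orP[e2|e1]|].
- have ce : c e.1 e.2 = overlap (lam e.1 e.2) true by rewrite /c (chD _ _ e2) e2.
  by apply: le_trans ov_true; rewrite -ce ler_piMr.
- have ce : c e.2 e.1 = overlap (lam e.1 e.2) true by rewrite /c (chD _ _ e1) e1 lamC.
  by apply: le_trans ov_true; rewrite -ce ler_piMl.
rewrite negb_or -ov_false => /andP[/negPf e2 /negPf e1].
case/orP: De => De.
- have <- : c e.1 e.2 = overlap (lam e.1 e.2) false by rewrite /c De e2.
  by rewrite ler_piMr.
- have <- : c e.2 e.1 = overlap (lam e.1 e.2) false by rewrite /c De e1 lamC.
  by rewrite ler_piMl.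
Qed.

End graph.

(** * Histories under the law of the trees *)

Section tree_side.
Context (I : finType) (R : realType) (w : I -> R) (nt : R).
Hypotheses (w_gt0 : forall x, 0 < w x) (nt_gt0 : 0 < nt).
Context (acc : bool -> I -> nat -> R) (qr : I -> nat -> R) (q : nat -> R).
Hypothesis acc01 : forall b x m, 0 <= acc b x m <= 1.
Hypothesis qr_ge0 : forall x m, 0 <= qr x m.
Hypothesis q_ge0 : forall m, 0 <= q m.

Let Lam := \sum_x w x.
Let ofs x := poisson_pmf (Lam / nt * w x).

(** The label of a root is given, so its offspring law is compared label by label; elsewhere the
    label is hidden and only the average over w-biased labels is compared with [q]. *)
Hypothesis acc_root : forall x m, ofs x m * acc true x m <= qr x m.
Hypothesis acc_inner : forall m,
  \sum_y w y / Lam * (ofs y m * acc false y m) <= q m.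

Definition node_law (nd : node I) : nat -> R :=
  if par nd == None then qr (lab nd) else q.

Definition conform_tree (M : I * seq nat -> nat) (s : step I) : bool :=
  M (addr s.1) == size s.2.

(** The division turns a joint weight of labels and offspring numbers into a conditional weight
    given [M]. *)
Definition label_weight (M : I * seq nat -> nat) (s : step I) : R :=
  (conform_tree M s)%:R *
  (step_weight w nt acc s / node_law s.1 (size s.2)).

(* The likelihood of the label of a pending node given its offspring number. *)
Let likelihood M (nd : node I) : R :=
  if dep nd == 0%N then 1 else
  ofs (lab nd) (M (addr nd)) * acc (par nd == None) (lab nd) (M (addr nd)) /
  node_law nd (M (addr nd)).

Let node_law_ge0 nd m : 0 <= node_law nd m.
Proof. by rewrite /node_law; case: ifP. Qed.

Let acc_ge0 b x m : 0 <= acc b x m.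
Proof. by case/andP: (acc01 b x m). Qed.

Lemma label_weight_ge0 M s : 0 <= label_weight M s.
Proof. by rewrite mulr_ge0// divr_ge0// step_weight_ge0. Qed.

Let likelihood_ge0 M nd : 0 <= likelihood M nd.
Proof.
by rewrite /likelihood; case: ifP => // _; rewrite divr_ge0 ?mulr_ge0 ?poisson_pmf_ge0.
Qed.

Lemma prod_kids nd m (t : m.-tuple I) (F : node I -> R) :
  \prod_(k <- kids (nd, val t)) F k =
  \prod_(i < m) F (tnth t i, Some (lab nd),
        ((addr nd).1, rcons (addr nd).2 i), (dep nd).-1).
Proof.
rewrite big_map /= (_ : zip _ _ = [seq (tnth t i, val i) | i <- enum 'I_m]).
  by rewrite big_map big_enum.
rewrite size_tuple -val_enum_ord -{1}(map_tnth_enum t).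
by elim: (enum 'I_m) => //= i s ->.
Qed.

(** At [b] = 0 this rests on the convention that 0 has inverse 0. *)
Let ratio_le1 (a b : R) : 0 <= b -> a <= b -> a / b <= 1.
Proof.
rewrite le_eqVlt => /predU1P[<-|b0] ab; first by rewrite invr0 mulr0.
by rewrite ler_pdivrMr// mul1r.
Qed.

Let likelihood_root M nd : par nd = None -> likelihood M nd <= 1.
Proof.
move=> pnd; rewrite /likelihood /node_law pnd; case: ifP => //= _.
exact: ratio_le1.
Qed.

Let likelihood_inner M p a d : 0 < Lam -> p != None ->
  \sum_y w y / Lam * likelihood M (y, p, a, d) <= 1.
Proof.
move=> L0; case: p => // p _; rewrite /likelihood /dep /=.
have [_|_] := eqVneq d 0%N.
  by under eq_bigr do rewrite mulr1; rewrite -mulr_suml divff// gt_eqF.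
rewrite (eq_bigr (fun y => w y / Lam * (ofs y (M a) * acc false y (M a)) / q (M a))).
  by rewrite -mulr_suml; exact: ratio_le1.
by move=> y _; rewrite mulrA.
Qed.

(** Pending nodes enter through the likelihood of their labels. Expanding a node releases children
    with independent w-biased labels, whose averaged likelihoods are at most 1, so the product of
    likelihoods never increases on average. *)
Lemma runs_label_weight_le M t (pq : seq (node I)) (A : {set I}) :
  (size pq + #|~: A| <= t)%N ->
  \sum_(h <- runs t pq A) \prod_(s <- h) label_weight M s <=
  \prod_(nd <- pq) likelihood M nd.
Proof.
have ll0 s : 0 <= \prod_(nd <- s) likelihood M nd by apply: prodr_ge0.
elim: t pq A => [|t IH] [|nd pq] A // fuel.
- by rewrite sum_runs_nil !big_nil.
- by rewrite sum_runs_nil !big_nil.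
have fuel' : (size pq + #|~: A| <= t)%N by [].
have [d0|dn0] := eqVneq (dep nd) 0%N.
  by rewrite sum_runs_leaf// big_cons /likelihood d0 mul1r; exact: IH.
rewrite sum_runs_cons// big_cons; set m := M (addr nd); set x := lab nd.
apply: (@le_trans _ _ (\sum_(ys <- cands A) label_weight M (nd, ys) *
  (\prod_(k <- pq) likelihood M k * \prod_(k <- kids (nd, ys)) likelihood M k))).
  rewrite big_seq [leRHS]big_seq; apply: ler_sum => ys ysA.
  rewrite ler_wpM2l ?label_weight_ge0//.
  by apply: le_trans (IH _ _ (fuel_kids nd ysA fuel')) _; rewrite big_cat.
pose C := acc (par nd == None) x m / node_law nd m * \prod_(k <- pq) likelihood M k.
have C0 : 0 <= C by rewrite mulr_ge0// divr_ge0.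
pose F ys := \prod_(k <- kids (nd, ys)) likelihood M k.
have -> : \sum_(ys <- cands A) label_weight M (nd, ys) *
    (\prod_(k <- pq) likelihood M k * \prod_(k <- kids (nd, ys)) likelihood M k) =
  C * \sum_(ys <- cands A)
    arrange_weight w nt x ys * (m == size ys)%:R * F ys.
  rewrite mulr_sumr; apply: eq_bigr => ys _.
  rewrite /label_weight /conform_tree /step_weight /= -/m -/(F ys) /C -/x.
  by case: eqP => [<-|_]; [ring|rewrite !(mulr0, mul0r)].
have L0 := sum_weight_gt0 w_gt0 x.
have -> : likelihood M nd * \prod_(j <- pq) likelihood M j = C * ofs x m.
  by rewrite /likelihood (negPf dn0) -/m -/x /C; ring.
rewrite ler_wpM2l//.
have := @sum_arrange_le _ _ w nt w_gt0 nt_gt0 A x (fun m' => (m == m')%:R) F.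
move=> /(_ (fun=> ler0n _ _) (fun=> ll0 _)) /le_trans; apply.
(* Only the length prescribed by [M] survives; the sum over the labels of that many children then
   factorises. *)
have term m' : ofs x m' * (m == m')%:R *
    (\sum_(t0 : m'.-tuple I) (\prod_(y <- t0) (w y / Lam)) * F t0) <=
    (m == m')%:R * ofs x m.
  case: eqP => [<-|_]; last by rewrite mulr0 !mul0r.
  rewrite mulr1 mul1r ler_piMr ?poisson_pmf_ge0//.
  under eq_bigr => t0 _ do rewrite /F prod_kids big_tuple -big_split/=.
  rewrite (sum_tuple_prod (fun i y => w y / Lam *
     likelihood M (y, Some (lab nd), ((addr nd).1, rcons (addr nd).2 i), (dep nd).-1))).
  apply: prodr_ile1 => i _; rewrite likelihood_inner// andbT sumr_ge0// => y _.
  by rewrite mulr_ge0// divr_ge0 ?ltW.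
apply: (@le_trans _ _ (\sum_(i < #|I|.+1) (m == i)%:R * ofs x m)).
  by apply: ler_sum => i _; exact: term.
rewrite -mulr_suml ler_piMl ?poisson_pmf_ge0//.
case: (ltnP m #|I|.+1) => [mI|Im].
  rewrite (bigD1 (Ordinal mI))//= eqxx big1 ?addr0// => i /eqP im.
  by case: eqP => // mi; case: im; apply/val_inj.
rewrite big1// => i _; case: eqP => // mi.
by move: (ltn_ord i); rewrite -mi ltnNge Im.
Qed.

Lemma runs_label_weight_le1 M t (pq : seq (node I)) (A : {set I}) :
  (size pq + #|~: A| <= t)%N -> (forall nd, nd \in pq -> par nd = None) ->
  \sum_(h <- runs t pq A) \prod_(s <- h) label_weight M s <= 1.
Proof.
move=> fuel pq_root; apply: le_trans (runs_label_weight_le _ fuel) _.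
rewrite big_seq; apply: prodr_ile1 => nd /pq_root pnd.
by rewrite likelihood_ge0 likelihood_root.
Qed.

End tree_side.

(** * Loss of mass along the generations *)

Section potential.
Context (I : finType) (R : realType) (w : I -> R) (nt : R).
Hypotheses (w_gt0 : forall x, 0 < w x) (nt_gt0 : 0 < nt).
Context (acc : bool -> I -> nat -> R).
Hypothesis acc01 : forall b x m, 0 <= acc b x m <= 1.

Let Lam := \sum_x w x.
Let ofs x := poisson_pmf (Lam / nt * w x).
Let G2 := (\sum_x w x ^+ 2) / nt.
Let G3 := (\sum_x w x ^+ 3) / nt.

(** The sum stops at [#|I|] because a step cannot record more children than there are vertices. *)
Definition reject (b : bool) (x : I) : R :=
  \sum_(m < #|I|.+1) ofs x m * (1 - acc b x m).

Definition accepted_mean (b : bool) (x : I) : R :=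
  \sum_(m < #|I|.+1) ofs x m * acc b x m * m%:R.

Context (tau rho g2 : R).
Hypotheses (tau_ge0 : 0 <= tau) (g2_ge0 : 0 <= g2).
Hypothesis ofs_mean : forall x, \sum_(m < #|I|.+1) ofs x m * m%:R <= Lam / nt * w x.
Hypothesis reject_inner : \sum_y w y / Lam * reject false y <= tau.
Hypothesis mean_inner : \sum_y w y / Lam * accepted_mean false y <= g2.
Hypothesis reject_root : forall x, reject true x <= w x * rho.
Hypothesis mean_root : forall x, accepted_mean true x <= w x.

Definition root_nodes (l : nat) (V : {set I}) : seq (node I) :=
  [seq (v, None, (v, [::]), l) | v <- enum V].

Section fixed_threshold.
Context (kk : R).
Hypothesis kk_gt0 : 0 < kk.

(** Graph loss per unit of weight. Collisions give [kk]/[nt]; the children, of mean total weight at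
    most G2 per unit, give the charge G2/[kk], their own mismatch G2 G3/[nt], and the loss further
    down. *)
Let Fixpoint B (d : nat) : R :=
  if d is d'.+1 then kk / nt + G2 / kk + G2 * G3 / nt + G2 * B d' else 0.

(** Offspring loss below a vertex with w-biased label; only accepted children pass it on, hence the
    factor [g2]. *)
Let Fixpoint T (d : nat) : R := if d is d'.+1 then tau + g2 * T d' else 0.

Let graph_cost x d := w x ^+ 2 * G2 / nt + w x * B d.
Let tree_cost b x d : R :=
  if d is d'.+1 then reject b x + accepted_mean b x * T d' else 0.
Let cost b x d := graph_cost x d + tree_cost b x d.

Let w0 x : 0 <= w x := ltW (w_gt0 x).
Let nt0 : 0 <= nt := ltW nt_gt0.
Let kk0 : 0 <= kk := ltW kk_gt0.

Let G2_ge0 : 0 <= G2.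
Proof. by rewrite divr_ge0// sumr_ge0// => x _; rewrite sqr_ge0. Qed.

Let G3_ge0 : 0 <= G3.
Proof. by rewrite divr_ge0// sumr_ge0// => x _; rewrite exprn_ge0. Qed.

Let B_ge0 d : 0 <= B d.
Proof. elim: d => //= d IH; apply: addr_ge0 (mulr_ge0 G2_ge0 IH).
apply: addr_ge0 (divr_ge0 (mulr_ge0 G2_ge0 G3_ge0) nt0).
exact: addr_ge0 (divr_ge0 kk0 nt0) (divr_ge0 G2_ge0 kk0). Qed.

Let T_ge0 d : 0 <= T d.
Proof. by elim: d => //= d IH; rewrite addr_ge0 ?mulr_ge0. Qed.

Let reject_ge0 b x : 0 <= reject b x.
Proof.
apply: sumr_ge0 => m _; rewrite mulr_ge0 ?poisson_pmf_ge0// subr_ge0.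
by case/andP: (acc01 b x m).
Qed.

Let accepted_mean_ge0 b x : 0 <= accepted_mean b x.
Proof.
apply: sumr_ge0 => m _; rewrite !mulr_ge0 ?poisson_pmf_ge0//.
by case/andP: (acc01 b x m).
Qed.

Let tree_cost_ge0 b x d : 0 <= tree_cost b x d.
Proof. by case: d => //= d; rewrite addr_ge0 ?mulr_ge0. Qed.

Let graph_cost_ge0 x d : 0 <= graph_cost x d.
Proof.
apply: addr_ge0 (mulr_ge0 (w0 x) (B_ge0 d)).
exact: divr_ge0 (mulr_ge0 (sqr_ge0 _) G2_ge0) nt0.
Qed.

(** Adding 1/[kk] + G3/[nt] turns the recursion into u(d+1) = X + G2 u(d), with X the last bracket.
    The added 1/[kk] later pays the charge of the starting set. *)
Let B_le d : B d + kk^-1 + G3 / nt <= (G2 + 1) ^+ d * (G3 / nt + kk^-1 + kk / nt).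
Proof.
have kn0 : 0 <= kk / nt := divr_ge0 kk0 nt0.
have ki0 : 0 <= kk^-1 by rewrite invr_ge0.
set X := G3 / nt + _ + _.
have X0 : 0 <= X := addr_ge0 (addr_ge0 (divr_ge0 G3_ge0 nt0) ki0) kn0.
elim: d => [|d IH]; first by rewrite /= expr0 mul1r add0r /X; lra.
have p1 : 1 <= (G2 + 1) ^+ d by rewrite exprn_ege1// lerDr.
have -> : B d.+1 + kk^-1 + G3 / nt = X + G2 * (B d + kk^-1 + G3 / nt).
  by rewrite /= /X; ring.
have -> : (G2 + 1) ^+ d.+1 * X = (G2 + 1) ^+ d * X + G2 * ((G2 + 1) ^+ d * X).
  by rewrite exprS; ring.
exact: lerD (ler_peMl X0 p1) (ler_wpM2l G2_ge0 IH).
Qed.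

Let T_le d : T d <= (g2 + 1) ^+ d * tau.
Proof.
elim: d => [|d IH] /=; first by rewrite mul1r.
have p1 : 1 <= (g2 + 1) ^+ d by rewrite exprn_ege1// lerDr.
have -> : (g2 + 1) ^+ d.+1 * tau = (g2 + 1) ^+ d * tau + g2 * ((g2 + 1) ^+ d * tau).
  by rewrite exprS; ring.
exact: lerD (ler_peMl tau_ge0 p1) (ler_wpM2l g2_ge0 IH).
Qed.

(** The graph part bounds accepted offspring by the Poisson mean G1 w_x, and G1 times the w-biased
    mean weight is G2. In the tree part the labels of the children are averaged first, where
    [reject_inner] and [mean_inner] apply. *)
Let cost_step b x d :
  \sum_z (w x * w z / nt) ^+ 2 + w x * kk / nt +
  \sum_(m < #|I|.+1) ofs x m * (1 - acc b x m) +
  (\sum_(m < #|I|.+1) ofs x m * acc b x m * m%:R) *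
    \sum_y w y / Lam * (w y / kk + cost false y d) <= cost b x d.+1.
Proof.
have L0 : 0 < Lam := sum_weight_gt0 w_gt0 x.
rewrite -/(reject b x) -/(accepted_mean b x).
have -> : \sum_z (w x * w z / nt) ^+ 2 = w x ^+ 2 * G2 / nt.
  rewrite /G2 mulrA mulr_sumr !mulr_suml; apply: eq_bigr => z _.
  by field; rewrite gt_eqF.
have mean_le : accepted_mean b x <= Lam / nt * w x.
  apply: le_trans (ofs_mean x); apply: ler_sum => m _.
  by rewrite ler_wpM2r// ler_piMr ?poisson_pmf_ge0//; case/andP: (acc01 b x m).
under eq_bigr do rewrite /cost addrA mulrDr; rewrite big_split/= mulrDr.
have hT : \sum_y w y / Lam * tree_cost false y d <= T d.
  case: d => [|d] /=; first by rewrite big1// => y _; rewrite mulr0.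
  under eq_bigr do rewrite mulrDr mulrA; rewrite big_split/= -mulr_suml.
  by rewrite lerD// ler_wpM2r.
have hG : accepted_mean b x * (\sum_y w y / Lam * (w y / kk + graph_cost y d)) <=
    w x * (G2 / kk + G2 * G3 / nt + G2 * B d).
  apply: (@le_trans _ _ (Lam / nt * w x *
      (\sum_y w y / Lam * (w y / kk + graph_cost y d)))).
    rewrite ler_wpM2r// sumr_ge0// => y _.
    apply: mulr_ge0; first exact: divr_ge0 (w0 y) (ltW L0).
    exact: addr_ge0 (divr_ge0 (w0 y) kk0) (graph_cost_ge0 y d).
  rewrite le_eqVlt; apply/orP; left; apply/eqP.
  rewrite (eq_bigr (fun y => Lam^-1 * (w y ^+ 2 * (kk^-1 + B d)) +
    Lam^-1 * (w y ^+ 3 * (G2 / nt)))); last by move=> y _; rewrite /graph_cost; ring.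
  rewrite big_split/= -!mulr_sumr -!mulr_suml.
  have -> : \sum_x w x ^+ 2 = G2 * nt by rewrite /G2 divfK// gt_eqF.
  have -> : \sum_x w x ^+ 3 = G3 * nt by rewrite /G3 divfK// gt_eqF.
  by move: (G2) (G3) => y z; field; rewrite !gt_eqF.
have hA : accepted_mean b x * (\sum_y w y / Lam * tree_cost false y d) <=
    accepted_mean b x * T d by rewrite ler_wpM2l.
rewrite /cost /graph_cost /= -/T -/B.
have -> : w x * (kk / nt + G2 / kk + G2 * G3 / nt + G2 * B d) =
  w x * kk / nt + w x * (G2 / kk + G2 * G3 / nt + G2 * B d) by ring.
move: hG hA; set a1 := accepted_mean _ _ * _; set a2 := accepted_mean _ _ * _.
by move: (w x * (_ + _)) (accepted_mean b x * T d) => *; lra.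
Qed.

(** For l = 0 nothing is expanded and no offspring is rejected. Otherwise a root v loses at most w_v
    [rho] itself and has at most w_v accepted children on average, each with l - 1 generations
    left. *)
Lemma exploration_mass_ge l (V : {set I}) :
  1 - (G2 / nt * \sum_(v in V) w v ^+ 2 +
       (G2 + 1) ^+ l * (G3 / nt + kk^-1 + kk / nt) * \sum_(v in V) w v +
       (\sum_(v in V) w v) * (if l is l'.+1 then rho + (g2 + 1) ^+ l' * tau else 0)) <=
  \sum_(h <- runs #|I| (root_nodes l V) V) \prod_(s <- h) step_weight w nt acc s.
Proof.
have cost_ge0 b x d : 0 <= cost b x d by rewrite addr_ge0.
have fuel : (size (root_nodes l V) + #|~: V| <= #|I|)%N by rewrite size_map -cardE cardsC.
have rootsV nd : nd \in root_nodes l V -> lab nd \in V.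
  by move=> /mapP[v]; rewrite mem_enum => vV ->.
have := runs_weight_ge w_gt0 nt_gt0 kk_gt0 acc01 cost_ge0 cost_step fuel rootsV.
apply: le_trans.
have -> : \sum_(nd <- root_nodes l V) cost (par nd == None) (lab nd) (dep nd) =
    \sum_(v in V) graph_cost v l + \sum_(v in V) tree_cost true v l.
  by rewrite big_map big_enum -big_split.
have hT : \sum_(v in V) tree_cost true v l <=
    (\sum_(v in V) w v) * (if l is l'.+1 then rho + (g2 + 1) ^+ l' * tau else 0).
  rewrite mulr_suml; apply: ler_sum => v _; case: (l) => [|l'] /=.
    by rewrite mulr0.
  rewrite mulrDr; apply: lerD; first exact: reject_root.
  apply: ler_pM; [exact: accepted_mean_ge0|exact: T_ge0|exact: mean_root|exact: T_le].
have S0 : 0 <= \sum_(v in V) w v by apply: sumr_ge0.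
have hB := ler_wpM2r S0 (B_le l).
have hG : 0 <= G3 / nt * (\sum_(v in V) w v).
  exact: mulr_ge0 (divr_ge0 G3_ge0 nt0) S0.
have -> : \sum_(v in V) graph_cost v l =
    G2 / nt * (\sum_(v in V) w v ^+ 2) + B l * (\sum_(v in V) w v).
  by rewrite big_split/= -!mulr_suml; ring.
move: hT hB hG; set t1 := \sum_(v in V) tree_cost _ _ _.
set t2 := _ * (if _ is _.+1 then _ else _); set t3 := _ ^+ l * _ * _.
rewrite !mulrDl; set s1 := \sum_(v in V) w v.
by rewrite (mulrC s1) => *; lra.
Qed.

End fixed_threshold.
End potential.

(** * Shared histories give isomorphic neighbourhoods *)

Section nodes.
Context (I : finType).

Definition kid (nd : node I) (y : I) (i : nat) : node I :=
  (y, Some (lab nd), ((addr nd).1, rcons (addr nd).2 i), (dep nd).-1).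

Lemma kidsP (s : step I) (k : node I) :
  reflect (exists2 i, (i < size s.2)%N & k = kid s.1 (nth (lab s.1) s.2 i) i)
    (k \in kids s).
Proof.
have nthE i : (i < size s.2)%N ->
    nth (lab s.1, 0%N) (zip s.2 (iota 0 (size s.2))) i = (nth (lab s.1) s.2 i, i).
  by move=> si; rewrite nth_zip ?size_iota// nth_iota// add0n.
apply: (iffP mapP) => [[p /(nthP (lab s.1, 0%N))[i]]|[i si ->]].
  by rewrite size_zip size_iota minnn => si; rewrite nthE// => <- ->; exists i.
exists (nth (lab s.1) s.2 i, i) => //.
rewrite -nthE//; apply: mem_nth.
by rewrite size_zip size_iota minnn.
Qed.

Definition all_nodes (q : seq (node I)) (h : seq (step I)) : seq (node I) :=
  q ++ flatten [seq kids s | s <- h].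

Lemma all_nodes_cons nd q s h :
  all_nodes (nd :: q) (s :: h) = nd :: all_nodes (q ++ kids s) h.
Proof. by rewrite /all_nodes /= catA. Qed.

Lemma runs_children t q (A : {set I}) h : h \in runs t q A ->
  let c := map lab (flatten [seq kids s | s <- h]) in
  uniq c /\ forall x, x \in c -> x \notin A.
Proof.
elim: t q A h => [|t IH] [|nd q] A h /=; rewrite ?inE; try by move=> /eqP ->.
case: ifPn => [_ /IH //|_ /flatten_mapP[ys ysA /mapP[h' /IH/=[uh hA] ->]]] /=.
rewrite map_cat lab_kids cat_uniq uh (cands_uniq ysA)/= andbT; split.
  by apply/hasPn => x /hA; rewrite !inE negb_or => /andP[].
move=> x; rewrite mem_cat => /orP[/(cands_disj ysA)//|/hA].
by rewrite inE negb_or => /andP[].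
Qed.

(** With enough fuel no pending node is abandoned: all nodes with generations left are expanded, in
    order of creation. *)
Lemma runs_steps t q (A : {set I}) h : (size q + #|~: A| <= t)%N ->
  h \in runs t q A -> map fst h = [seq nd <- all_nodes q h | dep nd != 0%N].
Proof.
elim: t q A h => [|t IH] [|nd q] A h fuel; rewrite /= ?inE; try by move=> /eqP ->.
have fuel' : (size q + #|~: A| <= t)%N by [].
case: ifPn => [d0 /(IH _ _ _ fuel')-> //|d0].
move=> /flatten_mapP[ys ysA /mapP[h' /(IH _ _ _ (fuel_kids nd ysA fuel')) e ->]].
by rewrite -[_ ++ flatten _]/(behead (all_nodes (nd :: q) ((nd, ys) :: h'))) all_nodes_cons /= e.
Qed.

Lemma runs_all (P : node I -> Prop) t q (A : {set I}) h :
  (forall nd y i, dep nd != 0%N -> P nd -> P (kid nd y i)) ->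
  (forall nd, nd \in q -> P nd) ->
  h \in runs t q A -> forall nd, nd \in all_nodes q h -> P nd.
Proof.
move=> Pkid; elim: t q A h => [|t IH] [|nd q] A h Pq /=;
  rewrite ?inE; try by move=> /eqP ->; rewrite /all_nodes cats0.
have Pq' nd' : nd' \in q -> P nd' by move=> nd'q; apply: Pq; rewrite inE nd'q orbT.
have Pnd : P nd by apply: Pq; rewrite mem_head.
case: ifPn => [_ hr nd'|d0].
  by rewrite /= inE => /predU1P[->//|]; apply: IH hr _.
move=> /flatten_mapP[ys ysA /mapP[h' hr ->]] nd'.
rewrite -/(all_nodes _ _) all_nodes_cons inE => /predU1P[->//|].
apply: IH hr _ => k; rewrite mem_cat => /orP[/Pq'//|/kidsP[i _ ->]].
exact: Pkid.
Qed.

End nodes.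

Section history.
Context (I : finType) (l : nat) (V : {set I}) (h : seq (step I)).
Hypothesis hV : h \in runs #|I| (root_nodes l V) V.

Let nodes := all_nodes (root_nodes l V) h.

Let fuel : (size (root_nodes l V) + #|~: V| <= #|I|)%N.
Proof. by rewrite size_map -cardE cardsC. Qed.

Lemma roots_lab : map lab (root_nodes l V) = enum V.
Proof. by rewrite -map_comp map_id. Qed.

Lemma nodes_lab_uniq : uniq (map lab nodes).
Proof.
have [uc cV] := runs_children hV.
rewrite map_cat cat_uniq uc roots_lab enum_uniq andbT /=.
by apply/hasPn => x /cV; rewrite mem_enum.
Qed.

Lemma node_lab_inj nd nd' : nd \in nodes -> nd' \in nodes ->
  lab nd = lab nd' -> nd = nd'.
Proof.
move=> ndn nd'n e.
have /(nthP nd)[i si ni] := ndn; have /(nthP nd)[j sj nj] := nd'n.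
move: e; rewrite -ni -nj -!(nth_map nd (lab nd))// => /eqP.
by rewrite nth_uniq ?size_map ?nodes_lab_uniq// => /eqP ->.
Qed.

Lemma step_node s : s \in h -> s.1 \in nodes /\ dep s.1 != 0%N.
Proof.
move=> sh; have : s.1 \in map fst h by apply: map_f.
by rewrite (runs_steps fuel hV) mem_filter => /andP[].
Qed.

Lemma node_step nd : nd \in nodes -> dep nd != 0%N ->
  exists2 s, s \in h & s.1 = nd.
Proof.
move=> ndn d0; have : nd \in map fst h by rewrite (runs_steps fuel hV) mem_filter d0.
by move=> /mapP[s sh ->]; exists s.
Qed.

Lemma step_nodes_uniq : uniq (map fst h).
Proof.
by rewrite (runs_steps fuel hV) filter_uniq// (map_uniq nodes_lab_uniq).
Qed.

Lemma step_inj s s' : s \in h -> s' \in h -> s.1 = s'.1 -> s = s'.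
Proof.
move=> sh s'h e.
have /(nthP s)[i si ni] := sh; have /(nthP s)[j sj nj] := s'h.
move: e; rewrite -ni -nj -!(nth_map s s.1)// => /eqP.
by rewrite nth_uniq ?size_map ?step_nodes_uniq// => /eqP ->.
Qed.

Lemma slab_uniq : uniq (map (@slab I) h).
Proof.
rewrite (_ : @slab I = @lab I \o fst)// map_comp (runs_steps fuel hV).
exact: subseq_uniq (map_subseq _ (filter_subseq _ _)) nodes_lab_uniq.
Qed.

Lemma kid_node s k : s \in h -> k \in kids s -> k \in nodes.
Proof.
by move=> sh ks; rewrite mem_cat; apply/orP; right; apply/flatten_mapP; exists s.
Qed.

Lemma nodeP nd : nd \in nodes ->
  (exists2 v, v \in V & nd = (v, None, (v, [::]), l)) \/
  (exists s i, [/\ s \in h, (i < size s.2)%N &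
     nd = kid s.1 (nth (lab s.1) s.2 i) i]).
Proof.
rewrite mem_cat => /orP[/mapP[v]|/flatten_mapP[s sh /kidsP[i si ->]]].
  by rewrite mem_enum => vV ->; left; exists v.
by right; exists s, i.
Qed.

Lemma node_depth nd : nd \in nodes -> (size (addr nd).2 + dep nd = l)%N.
Proof.
apply: (@runs_all _ (fun nd => size (addr nd).2 + dep nd = l)%N _ _ _ _ _ _ hV) =>
  [nd' y i d0 <-|nd' /mapP[v _ ->]//].
by rewrite /addr /dep /= size_rcons addSnnS prednK// lt0n.
Qed.

(** Induction on the word: an address determines the parent's address and the rank among the
    siblings. *)
Lemma node_addr_inj nd nd' : nd \in nodes -> nd' \in nodes ->
  addr nd = addr nd' -> nd = nd'.
Proof.
suff H u v nd1 nd2 : nd1 \in nodes -> nd2 \in nodes ->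
    addr nd1 = (v, u) -> addr nd2 = (v, u) -> nd1 = nd2.
  move=> ndn nd'n e; apply: (H (addr nd).2 (addr nd).1) => //.
    by rewrite -surjective_pairing.
  by rewrite -e -surjective_pairing.
elim/last_ind: u nd1 nd2 => [|u i IH] nd1 nd2 n1 n2.
  case: (nodeP n1) => [[v' v'V ->]|[s [j [_ _ ->]]]]; rewrite {1}/addr /=; last first.
    by move=> [_]; case: (addr s.1).2.
  case: (nodeP n2) => [[v'' v''V ->]|[s [j [_ _ ->]]]]; rewrite /addr /=.
    by move=> [->] [->].
  by move=> _ [_]; case: (addr s.1).2.
case: (nodeP n1) => [[v' v'V ->]|]; first by rewrite /addr /=; case: (u) => [|? ?] [].
move=> [s [j [sh js ->]]]; rewrite {1}/addr /= => -[e1 /rcons_inj[e2 e3]].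
case: (nodeP n2) => [[v'' v''V ->]|]; first by rewrite /addr /=; case: (u) => [|? ?] [].
move=> [s' [j' [s'h js' ->]]]; rewrite {1}/addr /= => -[e1' /rcons_inj[e2' e3']].
have e : s.1 = s'.1.
  have [sn _] := step_node sh; have [s'n _] := step_node s'h.
  apply: IH => //.
    by rewrite [LHS]surjective_pairing e1 e2.
  by rewrite [LHS]surjective_pairing e1' e2'.
by rewrite e3 e3' (step_inj sh s'h e).
Qed.

(** Labels are unique along a history, so a node bearing the label of a child of [s'] is that
    child. *)
Lemma step_par s s' : s \in h -> s' \in h -> slab s \in s'.2 ->
  par s.1 = Some (slab s').
Proof.
move=> sh s'h; rewrite -(lab_kids s') => /mapP[k ks e].
have [sn _] := step_node sh.
by rewrite (node_lab_inj sn (kid_node s'h ks) e); case/kidsP: ks => i _ ->.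
Qed.

Lemma step_addr_uniq : uniq [seq addr s.1 | s <- h].
Proof.
rewrite map_inj_in_uniq ?(map_uniq step_nodes_uniq)// => s s' sh s'h e.
have [sn _] := step_node sh; have [s'n _] := step_node s'h.
by apply: (step_inj sh s'h); exact: node_addr_inj.
Qed.

(** Reconciles the two marks of a root: the missing parent, used in the masses, and the empty word,
    used in the law of the trees. *)
Lemma step_rootP s : s \in h ->
  (par s.1 == None) = ((addr s.1).2 == [::]) /\
  ((addr s.1).2 == [::] -> (addr s.1).1 = lab s.1).
Proof.
move=> /step_node[/nodeP[[v _ ->]//|[s' [i [_ _ ->]]]] _].
by rewrite /addr /=; case: (addr s'.1).2.
Qed.

End history.

Section neighbourhood_tree.
Context (n l : nat) (V : {set 'I_n}) (h : seq (step 'I_n)).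
Hypothesis hV : h \in runs #|'I_n| (root_nodes l V) V.
Context (g : graph n) (M : 'I_n * seq nat -> nat) (v : 'I_n).
Hypothesis g_conform : forall s, s \in h -> conform g s.
Hypothesis M_conform : forall s, s \in h -> conform_tree M s.
Hypothesis vV : v \in V.

Let nodes := all_nodes (root_nodes l V) h.
Let root : node 'I_n := (v, None, (v, [::]), l).
Let G := adj g.
Let tree := tree_of_offspring (fun u => M (v, u)).

Let root_in : root \in nodes.
Proof. by rewrite mem_cat (map_f (fun v => (v, None, (v, [::]), l))) ?mem_enum. Qed.

Let depth_le nd : nd \in nodes -> (size (addr nd).2 <= l)%N.
Proof. by move=> /(node_depth hV) <-; rewrite leq_addr. Qed.

Let nodeP' nd : nd \in nodes -> (addr nd).1 = v ->
  nd = root \/ exists s i, [/\ s \in h, (i < size s.2)%N, (addr s.1).1 = v &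
     nd = kid s.1 (nth (lab s.1) s.2 i) i].
Proof.
move=> /nodeP[[v' v'V ->]|[s [i [sh si ->]]]]; rewrite /addr /= => e.
  by left; rewrite /root -e.
by right; exists s, i.
Qed.

Let tree_rcons u i : tree (rcons u i) <-> tree u /\ (i < M (v, u))%N.
Proof.
split=> [T|[T iM] s j /prefixP[s2]].
  split; last by apply: T; exact: prefix_refl.
  by move=> s j p; apply: T; apply: prefix_trans p (prefix_rcons _ _).
case/lastP: s2 => [|s2 k]; first by rewrite cats0 => /rcons_inj[<- <-].
rewrite -rcons_cat => /rcons_inj[e _]; apply: T; rewrite e; exact: prefix_prefix.
Qed.

Let tree_nil : tree [::].
Proof. by move=> s i /prefixP[s2]; rewrite cat_rcons; case: s. Qed.

Let tree_node u : tree u -> (size u <= l)%N ->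
  exists2 nd, nd \in nodes & addr nd = (v, u).
Proof.
elim/last_ind: u => [|u i IH]; first by exists root.
rewrite size_rcons => /tree_rcons[Tu iM] ul.
have [nd ndn ae] := IH Tu (ltnW ul).
have d0 : dep nd != 0%N.
  by apply: contraTneq ul => d0; have := node_depth hV ndn; rewrite d0 ae addn0 => ->; rewrite ltnn.
have [s sh se] := node_step hV ndn d0.
have si : (i < size s.2)%N by move/eqP: (M_conform sh); rewrite se ae => <-.
exists (kid s.1 (nth (lab s.1) s.2 i) i); last by rewrite /kid /addr /= se -/(addr nd) ae.
by apply: kid_node sh _; apply/kidsP; exists i.
Qed.

Let node_tree nd : nd \in nodes -> (addr nd).1 = v -> tree (addr nd).2.
Proof.
move E : (addr nd).2 => u; elim/last_ind: u nd E => [|u i IH] nd E ndn nv //.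
case: (nodeP' ndn nv) E => [->|[s [j [sh sj sv ->]]]]; first by case: (u).
rewrite /addr /= => /rcons_inj[e <-]; apply/tree_rcons; split.
  by apply: IH e _ sv; case: (step_node hV sh).
by rewrite -e -sv -surjective_pairing; move/eqP: (M_conform sh) => ->.
Qed.

Let child_of s k : s \in h -> k \in kids s ->
  [/\ k \in nodes, par k = Some (lab s.1), lab k \in s.2 &
      exists i, addr k = ((addr s.1).1, rcons (addr s.1).2 i)].
Proof.
move=> sh ks; split; first exact: kid_node sh ks.
- by case/kidsP: ks => i _ ->.
- by rewrite -(lab_kids s) map_f.
- by case/kidsP: ks => i _ ->; exists i.
Qed.

Let adj_child s k : s \in h -> k \in kids s -> G (lab s.1) (lab k).
Proof.
move=> sh ks; have [kn kp ks2 [i ka]] := child_of sh ks.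
have [sn _] := step_node hV sh.
have /forallP/(_ (lab k))/implyP := g_conform sh.
rewrite ks2 => H; suff /H/eqP : (lab k != slab s) && (par s.1 != Some (lab k)) by [].
(* The two vertices exempted by conformity, the node and its parent, have words shorter than the
   child's by one and two letters. *)
apply/andP; split.
  apply/eqP => /(node_lab_inj hV kn sn) e; move: ka; rewrite e => /(congr1 (size \o snd)).
  by rewrite /= size_rcons => /n_Sn.
apply/eqP => sp.
case: (nodeP sn) => [[v' _ e]|[s' [j [s'h s'j e]]]]; first by move: sp; rewrite e.
have [s'n _] := step_node hV s'h.
have : lab s'.1 = lab k by move: sp; rewrite e => -[].
move=> /(node_lab_inj hV s'n kn) e'; move: ka; rewrite -e' e => /(congr1 (size \o snd)).
by rewrite /= !size_rcons => /eqP; rewrite -addn2 -[X in X == _]addn0 eqn_add2l.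
Qed.

(** A simple path from the root can only descend: the parent of its endpoint already lies on it, so
    by conformity the next vertex is a child. The clause on [belast] carries this through the
    induction. *)
Let path_node p : short_path G l v p ->
  exists nd, [/\ nd \in nodes, addr nd = (v, (addr nd).2), lab nd = last v p,
    size (addr nd).2 = size p &
    (forall z, par nd = Some z -> z \in belast v p) /\
    (forall p' y, p = rcons p' y -> par nd = Some (last v p'))].
Proof.
elim/last_ind: p => [|p y IH] [pp up sp].
  by exists root; split => //; split => // -[].
move: pp up sp; rewrite rcons_path -rcons_cons rcons_uniq size_rcons => /andP[pp Gy].
move=> /andP[yp up] sp.
have [|nd [ndn ae le se [pb _]]] := IH; first by split => //; exact: ltnW.
have d0 : dep nd != 0%N.
  by apply: contraTneq sp => d0; have := node_depth hV ndn; rewrite d0 addn0 se => ->; rewrite ltnn.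
have [s sh e] := node_step hV ndn d0.
have ys : y \in s.2.
  have /forallP/(_ y)/implyP := g_conform sh; rewrite /slab e le -/G Gy => H.
  suff /H/eqP <- : (y != last v p) && (par nd != Some y) by [].
  apply/andP; split.
    by apply: contraNneq yp => ->; exact: mem_last.
  by apply/eqP => /pb /mem_belast; apply/negP.
have /mapP[k ks ye] : y \in map lab (kids s) by rewrite lab_kids.
have [kn kp _ [i ka]] := child_of sh ks.
exists k; split => //.
- by rewrite ka /= e ae.
- by rewrite last_rcons.
- by rewrite ka /= size_rcons e se.
- split; last by move=> p' y' /rcons_inj[<- _]; rewrite kp e le.
  by move=> z; rewrite kp e le belast_rcons => -[<-]; exact: mem_last.
Qed.

Let lab_root_addr nd : nd \in nodes -> (addr nd).2 = [::] -> (addr nd).1 = v -> nd = root.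
Proof.
move=> ndn e1 e2; apply: (node_addr_inj hV ndn root_in).
by rewrite [LHS]surjective_pairing e1 e2.
Qed.

(** The last clause keeps the path no deeper than [nd], so that the label of a child of [nd] is new
    to it. *)
Let good_path nd p := [/\ short_path G l v p, last v p = lab nd,
  size p = size (addr nd).2 &
  forall y, y \in v :: p -> exists nd', [/\ nd' \in nodes, lab nd' = y &
    (size (addr nd').2 <= size (addr nd).2)%N]].

Let extend_path s k p : s \in h -> k \in kids s -> good_path s.1 p ->
  good_path k (rcons p (lab k)).
Proof.
move=> sh ks [[pp up pl] lp sp yp].
have [kn kp _ [i ka]] := child_of sh ks.
have kp' : lab k \notin v :: p.
  apply/negP => /yp[nd' [nd'n /(node_lab_inj hV nd'n kn) ->]].
  by rewrite ka size_rcons ltnn.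
have sk : size (rcons p (lab k)) = size (addr k).2.
  by rewrite ka !size_rcons sp.
split => //; first split.
- by rewrite rcons_path pp lp (adj_child sh ks).
- by rewrite -rcons_cons rcons_uniq kp' up.
- by rewrite sk depth_le.
- by rewrite last_rcons.
move=> y; rewrite -rcons_cons mem_rcons inE => /predU1P[->|/yp[nd' [? ? le]]].
  by exists k.
by exists nd'; split => //; rewrite ka size_rcons; exact: leqW.
Qed.

Let node_path nd : nd \in nodes -> (addr nd).1 = v -> exists p, good_path nd p.
Proof.
move E : (addr nd).2 => u; elim/last_ind: u nd E => [|u i IH] nd E ndn nv.
  exists [::]; rewrite (lab_root_addr ndn E nv); split => // y; rewrite inE => /eqP ->.
  by exists root.
case: (nodeP' ndn nv) E => [->|[s [j [sh sj sv ke]]]]; first by case: (u).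
rewrite {1}ke /addr /= => /rcons_inj[e _]; have [sn _] := step_node hV sh.
have [p gp] := IH _ e sn sv; exists (rcons p (lab nd)).
by apply: extend_path gp => //; rewrite ke; apply/kidsP; exists j.
Qed.

(** The isomorphism. Vertices outside the history get the default value, the root's word. *)
Let address x : seq nat := (addr (nth root nodes (index x (map lab nodes)))).2.

Let addressE nd : nd \in nodes -> address (lab nd) = (addr nd).2.
Proof.
move=> ndn; rewrite /address; congr (addr _).2.
have /(nthP root)[i si ni] := ndn; rewrite -ni -(nth_map root v)//.
by rewrite index_uniq ?size_map// (nodes_lab_uniq hV).
Qed.

Let vertP x : rg_verts (neighbourhood G l v) x <->
  exists nd, [/\ nd \in nodes, lab nd = x & (addr nd).1 = v].
Proof.
split=> [[p sp]|[nd [ndn <- nv]]]; last first.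
  have [p [sp lp _ _]] := node_path ndn nv; exists p => //.
  by rewrite -lp mem_last.
rewrite inE => /predU1P[->|xp]; first by exists root.
case/splitPr: xp sp => p1 p2; rewrite -cat_rcons => -[].
rewrite cat_path -cat_cons cat_uniq size_cat => /andP[pp _] /andP[up _] sp.
have [|nd [ndn ae le _ _]] := @path_node (rcons p1 x).
  by split => //; exact: leq_trans (leq_addr _ _) sp.
by exists nd; split => //; [rewrite le last_rcons | rewrite ae].
Qed.

(** Short paths descend, hence traverse only parent-child pairs, and each such pair ends the path
    down to the child. Edges of the graph between two vertices of depth [l] are not controlled by
    conformity, but no short path uses them. *)
Let edge_child x y : rg_edge (neighbourhood G l v) x y <->
  exists s k, [/\ s \in h, k \in kids s, (addr s.1).1 = v &
    (lab s.1 = x /\ lab k = y) \/ (lab s.1 = y /\ lab k = x)].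
Proof.
have dir x1 y1 p : short_path G l v p -> infix [:: x1; y1] (v :: p) ->
    exists s k, [/\ s \in h, k \in kids s, (addr s.1).1 = v & lab s.1 = x1 /\ lab k = y1].
  move=> sp /infixP[p1 [p2 e]].
  have [q [qe pe]] : exists q, v :: q = rcons p1 x1 /\ p = rcons q y1 ++ p2.
    case: p1 e => [|z p1] [-> ->]; first by exists [::].
    by exists (rcons p1 x1); rewrite rcons_cons -!cats1 -!catA.
  have lq : last v q = x1 by rewrite -[LHS]/(last v (v :: q)) qe last_rcons.
  move: sp; rewrite pe => -[].
  rewrite cat_path -cat_cons cat_uniq size_cat => /andP[pp _] /andP[up _] ss.
  have [|nd [ndn ae le se [_ /(_ _ _ erefl) pnd]]] := @path_node (rcons q y1).
    by split => //; exact: leq_trans (leq_addr _ _) ss.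
  have nv : (addr nd).1 = v by rewrite ae.
  case: (nodeP' ndn nv) => [nde|[s [i [sh si sv ke]]]]; first by rewrite nde in pnd.
  exists s, nd; split => //; first by rewrite ke; apply/kidsP; exists i.
  by rewrite le last_rcons -lq; move: pnd; rewrite ke => -[].
have dir' s k p : s \in h -> k \in kids s -> good_path s.1 p ->
    short_path G l v (rcons p (lab k)) /\
    infix [:: lab s.1; lab k] (v :: rcons p (lab k)).
  move=> sh ks gp; have [sp _ _ _] := extend_path sh ks gp; split => //.
  have [_ lp _ _] := gp; apply/infixP; exists (belast v p), [::].
  by rewrite -rcons_cons lastI lp -!cats1 -catA.
split=> [[p sp /orP[]/(dir _ _ _ sp)]|[s [k [sh ks sv]]]].
- by move=> [s [k [? ? ? ?]]]; exists s, k; split => //; left.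
- by move=> [s [k [? ? ? ?]]]; exists s, k; split => //; right.
have [sn _] := step_node hV sh; have [p gp] := node_path sn sv.
have [sp' ip] := dir' _ _ _ sh ks gp.
by move=> [] [<- <-]; exists (rcons p (lab k)) => //; rewrite ip ?orbT.
Qed.

Lemma conform_iso : rg_iso (neighbourhood G l v) (tree_cut tree l).
Proof.
exists address; split; last 2 first.
- by rewrite /= (addressE root_in).
- move=> x y /vertP[nx [nxn <- nxv]] /vertP[ny [nyn <- nyv]].
  have T nd : nd \in nodes -> (addr nd).1 = v ->
      tree (address (lab nd)) /\ (size (address (lab nd)) <= l)%N.
    by move=> ndn nv; rewrite addressE//; split; [exact: node_tree|exact: depth_le].
  have aux nd nd' i : nd \in nodes -> (addr nd).1 = v -> nd' \in nodes ->
      (addr nd').1 = v -> address (lab nd') = rcons (address (lab nd)) i ->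
      exists s k, [/\ s \in h, k \in kids s, (addr s.1).1 = v &
        lab s.1 = lab nd /\ lab k = lab nd'].
    move=> ndn nv nd'n nv'; rewrite !addressE// => e.
    case: (nodeP' nd'n nv') e => [->|[s [j [sh sj sv ke]]]]; first by case: (addr nd).2.
    rewrite {1}ke {1}/addr /= => /rcons_inj[e _].
    exists s, nd'; split => //; first by rewrite ke; apply/kidsP; exists j.
    split => //; congr lab; have [sn _] := step_node hV sh.
    apply: (node_addr_inj hV sn ndn).
    by rewrite [LHS]surjective_pairing [RHS]surjective_pairing sv nv e.
  split=> [/edge_child[s [k [sh ks sv xy]]]|[_ _ [i]]].
    have [sn _] := step_node hV sh; have [kn _ _ [i ka]] := child_of sh ks.
    have ak : address (lab k) = rcons (address (lab s.1)) i.
      by rewrite !addressE// ka.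
    split; [exact: T|exact: T|exists i].
    by case: xy => -[<- <-]; [left|right].
  case=> e; apply/edge_child.
    by have [s [k [? ? ? ?]]] := aux _ _ _ nxn nxv nyn nyv e; exists s, k; split => //; left.
  by have [s [k [? ? ? ?]]] := aux _ _ _ nyn nyv nxn nxv e; exists s, k; split => //; right.
split.
- move=> x /vertP[nd [ndn <- nv]] /=.
  by rewrite addressE//; split; [exact: node_tree|exact: depth_le].
- move=> x y /set_mem/vertP[nx [nxn <- nxv]] /set_mem/vertP[ny [nyn <- nyv]].
  rewrite !addressE// => e; congr lab; apply: (node_addr_inj hV nxn nyn).
  by rewrite [LHS]surjective_pairing [RHS]surjective_pairing nxv nyv e.
- move=> u [Tu ul]; have [nd ndn ae] := tree_node Tu ul.
  exists (lab nd); last by rewrite addressE// ae.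
  by apply/vertP; exists nd; rewrite ae.
Qed.

End neighbourhood_tree.

Local Open Scope classical_set_scope.

(** * Offspring laws and Wasserstein distance *)

Section poisson.
Context (R : realType).
Implicit Types (a b : R).

(* Unlike [poisson_pmf], this is continuous at [a = 0]. *)
Definition pois a (m : nat) : R := a ^+ m / m`!%:R * expR (- a).

Lemma poisson_pmfE a m : 0 < a -> poisson_pmf a m = pois a m.
Proof. by rewrite /poisson_pmf => ->. Qed.

Lemma pois_ge0 a m : 0 <= a -> 0 <= pois a m.
Proof. by move=> a0; rewrite !mulr_ge0 ?exprn_ge0 ?expR_ge0 ?invr_ge0. Qed.

Lemma pois_gt0 a m : 0 < a -> 0 < pois a m.
Proof.
by move=> a0; rewrite !mulr_gt0 ?exprn_gt0 ?expR_gt0 ?invr_gt0// ltr0n fact_gt0.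
Qed.

Let sum_poisE a N : \sum_(m < N) pois a m = series (exp_coeff a) N * expR (- a).
Proof.
by rewrite /series/= big_mkord mulr_suml; apply: eq_bigr.
Qed.

Lemma sum_pois_le1 a N : 0 <= a -> \sum_(m < N) pois a m <= 1.
Proof.
move=> a0; rewrite sum_poisE -(expRxMexpNx_1 a) ler_wpM2r ?expR_ge0//.
rewrite /expR; apply: nondecreasing_cvgn_le (is_cvg_series_exp_coeff a) _.
by apply: nondecreasing_series => m _ _; rewrite /exp_coeff/= mulr_ge0 ?exprn_ge0 ?invr_ge0.
Qed.

Lemma cvg_sum_pois a : \sum_(m < N) pois a m @[N --> \oo] --> (1 : R).
Proof.
rewrite (_ : (fun N => _) = (fun N => series (exp_coeff a) N * expR (- a))).
  rewrite -(expRxMexpNx_1 a); apply: cvgM; last exact: cvg_cst.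
  exact: is_cvg_series_exp_coeff.
by apply/funext => N; rewrite sum_poisE.
Qed.

Lemma sum_pois_mean a N : 0 <= a -> \sum_(m < N) pois a m * m%:R <= a.
Proof.
move=> a0; case: N => [|N]; first by rewrite big_ord0.
rewrite big_ord_recl mulr0 add0r -[leRHS]mulr1.
apply: le_trans (ler_wpM2l a0 (sum_pois_le1 N a0)).
rewrite mulr_sumr le_eqVlt; apply/orP; left; apply/eqP; apply: eq_bigr => m _.
rewrite /pois /= /bump /= add1n exprS factS natrM.
by field; rewrite nat1r !pnatr_eq0 -!lt0n fact_gt0.
Qed.

(** Poi(b) is the sum of Poi(a) and an independent Poi(b - a), which vanishes with probability
    exp(-(b - a)). *)
Let pois_dom a b m : 0 <= a -> a <= b -> expR (- (b - a)) * pois a m <= pois b m.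
Proof.
move=> a0 ab; rewrite /pois mulrCA -expRD (_ : - (b - a) - a = - b); last by ring.
by rewrite ler_wpM2r ?expR_ge0// ler_wpM2r// lerXn2r// nnegrE// (le_trans a0).
Qed.

(** For a <= b domination works term by term. For b < a it is applied to the complementary event,
    which involves the whole series; hence the passage to the limit in N'. *)
Lemma sum_pois_lipschitz a b (B : pred nat) N : 0 <= a -> 0 <= b ->
  \sum_(m < N | B m) (pois a m - pois b m) <= `|a - b|.
Proof.
move=> a0 b0; have [ab|ba] := leP a b.
  have e0 : expR (- (b - a)) <= 1 by rewrite -expR0 ler_expR; lra.
  apply: (@le_trans _ _ (\sum_(m < N) (1 - expR (- (b - a))) * pois a m)).
    rewrite big_mkcond; apply: ler_sum => m _.
    case: ifP => _; last by rewrite mulr_ge0 ?pois_ge0 ?subr_ge0.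
    by rewrite mulrBl mul1r lerD2l lerN2 pois_dom.
  rewrite -mulr_sumr; apply: (@le_trans _ _ (1 - expR (- (b - a)))).
    by rewrite ler_piMr ?subr_ge0// sum_pois_le1.
  rewrite distrC ger0_norm ?subr_ge0//.
  by have := expR_ge1Dx (- (b - a)); lra.
rewrite gtr0_norm ?subr_gt0//.
set e := expR (- (a - b)); have e1 : 1 - e <= a - b.
  by have := expR_ge1Dx (- (a - b)); rewrite /e; lra.
have e0 : 0 <= e <= 1 by rewrite expR_ge0 -expR0 ler_expR; lra.
apply: (@le_trans _ _ (1 - e)) => //.
have key N' : (N <= N')%N ->
    \sum_(m < N | B m) (pois a m - pois b m) <= 1 - e * \sum_(m < N') pois b m.
  move=> NN'.
  pose C (m : 'I_N') := B m && (m < N)%N.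
  have widen (F : nat -> R) : \sum_(m < N | B m) F m = \sum_(m < N' | C m) F m.
    by rewrite (big_ord_widen_cond _ B F NN').
  rewrite (widen (fun m => pois a m - pois b m)) sumrB.
  have hb := bigID C predT (fun m : 'I_N' => pois b m).
  have ha : \sum_(m < N' | C m) pois a m <=
      1 - e * \sum_(m < N' | ~~ C m) pois b m.
    rewrite lerBrDr; apply: le_trans (sum_pois_le1 N' a0).
    rewrite [leRHS](bigID C)/= lerD2l mulr_sumr; apply: ler_sum => m _.
    by apply: pois_dom => //; exact: ltW.
  rewrite hb/= mulrDr; have : 0 <= \sum_(m < N' | C m) pois b m.
    by apply: sumr_ge0 => m _; exact: pois_ge0.
  by move: e0 => /andP[_ e0]; nra.
have c : 1 - e * (\sum_(m < N') pois b m) @[N' --> \oo] --> 1 - e * 1.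
  by apply: cvgB; [exact: cvg_cst|apply: cvgM; [exact: cvg_cst|exact: cvg_sum_pois]].
rewrite mulr1 in c; rewrite -(cvg_lim _ c)//; apply: limr_ge.
  by apply/cvg_ex; exists (1 - e).
by exists N => // N' /= NN'; exact: key.
Qed.

Lemma measurable_pois m : measurable_fun [set: R] (fun x => pois (Num.max 0 x) m).
Proof.
apply: measurable_funM; first apply: measurable_funM => //.
  by apply: measurable_funX; exact: measurable_maxr.
apply: measurableT_comp => //; apply: measurableT_comp => //; exact: measurable_maxr.
Qed.

End poisson.

Section density.
Context d (T : measurableType d) (R : realType).
Context (mu nu : {measure set T -> \bar R}) (rho : T -> \bar R).
Hypotheses (mrho : measurable_fun [set: T] rho) (rho0 : forall x, (0 <= rho x)%E).
Hypothesis rho_fin : forall x, rho x \is a fin_num.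
Hypothesis nuE : forall A, measurable A -> nu A = (\int[mu]_(x in A) rho x)%E.
Local Open Scope ereal_scope.
Import HBNNSimple.

Let integral_density_nnsfun (f : {nnsfun T >-> R}) :
  \int[nu]_x (f x)%:E = \int[mu]_x ((f x)%:E * rho x).
Proof.
under [LHS]eq_integral do rewrite fimfunE -fsumEFin//.
rewrite ge0_integral_fsum//; last 2 first.
  by move=> r; exact/measurable_EFinP/measurableT_comp.
  by move=> r z _; rewrite EFinM nnfun_muleindic_ge0.
transitivity (\int[mu]_x (\sum_(r \in range f)
   ((r * \1_(f @^-1` [set r]) x)%:E * rho x))); last first.
  apply: eq_integral => x _; rewrite [in RHS]fimfunE -fsumEFin//.
  rewrite ge0_mule_fsuml// => r; rewrite EFinM.
  exact: nnfun_muleindic_ge0.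
rewrite ge0_integral_fsum//; last 2 first.
  move=> r; apply: emeasurable_funM => //.
  exact/measurable_EFinP/measurableT_comp.
  by move=> r z _; rewrite mule_ge0// EFinM nnfun_muleindic_ge0.
apply: eq_fsbigr => r _.
rewrite (integralZl_indic _ (fun r => f @^-1` [set r]))//; last first.
  by move=> r0; rewrite preimage_nnfun0.
rewrite integral_indic// setIT nuE//.
have [r0|r0] := ltP r 0%R.
  rewrite preimage_nnfun0// integral_set0 mule0 integral0_eq// => x _.
  by rewrite indic0 mulr0 mul0e.
under [RHS]eq_integral do rewrite EFinM -muleA.
rewrite ge0_integralZl//; last 2 first.
  by apply: emeasurable_funM => //; exact/measurable_EFinP.
  by move=> x _; rewrite mule_ge0// lee_fin.
congr (_ * _); rewrite integral_mkcond; apply: eq_integral => x _.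
by rewrite patchE indicE; case: ifPn => _; rewrite ?mul1e ?mul0e.
Qed.

Lemma integral_density (f : T -> \bar R) : (forall x, 0 <= f x) ->
  measurable_fun [set: T] f -> \int[nu]_x f x = \int[mu]_x (f x * rho x).
Proof.
move=> f0 mf; pose f_ := nnsfun_approx measurableT mf.
have nd_f_ x m n : (m <= n)%N -> (f_ m x <= f_ n x)%R.
  by move=> mn; exact/lefP/nd_nnsfun_approx.
have f_f x : (f_ n x)%:E @[n --> \oo] --> f x by exact: cvg_nnsfun_approx.
transitivity (\int[nu]_x lim ((f_ n x)%:E @[n --> \oo])).
  by apply: eq_integral => x _; apply/esym/cvg_lim.
rewrite monotone_convergence//; last 3 first.
  by move=> n; exact/measurable_EFinP.
  by move=> n z _; rewrite lee_fin.
  by move=> z _ a b ab; rewrite lee_fin nd_f_.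
under eq_fun do rewrite integral_density_nnsfun.
rewrite -monotone_convergence//; last 3 first.
  by move=> n; apply: emeasurable_funM => //; exact/measurable_EFinP.
  by move=> n z _; rewrite mule_ge0// lee_fin.
  by move=> z _ a b ab; rewrite lee_wpmul2r// lee_fin nd_f_.
apply: eq_integral => x _; apply/cvg_lim => //.
by apply: cvgeZr => //; exact: rho_fin.
Qed.

End density.

Section couplings.
Context (R : realType).
Local Open Scope ereal_scope.

Definition coupling_of (mu nu : set R -> \bar R) (pi : probability (R * R)%type R) :=
  forall A : set R, measurable A ->
    pi (A `*` [set: R]) = mu A /\ pi ([set: R] `*` A) = nu A.

Lemma wasserstein1_ge (mu nu : set R -> \bar R) (c : \bar R) :
  (forall pi, coupling_of mu nu pi -> c <= \int[pi]_z (`|z.1 - z.2|%R)%:E) ->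
  c <= wasserstein1 mu nu.
Proof. by move=> h; apply: le_ereal_inf_tmp => _ [pi pic <-]; exact: h. Qed.

Lemma measurable_cost : measurable_fun [set: R * R] (fun z => (`|z.1 - z.2|%R)%:E).
Proof.
apply/measurable_EFinP; apply: measurableT_comp => //.
exact: measurable_funB.
Qed.

Section atomic.
Context (n : nat) (p w : 'I_n -> R) (nu : {measure set R -> \bar R}).
Hypothesis p_ge0 : forall i, (0 <= p i)%R.

Let mu (A : set R) : \bar R := (\sum_(i < n) p i * \1_A (w i))%:E.

Context (pi : probability (R * R)%type R).
Hypothesis pi_coupling : coupling_of mu nu pi.

(** [msum] is indexed by natural numbers, so masses and atoms are extended by 0 beyond [n]. *)
Let mass (k : nat) : {nonneg R} :=
  if insub k is Some i then NngNum (p_ge0 i) else NngNum (lexx (0%R : R)).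
Let atom (k : nat) : R := if insub k is Some i then w i else 0%R.
Let atomic : {measure set R -> \bar R} :=
  msum (fun k => mscale (mass k) \d_(atom k)) n.

Lemma integral_coupling_fst (f : R -> R) : measurable_fun [set: R] f ->
  (forall x, (0 <= f x)%R) ->
  \int[pi]_z (f z.1)%:E = (\sum_(i < n) p i * f (w i))%:E.
Proof.
move=> mf f0; have mEf : measurable_fun [set: R] (EFin \o f) by exact/measurable_EFinP.
transitivity (\int[pushforward pi fst]_x (f x)%:E).
  by rewrite ge0_integral_pushforward// => x _; rewrite lee_fin.
rewrite (eq_measure_integral atomic); last first.
  move=> A mA _; rewrite /pushforward /=.
  transitivity (pi (A `*` [set: R])).
    by congr (pi _); apply/seteqP; split => [[x y]//=|[x y] []].
  rewrite (pi_coupling mA).1 /mu /msum/= -sumEFin; apply: eq_bigr => i _.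
  by rewrite /mscale /mass /atom /= valK /= diracE indicE -EFinM.
rewrite ge0_integral_measure_sum//; last by move=> x _; rewrite lee_fin.
rewrite -sumEFin; apply: eq_bigr => i _.
rewrite ge0_integral_mscale//; last by move=> x _; rewrite lee_fin.
by rewrite integral_dirac// diracT mul1e /mass /atom valK /= EFinM.
Qed.

Lemma integral_coupling_snd (f : R -> \bar R) : measurable_fun [set: R] f ->
  (forall x, 0 <= f x) -> \int[pi]_z f z.2 = \int[nu]_x f x.
Proof.
move=> mf f0; transitivity (\int[pushforward pi snd]_x f x).
  by rewrite ge0_integral_pushforward.
apply: eq_measure_integral => A mA _; rewrite /pushforward /=.
rewrite -(pi_coupling mA).2.
by congr (pi _); apply/seteqP; split => [[x y]//=|[x y] []].
Qed.

End atomic.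

Section kantorovich.
Context (n : nat) (p w : 'I_n -> R) (nu : {measure set R -> \bar R}).
Hypothesis p_ge0 : forall i, (0 <= p i)%R.

Let mu (A : set R) : \bar R := (\sum_(i < n) p i * \1_A (w i))%:E.

(** Easy half of Kantorovich duality: the pointwise inequality is integrated against an arbitrary
    coupling. *)
Lemma kantorovich_snd (f1 f2 : R -> R) : measurable_fun [set: R] f1 ->
  measurable_fun [set: R] f2 -> (forall x, (0 <= f1 x)%R) -> (forall x, (0 <= f2 x)%R) ->
  (forall x y, (f2 y <= f1 x + `|x - y|)%R) ->
  \int[nu]_x (f2 x)%:E <= (\sum_(i < n) p i * f1 (w i))%:E + wasserstein1 mu nu.
Proof.
move=> mf1 mf2 f10 f20 f12; rewrite -leeBlDl//; apply: wasserstein1_ge => pi pic.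
rewrite leeBlDl// -(integral_coupling_snd pic) ?lee_fin//; last exact/measurable_EFinP.
rewrite -(integral_coupling_fst p_ge0 pic mf1 f10) -ge0_integralD//; last 3 first.
- by move=> z _; rewrite lee_fin.
- by apply/measurable_EFinP; exact: measurableT_comp mf1 measurable_fst.
- exact: measurable_cost.
apply: ge0_le_integral => //.
- by move=> z _; rewrite lee_fin.
- by apply/measurable_EFinP; exact: measurableT_comp mf2 measurable_snd.
- apply: emeasurable_funD measurable_cost.
  by apply/measurable_EFinP; exact: measurableT_comp mf1 measurable_fst.
- by move=> z _; rewrite -EFinD lee_fin.
Qed.

(** Reverse direction, with an error [C] that allows the two test functions to differ. The integral
    of [f2] is finite and can be subtracted in the extended reals. *)
Lemma kantorovich_fst (f1 f2 C : R -> R) (x2 : R) : measurable_fun [set: R] f1 ->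
  measurable_fun [set: R] f2 -> measurable_fun [set: R] C ->
  (forall x, (0 <= f1 x)%R) -> (forall x, (0 <= f2 x)%R) -> (forall x, (0 <= C x)%R) ->
  (forall x y, (f1 x <= f2 y + C x + `|x - y|)%R) ->
  \int[nu]_x (f2 x)%:E = x2%:E ->
  (\sum_(i < n) p i * f1 (w i))%:E <=
    x2%:E + (\sum_(i < n) p i * C (w i))%:E + wasserstein1 mu nu.
Proof.
move=> mf1 mf2 mC f10 f20 C0 f12 e; rewrite -e.
have finx : \int[nu]_x (f2 x)%:E + (\sum_(i < n) p i * C (w i))%:E \is a fin_num.
  by rewrite e.
rewrite -leeBlDl//; apply: wasserstein1_ge => pi pic.
rewrite leeBlDl// -(integral_coupling_snd pic); last 2 first.
- exact/measurable_EFinP.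
- by move=> x; rewrite lee_fin.
rewrite -(integral_coupling_fst p_ge0 pic mf1 f10) -(integral_coupling_fst p_ge0 pic mC C0).
have m1 (f : R -> R) : measurable_fun [set: R] f ->
    measurable_fun [set: R * R] (fun z => (f z.1)%:E).
  by move=> mf; apply/measurable_EFinP; exact: measurableT_comp mf measurable_fst.
have m2 (f : R -> R) : measurable_fun [set: R] f ->
    measurable_fun [set: R * R] (fun z => (f z.2)%:E).
  by move=> mf; apply/measurable_EFinP; exact: measurableT_comp mf measurable_snd.
rewrite -ge0_integralD//; last 4 first.
- by move=> z _; rewrite lee_fin.
- exact: m2.
- by move=> z _; rewrite lee_fin.
- exact: m1.
rewrite -ge0_integralD//; last 3 first.
- by move=> z _; rewrite -EFinD lee_fin addr_ge0.
- by apply: emeasurable_funD; [exact: m2|exact: m1].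
- exact: measurable_cost.
apply: ge0_le_integral => //.
- by move=> z _; rewrite lee_fin.
- exact: m1.
- apply: emeasurable_funD measurable_cost.
  by apply: emeasurable_funD; [exact: m2|exact: m1].
- by move=> z _; rewrite -!EFinD lee_fin.
Qed.

End kantorovich.
End couplings.

Section limit_law.
Context (R : realType) (nu : probability R R).
Hypothesis nu_pos : nu `]0, +oo[%classic = 1%E.
Hypothesis nu_mean : (0 < \int[nu]_x x%:E < +oo)%E.

Let theta := mean nu.

Lemma meanE : (\int[nu]_x x%:E)%E = theta%:E.
Proof.
rewrite fineK// fin_numElt; case/andP: nu_mean => h1 ->; rewrite andbT.
exact: lt_trans h1.
Qed.

Lemma mean_gt0 : 0 < theta.
Proof. by case/andP: nu_mean; rewrite meanE lte_fin. Qed.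

Let ae_pos : {ae nu, forall x : R, 0 < x}.
Proof.
exists (~` `]0, +oo[); split.
- exact: measurableC.
- by rewrite probability_setC// nu_pos subee.
- by move=> x /= + h; apply; move: h; rewrite in_itv/= andbT.
Qed.

Lemma ae_integral (f g : R -> \bar R) : measurable_fun [set: R] f ->
  measurable_fun [set: R] g -> (forall x, 0 < x -> f x = g x) ->
  (\int[nu]_x f x = \int[nu]_x g x)%E.
Proof.
move=> mf mg fg; apply: ae_eq_integral => //.
by case: ae_pos => N [mN N0 hN]; exists N; split => // x /= nfg; apply: hN => x0; apply: nfg => _; exact: fg.
Qed.

Lemma measurable_max0 : measurable_fun [set: R] (fun x : R => Num.max 0 x).
Proof. exact: measurable_maxr. Qed.

Lemma integral_max0 : (\int[nu]_x (Num.max 0 x)%:E)%E = theta%:E.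
Proof.
rewrite -meanE; apply: ae_integral.
- apply/measurable_EFinP; exact: measurable_max0.
- exact/measurable_EFinP.
- by move=> x x0; rewrite max_r// ltW.
Qed.

Let density (x : R) : \bar R := (Num.max 0 (x / theta))%:E.

Let mdensity : measurable_fun [set: R] density.
Proof. by apply/measurable_EFinP; apply: measurable_maxr => //; exact: measurable_funM. Qed.

Lemma integral_size_biased (f : R -> \bar R) : (forall x, (0 <= f x)%E) ->
  measurable_fun [set: R] f ->
  (\int[size_biased nu]_x f x = \int[nu]_x (f x * density x))%E.
Proof.
move=> f0 mf; apply: integral_density => //.
by move=> x; rewrite lee_fin le_max lexx.
Qed.

Lemma size_biased_setT : size_biased nu [set: R] = 1%E.
Proof.
rewrite /size_biased.
rewrite (@ae_integral density (fun x => (Num.max 0 x)%:E * theta^-1%:E)%E)//.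
- rewrite ge0_integralZr//; first by rewrite integral_max0 -EFinM divff// gt_eqF// mean_gt0.
  + apply/measurable_EFinP; exact: measurable_max0.
  + by move=> x _; rewrite lee_fin le_max lexx.
  + by rewrite lee_fin invr_ge0 ltW// mean_gt0.
- by apply: emeasurable_funM => //; apply/measurable_EFinP; exact: measurable_max0.
- move=> x x0; rewrite /density max_r ?max_r ?EFinM//; first exact: ltW.
  by rewrite divr_ge0// ltW// mean_gt0.
Qed.

Let pois_max m (x : R) : R := pois (Num.max 0 x) m.

Let pois_max_ge0 m x : 0 <= pois_max m x.
Proof. by apply: pois_ge0; rewrite le_max lexx. Qed.

(** The integrands may differ only for x <= 0, where the size-biased density vanishes. *)
Lemma integral_poisson_pmf m :
  (\int[size_biased nu]_x (poisson_pmf x m)%:E =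
   \int[size_biased nu]_x (pois (Num.max 0 x) m)%:E)%E.
Proof.
rewrite !integral_size_biased//.
- apply: eq_integral => x _; have [x0|x0] := ltP 0 x.
    by rewrite poisson_pmfE// max_r// ltW.
  rewrite /density (@max_l _ _ _ (x / theta)) ?mule0//.
  by rewrite pmulr_lle0// invr_gt0 mean_gt0.
- by move=> x; rewrite lee_fin pois_max_ge0.
- apply/measurable_EFinP; exact: measurable_pois.
- by move=> x; rewrite lee_fin poisson_pmf_ge0.
- apply/measurable_EFinP; exact: measurable_poisson_pmf.
Qed.

Definition mixed_pois (m : nat) : R :=
  fine (\int[size_biased nu]_x (poisson_pmf x m)%:E)%E.

Lemma sum_mixed_poisE (c : nat -> R) N : (forall m, 0 <= c m) ->
  (\sum_(m < N) c m * mixed_pois m)%:E =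
  (\int[size_biased nu]_x (\sum_(m < N) c m * pois (Num.max 0 x) m)%:E)%E.
Proof.
move=> c0; have le1 (x : R) m : pois (Num.max 0 x) m <= 1.
  have x0 : (0 : R) <= Num.max 0 x by rewrite le_max lexx.
  apply: le_trans (sum_pois_le1 m.+1 x0); rewrite big_ord_recr/= lerDr sumr_ge0// => i _.
  exact: pois_ge0.
under eq_integral do rewrite -sumEFin.
rewrite ge0_integral_sum//; last 2 first.
- by move=> m; apply/measurable_EFinP; apply: measurable_funM => //; exact: measurable_pois.
- by move=> m x _; rewrite lee_fin mulr_ge0// pois_max_ge0.
rewrite -sumEFin; apply: eq_bigr => m _.
under [RHS]eq_integral do rewrite EFinM.
rewrite ge0_integralZl//; last 3 first.
- by apply/measurable_EFinP; exact: measurable_pois.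
- by move=> x _; rewrite lee_fin pois_max_ge0.
- by rewrite lee_fin.
rewrite EFinM /mixed_pois integral_poisson_pmf fineK// fin_numElt; apply/andP; split.
  by apply: (@lt_le_trans _ _ 0%E) => //; apply: integral_ge0 => x _; rewrite lee_fin pois_max_ge0.
apply: (@le_lt_trans _ _ (\int[size_biased nu]_x (cst 1%E) x)%E).
  apply: ge0_le_integral => //.
  - by move=> x _; rewrite lee_fin pois_max_ge0.
  - apply/measurable_EFinP; exact: measurable_pois.
  - by move=> x _; rewrite lee_fin.
by rewrite integral_cst// mul1e [X in (X < _)%E]size_biased_setT ltry.
Qed.

Lemma mixed_pois_ge0 m : 0 <= mixed_pois m.
Proof. by apply: fine_ge0; apply: integral_ge0 => x _; rewrite lee_fin poisson_pmf_ge0. Qed.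

Lemma mixed_poisE m :
  (\int[size_biased nu]_x (poisson_pmf x m)%:E)%E = (mixed_pois m)%:E.
Proof.
have := @sum_mixed_poisE (fun i => (i == m)%:R) m.+1 (fun=> ler0n _ _).
have pick (F : nat -> R) : \sum_(i < m.+1) (i == m :> nat)%:R * F i = F m.
  rewrite big_ord_recr/= eqxx mul1r big1 ?add0r// => i _.
  by rewrite ltn_eqF ?mul0r.
by rewrite pick integral_poisson_pmf => ->; apply: eq_integral => x _; rewrite pick.
Qed.

(** Monotone convergence moves the limit of the Poisson partial sums inside the mixture, of total
    mass 1. *)
Lemma cvg_sum_mixed_pois : \sum_(m < N) mixed_pois m @[N --> \oo] --> (1 : R).
Proof.
pose g N (x : R) := (\sum_(m < N) pois (Num.max 0 x) m)%:E.
have gE N : (\sum_(m < N) mixed_pois m)%:E = (\int[size_biased nu]_x g N x)%E.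
  have := @sum_mixed_poisE (fun=> 1) N (fun=> ler01).
  under eq_bigr do rewrite mul1r.
  move=> ->; apply: eq_integral => x _; rewrite /g.
  by under eq_bigr do rewrite mul1r.
have g_cvg x : g N x @[N --> \oo] --> 1%E.
  by apply: cvg_EFin; [exact: nearW|exact: cvg_sum_pois].
have : (\int[size_biased nu]_x g N x)%E @[N --> \oo] -->
    (\int[size_biased nu]_x (limn (g^~ x)))%E.
  apply: cvg_monotone_convergence => //.
  - move=> N; apply/measurable_EFinP; apply: measurable_sum => m; exact: measurable_pois.
  - by move=> N x _; rewrite lee_fin; apply: sumr_ge0 => m _; exact: pois_max_ge0.
  - move=> x _ N M NM; rewrite lee_fin.
    rewrite (big_ord_widen _ (fun m => pois (Num.max 0 x) m) NM) big_mkcond/=.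
    by apply: ler_sum => m _; case: ifP => // _; exact: pois_max_ge0.
rewrite (_ : (\int[_]_x _)%E = 1%E); last first.
  transitivity (\int[size_biased nu]_x (cst 1 x))%E.
    by apply: eq_integral => x _; apply/cvg_lim.
  by rewrite integral_cst// mul1e [LHS]size_biased_setT.
by under eq_fun do rewrite -gE; move/fine_cvg.
Qed.

End limit_law.

(** * Acceptance densities and the mass for fixed weights *)

Section weights_close.
Context (R : realType) (nu : probability R R).
Hypothesis nu_pos : nu `]0, +oo[%classic = 1%E.
Hypothesis nu_mean : (0 < \int[nu]_x x%:E < +oo)%E.
Context (n : nat) (w : 'I_n -> R) (alpha : R).
Hypotheses (n_gt0 : (0 < n)%N) (w_gt0 : forall v, 0 < w v).
Hypothesis w_nu : (wasserstein1 (empirical w) nu <= alpha%:E)%E.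
Hypothesis w_sb : (wasserstein1 (empirical_size_biased w) (size_biased nu) <= alpha%:E)%E.

Let theta := mean nu.
Let nt := n%:R * theta.
Let Lam := \sum_v w v.
Let G1 := Lam / nt.
Let G2 := (\sum_v w v ^+ 2) / nt.
Let g2 := limit_moment nu 2.

Let theta_gt0 : 0 < theta := mean_gt0 nu_mean.
Let nt_gt0 : 0 < nt. Proof. by rewrite mulr_gt0// ltr0n. Qed.
Let Lam_gt0 : 0 < Lam := sum_weight_gt0 w_gt0 (Ordinal n_gt0).
Let G1_gt0 : 0 < G1. Proof. exact: divr_gt0. Qed.
Let n_neq0 : n%:R != 0 :> R. Proof. by rewrite pnatr_eq0 -lt0n. Qed.

(** Stands for the identity as a nonnegative 1-Lipschitz test function on the whole line. *)
Let m0 (x : R) : R := Num.max 0 x.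
Let m0_ge0 x : 0 <= m0 x. Proof. by rewrite le_max lexx. Qed.
Let m0E v : m0 (w v) = w v. Proof. by rewrite /m0 max_r// ltW. Qed.
Let m0_lip x y : `|m0 x - m0 y| <= `|x - y|.
Proof.
rewrite /m0; case: (leP 0 x) => x0; case: (leP 0 y) => y0 //.
- by rewrite subr0 ger0_norm// (le_trans _ (ler_norm _))//; lra.
- by rewrite sub0r normrN ger0_norm// distrC (le_trans _ (ler_norm _))//; lra.
- by rewrite subrr normr0.
Qed.
Let mm0 : measurable_fun [set: R] m0 := @measurable_max0 R.

Let empiricalE : empirical w =
  fun A => (\sum_(i < n) n%:R^-1 * \1_A (w i))%:E.
Proof. by apply/funext => A; rewrite /empirical mulr_sumr. Qed.

Let empirical_size_biasedE : empirical_size_biased w =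
  fun A => (\sum_(i < n) w i / Lam * \1_A (w i))%:E.
Proof.
apply/funext => A; rewrite /empirical_size_biased mulr_sumr; congr (_%:E).
by apply: eq_bigr => i _; rewrite mulrA (mulrC (w i)).
Qed.

Lemma dist_ge0 : 0 <= alpha.
Proof.
rewrite -lee_fin; apply: le_trans w_nu; apply: wasserstein1_ge => pi _.
by apply: integral_ge0 => z _; rewrite lee_fin.
Qed.

Let p1_ge0 (i : 'I_n) : 0 <= n%:R^-1 :> R. Proof. by rewrite invr_ge0. Qed.
Let p2_ge0 (i : 'I_n) : 0 <= w i / Lam. Proof. by rewrite divr_ge0// ltW. Qed.

Let mean_close : `|Lam / n%:R - theta| <= alpha.
Proof.
have f12 (x y : R) : m0 x <= m0 y + `|y - x|.
  by have := m0_lip y x; rewrite distrC => /(le_trans (ler_norm _)); lra.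
have h0 : (\int[nu]_x (m0 x)%:E)%E = theta%:E := integral_max0 nu_pos nu_mean.
have S : \sum_(i < n) n%:R^-1 * m0 (w i) = Lam / n%:R.
  by rewrite -mulr_sumr mulrC; congr (_ / _); apply: eq_bigr => i _; exact: m0E.
have h1 := @kantorovich_snd R n (fun=> n%:R^-1) w nu p1_ge0 m0 m0 mm0 mm0 m0_ge0 m0_ge0
  (fun x y => f12 y x).
have h2 := @kantorovich_fst R n (fun=> n%:R^-1) w nu p1_ge0 m0 m0 (cst 0) theta mm0 mm0
  (measurable_cst _) m0_ge0 m0_ge0 (fun=> lexx 0).
rewrite -empiricalE in h1 h2; rewrite ler_norml; apply/andP; split.
  move: h1; rewrite h0 S => /le_trans/(_ (leeD2l _ w_nu)); rewrite -EFinD lee_fin; lra.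
have /h2 : forall x y, m0 x <= m0 y + cst 0 x + `|x - y|.
  by move=> x y; rewrite /= addr0 distrC.
move=> /(_ h0) /le_trans/(_ (leeD2l _ w_nu)); rewrite S big1 => [|i _]; last by rewrite mulr0.
by rewrite addr0 -EFinD lee_fin; lra.
Qed.

Lemma moment1_close : `|G1 - 1| <= alpha / theta.
Proof.
rewrite (_ : G1 - 1 = (Lam / n%:R - theta) / theta); last first.
  by rewrite /G1 /nt; field; rewrite n_neq0 gt_eqF.
by rewrite normrM normfV (gtr0_norm theta_gt0) ler_pM2r ?invr_gt0.
Qed.

(** The second moment is finite because the size-biased law lies at finite Wasserstein distance from
    a law of finite support. *)
Lemma integral_size_biased_id : (\int[size_biased nu]_x (Num.max 0 x)%:E)%E = g2%:E.
Proof.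
have lt_oo : (\int[size_biased nu]_x (m0 x)%:E < +oo)%E.
  have f12 (x y : R) : m0 y <= m0 x + `|x - y|.
    by have := m0_lip x y; rewrite distrC => /(le_trans (ler_norm _)); lra.
  have := @kantorovich_snd R n (fun i => w i / Lam) w (size_biased nu) p2_ge0 m0 m0
    mm0 mm0 m0_ge0 m0_ge0 f12.
  rewrite -empirical_size_biasedE => /le_lt_trans; apply.
  by rewrite lte_add_pinfty ?ltry// (le_lt_trans w_sb)// ltry.
have e : (\int[size_biased nu]_x (m0 x)%:E =
    (\int[nu]_x (x ^+ 2)%:E) * theta^-1%:E)%E.
  rewrite integral_size_biased//; last exact/measurable_EFinP.
  rewrite -ge0_integralZr//; last 3 first.
  - by apply/measurable_EFinP; exact: measurable_funX.
  - by move=> x _; rewrite lee_fin sqr_ge0.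
  - by rewrite lee_fin invr_ge0 ltW.
  apply: (ae_integral nu_pos).
  - apply: emeasurable_funM; first exact/measurable_EFinP.
    by apply/measurable_EFinP; apply: measurable_maxr => //; exact: measurable_funM.
  - apply: emeasurable_funM => //; apply/measurable_EFinP; exact: measurable_funX.
  move=> x x0; rewrite /m0 max_r ?ltW// max_r ?divr_ge0 ?ltW// -!EFinM expr2.
  by rewrite mulrA.
rewrite e /g2 /limit_moment EFinM; congr (_ * _)%E.
rewrite fineK// fin_numElt; apply/andP; split.
  apply: (@lt_le_trans _ _ 0%E) => //.
  by apply: integral_ge0 => x _; rewrite lee_fin sqr_ge0.
move: lt_oo; rewrite e; case: (\int[nu]_x _)%E => [r||]//; rewrite ?ltry// mulyr.
by rewrite gtr0_sg ?invr_gt0// mul1e.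
Qed.

Lemma limit_moment2_ge0 : 0 <= g2.
Proof.
rewrite -lee_fin -integral_size_biased_id.
by apply: integral_ge0 => x _; rewrite lee_fin m0_ge0.
Qed.

Definition empirical_mixed_pois (m : nat) : R :=
  \sum_v w v / Lam * pois (G1 * w v) m.

(** Distance of the size-biased laws, plus the cost of scaling the Poisson parameter by G1: |G1 - 1|
    <= alpha/theta, times the mean G2/G1 of the empirical size-biased law. *)
Definition offspring_dist : R := alpha + alpha / theta * (G2 / G1).

(** The Poisson probability of an event is 1-Lipschitz in the parameter, so mixtures are compared
    through the Wasserstein distance; the parameter G1 x in place of x costs |G1 - 1| x. *)
Lemma sum_mixed_pois_close (B : pred nat) N :
  \sum_(m < N | B m) (empirical_mixed_pois m - mixed_pois nu m) <= offspring_dist.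
Proof.
pose c m : R := (B m)%:R; have c0 m : 0 <= c m by rewrite /c ler0n.
pose F (a : R) := \sum_(m < N) c m * pois a m.
have sumB (f : nat -> R) : \sum_(m < N | B m) f m = \sum_(m < N) c m * f m.
  by rewrite big_mkcond; apply: eq_bigr => m _; rewrite /c; case: (B m); rewrite ?mul1r ?mul0r.
have F0 a : 0 <= a -> 0 <= F a by move=> a0; rewrite sumr_ge0// => m _; rewrite mulr_ge0// pois_ge0.
have mF (f : R -> R) : measurable_fun [set: R] f -> measurable_fun [set: R] (fun x => F (m0 (f x))).
  move=> mf; apply: measurable_sum => m; apply: measurable_funM => //.
  exact: measurableT_comp (measurable_pois m) mf.
pose f1 x := F (m0 (G1 * x)); pose f2 x := F (m0 x).
pose C x := `|G1 - 1| * m0 x.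
have lip (x y : R) : f1 x <= f2 y + C x + `|x - y|.
  have : f1 x - f2 y <= `|m0 (G1 * x) - m0 y|.
    rewrite /f1 /f2 /F -sumrB.
    rewrite (eq_bigr (fun m : 'I_N => c m * (pois (m0 (G1 * x)) m - pois (m0 y) m))).
      rewrite -(sumB (fun m => pois (m0 (G1 * x)) m - pois (m0 y) m)).
      exact: sum_pois_lipschitz.
    by move=> m _; rewrite mulrBr.
  have : `|m0 (G1 * x) - m0 y| <= C x + `|x - y|.
    have -> : m0 (G1 * x) = G1 * m0 x.
      by rewrite /m0 maxr_pMr ?mulr0// ltW.
    have -> : G1 * m0 x - m0 y = (G1 - 1) * m0 x + (m0 x - m0 y) by ring.
    rewrite (le_trans (ler_normD _ _))// normrM (ger0_norm (m0_ge0 x)) lerD2l.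
    exact: m0_lip.
  lra.
have e2 : (\int[size_biased nu]_x (f2 x)%:E)%E = (\sum_(m < N) c m * mixed_pois nu m)%:E.
  by rewrite sum_mixed_poisE.
have := @kantorovich_fst R n (fun i => w i / Lam) w (size_biased nu) p2_ge0 f1 f2 C _
  _ _ _ _ _ _ lip e2.
rewrite -empirical_size_biasedE => h.
have {}h : ((\sum_(i < n) w i / Lam * f1 (w i))%:E <=
   (\sum_(m < N) c m * mixed_pois nu m)%:E + (\sum_(i < n) w i / Lam * C (w i))%:E + alpha%:E)%E.
  apply: le_trans (leeD2l _ w_sb); apply: h.
  - by apply: mF; exact: measurable_funM.
  - exact: mF.
  - by apply: measurable_funM => //; exact: measurable_cst.
  - by move=> x; exact: F0.
  - by move=> x; exact: F0.
  - by move=> x; rewrite mulr_ge0.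
move: h; rewrite -!EFinD lee_fin => h.
have E1 : \sum_(i < n) w i / Lam * f1 (w i) = \sum_(m < N) c m * empirical_mixed_pois m.
  under eq_bigr => i _ do rewrite /f1 /F mulr_sumr.
  rewrite exchange_big/=; apply: eq_bigr => m _; rewrite mulr_sumr.
  apply: eq_bigr => i _; rewrite /m0 max_r; last by rewrite mulr_ge0// ltW.
  by rewrite mulrCA.
have E2 : \sum_(i < n) w i / Lam * C (w i) = `|G1 - 1| * (G2 / G1).
  rewrite /C; under eq_bigr => i _ do rewrite m0E mulrCA.
  rewrite -mulr_sumr; congr (_ * _); rewrite /G2 /G1.
  rewrite -mulf_div divff ?mulr1; last by rewrite gt_eqF// invr_gt0.
  by rewrite mulr_suml; apply: eq_bigr => i _; ring.
have G20 : 0 <= G2 / G1.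
  apply: divr_ge0 (ltW G1_gt0); apply: divr_ge0 (ltW nt_gt0).
  by apply: sumr_ge0 => i _; exact: sqr_ge0.
rewrite (sumB (fun m => empirical_mixed_pois m - mixed_pois nu m)).
rewrite (eq_bigr (fun m : 'I_N => c m * empirical_mixed_pois m - c m * mixed_pois nu m)).
  rewrite sumrB -E1 /offspring_dist; move: h; rewrite E2.
  have := ler_wpM2r G20 moment1_close; lra.
by move=> m _; rewrite mulrBr.
Qed.

(** A root has a known weight, so two Poisson laws are compared. Inner labels are averaged out in
    the tree, so there the two mixed laws are compared, whatever the label x. *)
Definition accept (b : bool) (x : 'I_n) (m : nat) : R :=
  if b then Num.min 1 (pois (w x) m / pois (G1 * w x) m)
  else Num.min 1 (mixed_pois nu m / empirical_mixed_pois m).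

Let ofs x := poisson_pmf (G1 * w x).

Let ofsE x m : ofs x m = pois (G1 * w x) m.
Proof. by rewrite /ofs poisson_pmfE// mulr_gt0. Qed.

Let ofs_gt0 x m : 0 < pois (G1 * w x) m.
Proof. by rewrite pois_gt0// mulr_gt0. Qed.

Let emp_gt0 m : 0 < empirical_mixed_pois m.
Proof.
rewrite /empirical_mixed_pois (bigD1 (Ordinal n_gt0))//= ltr_pwDl//.
  by rewrite mulr_gt0// divr_gt0.
by apply: sumr_ge0 => v _; rewrite mulr_ge0// ltW.
Qed.

Lemma accept01 b x m : 0 <= accept b x m <= 1.
Proof.
rewrite /accept; case: b; rewrite le_min ge_min lexx ler01 /= andbT.
  exact: divr_ge0 (pois_ge0 m (ltW (w_gt0 x))) (ltW (ofs_gt0 x m)).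
exact: divr_ge0 (mixed_pois_ge0 _ _) (ltW (emp_gt0 m)).
Qed.

Let min_le (a e : R) : 0 < e -> e * Num.min 1 (a / e) <= a.
Proof.
move=> e0; apply: (@le_trans _ _ (e * (a / e))).
  by rewrite ler_pM2l// ge_min lexx orbT.
by rewrite mulrC divfK// gt_eqF.
Qed.

(** Mean rejection is the excess of e over a, as in total variation: only values with a < e are
    rejected. *)
Let sum_min (a e : nat -> R) N : (forall m, 0 < e m) ->
  \sum_(m < N) e m * (1 - Num.min 1 (a m / e m)) = \sum_(m < N | a m < e m) (e m - a m).
Proof.
move=> e0; rewrite [RHS]big_mkcond; apply: eq_bigr => m _.
have [ae|ae] := ltP (a m) (e m).
  rewrite min_r; last by rewrite ler_pdivrMr// mul1r ltW.
  by rewrite mulrBr mulr1 [e m * _]mulrC divfK// gt_eqF.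
by rewrite min_l ?subrr ?mulr0// ler_pdivlMr// mul1r.
Qed.

Lemma accept_root x m : ofs x m * accept true x m <= pois (w x) m.
Proof. by rewrite ofsE min_le. Qed.

Let accept_innerE m : \sum_y w y / Lam * (ofs y m * accept false y m) =
  empirical_mixed_pois m * Num.min 1 (mixed_pois nu m / empirical_mixed_pois m).
Proof.
by rewrite /empirical_mixed_pois mulr_suml; apply: eq_bigr => y _; rewrite ofsE mulrA.
Qed.

Lemma accept_inner m :
  \sum_y w y / Lam * (ofs y m * accept false y m) <= mixed_pois nu m.
Proof. by rewrite accept_innerE min_le. Qed.

Let ofs_mean N x : \sum_(m < N) ofs x m * m%:R <= G1 * w x.
Proof.
under eq_bigr do rewrite ofsE.
by apply: sum_pois_mean; rewrite mulr_ge0 ?ltW.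
Qed.

Let reject_root x : reject w nt accept true x <= w x * (alpha / theta).
Proof.
rewrite /reject; under eq_bigr do rewrite -/(ofs x _) ofsE.
rewrite (sum_min (fun m => pois (w x) m) _ (fun m => ofs_gt0 x m)).
apply: le_trans (sum_pois_lipschitz (fun m => pois (w x) m < pois (G1 * w x) m) _ _ _) _.
- by rewrite mulr_ge0 ?ltW.
- exact: ltW.
rewrite -[X in _ - X]mul1r -mulrBl normrM (gtr0_norm (w_gt0 x)) mulrC.
by rewrite ler_pM2l// moment1_close.
Qed.

Let mean_root x : accepted_mean w nt accept true x <= w x.
Proof.
apply: le_trans (sum_pois_mean #|'I_n|.+1 (ltW (w_gt0 x))).
by apply: ler_sum => m _; rewrite ler_wpM2r// accept_root.
Qed.

Let reject_inner : \sum_y w y / Lam * reject w nt accept false y <= offspring_dist.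
Proof.
have -> : \sum_y w y / Lam * reject w nt accept false y =
   \sum_(m < #|'I_n|.+1) empirical_mixed_pois m *
     (1 - Num.min 1 (mixed_pois nu m / empirical_mixed_pois m)).
  rewrite /reject; under eq_bigr do rewrite mulr_sumr.
  rewrite exchange_big/=; apply: eq_bigr => m _.
  rewrite /empirical_mixed_pois mulr_suml; apply: eq_bigr => y _.
  by rewrite -/(ofs y m) ofsE mulrA.
rewrite (sum_min (mixed_pois nu) _ emp_gt0).
exact: (sum_mixed_pois_close (fun m => mixed_pois nu m < empirical_mixed_pois m)).
Qed.

(** Averaged over labels, accepted offspring is dominated by the limiting law, whose mean is that of
    the size-biased weight. *)
Let mean_inner : \sum_y w y / Lam * accepted_mean w nt accept false y <= g2.
Proof.
have -> : \sum_y w y / Lam * accepted_mean w nt accept false y =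
   \sum_(m < #|'I_n|.+1) (\sum_y w y / Lam * (ofs y m * accept false y m)) * m%:R.
  rewrite /accepted_mean; under eq_bigr do rewrite mulr_sumr.
  rewrite exchange_big/=; apply: eq_bigr => m _; rewrite [RHS]mulr_suml.
  by apply: eq_bigr => y _; rewrite mulrA.
apply: (@le_trans _ _ (\sum_(m < #|'I_n|.+1) m%:R * mixed_pois nu m)).
  by apply: ler_sum => m _; rewrite mulrC ler_wpM2l// accept_inner.
rewrite -lee_fin (sum_mixed_poisE nu_pos nu_mean (c := fun m => m%:R))//.
rewrite -integral_size_biased_id; apply: ge0_le_integral => //.
- by move=> x _; rewrite lee_fin sumr_ge0// => m _; rewrite mulr_ge0// pois_ge0// m0_ge0.
- apply/measurable_EFinP; apply: measurable_sum => m.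
  by apply: measurable_funM => //; exact: measurable_pois.
- by apply/measurable_EFinP; exact: mm0.
- move=> x _; rewrite lee_fin; under eq_bigr do rewrite mulrC.
  by apply: sum_pois_mean; exact: m0_ge0.
Qed.

Lemma runs_mass_ge l (V : {set 'I_n}) (k : R) : 0 < k ->
  1 - coupling_bound nu w V l alpha k <=
  \sum_(h <- runs #|'I_n| (root_nodes l V) V)
    \prod_(s <- h) step_weight w nt accept s.
Proof.
move=> k0; have al0 := dist_ge0.
have rho0 : 0 <= alpha / theta by rewrite divr_ge0// ltW.
have S0 : 0 <= \sum_(v in V) w v by apply: sumr_ge0 => v _; exact: ltW.
have S20 : 0 <= \sum_v w v ^+ 2 by apply: sumr_ge0 => v _; exact: sqr_ge0.
have G20 : 0 <= G2 := divr_ge0 S20 (ltW nt_gt0).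
have G210 : 0 <= G2 / G1 := divr_ge0 G20 (ltW G1_gt0).
have tau0 : 0 <= offspring_dist := addr_ge0 al0 (mulr_ge0 rho0 G210).
have := exploration_mass_ge w_gt0 nt_gt0 accept01 tau0 limit_moment2_ge0
  (ofs_mean _) reject_inner mean_inner reject_root mean_root k0 l V.
apply: le_trans; rewrite lerD2l lerN2 /coupling_bound -/theta -/nt -/g2.
have momentE p : moment w theta p = (\sum_v w v ^+ p) / nt by rewrite /moment mulrC.
have m1E : moment w theta 1 = G1.
  by rewrite momentE /G1; congr (_ / _); apply: eq_bigr => v _; rewrite expr1.
have kap0 p : 0 <= trunc_moment w theta p.
  apply: mulr_ge0; first by rewrite invr_ge0 ltW.
  by apply: sumr_ge0 => v _; rewrite mulr_ge0// exprn_ge0// ltW.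
rewrite m1E !momentE -/G2.
set G3 := (\sum_v w v ^+ 3) / nt; set S := \sum_(v in V) w v.
set S2 := \sum_(v in V) _ ^+ 2.
set S' := \sum_(v in V) w v * _%:R.
have S'0 : 0 <= G1 * S'.
  apply: mulr_ge0 (ltW G1_gt0) _; apply: sumr_ge0 => v _.
  by rewrite mulr_ge0// ltW.
have V0 : 0 <= #|V|%:R * k^-1 by rewrite mulr_ge0// invr_ge0 ltW.
have k20 : 0 <= k ^+ 2 / (nt * G1).
  by apply: divr_ge0; [exact: sqr_ge0|exact: mulr_ge0 (ltW nt_gt0) (ltW G1_gt0)].
have hA : (G2 + 1) ^+ l * (G3 / nt + k^-1 + k / nt) * S <=
    (G2 + 1) ^+ l * (G3 / nt + trunc_moment w theta 1 + trunc_moment w theta 2 +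
      (2 + G1) / k + k / nt) * S.
  rewrite ler_wpM2r// ler_wpM2l ?exprn_ge0 ?addr_ge0// lerD2r.
  have := kap0 1%N; have := kap0 2%N.
  have : k^-1 <= (2 + G1) / k.
    by rewrite ler_peMl ?invr_ge0 ?(ltW k0)//; have := G1_gt0; lra.
  by move: (G3 / nt) => *; lra.
(* For l = 0 the left side is 0 and the power with exponent -1 need only be nonnegative; for l = l'
   + 1 both sides are equal. *)
have hB : S * (if l is l'.+1 then alpha / theta + (g2 + 1) ^+ l' * offspring_dist else 0) <=
    S * alpha * (theta^-1 + (g2 + 1) ^ (l%:Z - 1) * (G2 / (theta * G1) + 1)).
  have g20 := limit_moment2_ge0.
  rewrite -mulrA ler_wpM2l//; case: (l) => [|l'].
    apply: mulr_ge0 => //; apply: addr_ge0; first by rewrite invr_ge0 ltW.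
    apply: mulr_ge0; first by apply: exprz_ge0; exact: addr_ge0.
    apply: addr_ge0 => //; apply: divr_ge0 => //.
    exact: mulr_ge0 (ltW theta_gt0) (ltW G1_gt0).
  rewrite (_ : l'.+1%:Z - 1 = l'%:Z); last by rewrite -addn1 PoszD addrK.
  rewrite -exprnP /offspring_dist; move: (_ ^+ l') => y.
  rewrite le_eqVlt; apply/orP; left; apply/eqP; field.
  by rewrite !gt_eqF.
move: hA hB; set a1 := _ * _ * S; set a2 := _ * _ * S; set b1 := S * _; set b2 := S * _ * _.
by move: a1 a2 b1 b2 => *; lra.
Qed.

End weights_close.

(** * Countably many discrete variables from one uniform variable *)

Section uniform.
Context (R : realType).

Definition unif : probability (measurableTypeR R) R := uniform_prob (@ltr01 R).

(** The null endpoint 1 is removed because the intervals of the digits below are half-open. *)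
Lemma unifE (A : set (measurableTypeR R)) : measurable A -> unif A = lebesgue_measure (A `&` `[0%R, 1%R[).
Proof.
move=> mA; rewrite /unif /= /uniform_prob integral_uniform_pdf.
rewrite (eq_integral (fun=> 1%E)); last first.
  by move=> x; rewrite inE => -[_]; rewrite /= in_itv/= /uniform_pdf => ->; rewrite subr0 invr1.
rewrite integral_cst; last exact: measurableI.
rewrite mul1e; apply/eqP; rewrite eq_le; apply/andP; split.
  apply: (@le_trans _ _ (lebesgue_measure (A `&` `[0, 1[ `|` [set 1]))).
    apply: le_measure; rewrite ?inE.
    - exact: measurableI.
    - by apply: measurableU => //; exact: measurableI.
    move=> x [Ax] /=; rewrite !in_itv/= => /andP[x0].
    by rewrite le_eqVlt => /predU1P[->|x1]; [right|left; split => //=; rewrite ?in_itv/= ?x0].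
  apply: (le_trans (measureU2 _ _ _)) => //; first exact: measurableI.
  by rewrite [X in (_ + X)%E](@lebesgue_measure_set1 R) adde0.
apply: le_measure; rewrite ?inE; [exact: measurableI|exact: measurableI|].
move=> x [Ax] /=; rewrite !in_itv/= => /andP[x0 x1]; split => //=.
by rewrite ?in_itv/= x0 ltW.
Qed.

(** The pushforward scaled by 1/c gives every half-open interval its length, which characterises
    Lebesgue measure. *)
Lemma lebesgue_affine (a c : R) (B : set (measurableTypeR R)) : 0 < c -> measurable B ->
  lebesgue_measure ((fun x => (x - a) / c) @^-1` B) = (c%:E * lebesgue_measure B)%E.
Proof.
move=> c0 mB; pose f (x : measurableTypeR R) : measurableTypeR R := (x - a) / c.
have mf : measurable_fun [set: measurableTypeR R] f.
  by apply: measurable_funM => //; exact: measurable_funB.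
have ci0 : 0 <= c^-1 by rewrite invr_ge0 ltW.
pose nu : {measure set (measurableTypeR R) -> \bar R} :=
  mscale (NngNum ci0) (pushforward (@lebesgue_measure R) f).
have : lebesgue_measure B = nu mf B.
  apply: lebesgue_measure_unique => // X [[u v] _ <-].
  rewrite /nu /mscale /= /pushforward.
  transitivity ((c^-1)%:E * lebesgue_measure `](c * u + a)%R, (c * v + a)%R]%classic)%E; last first.
    congr (_ * _)%E; congr (lebesgue_measure _).
    apply/seteqP; split => x /=; rewrite !in_itv/= /f ltr_pdivlMr// ler_pdivrMr//;
    by rewrite ltrBrDr lerBlDr !(mulrC c).
  rewrite !lebesgue_measure_itv/= !lte_fin ltrD2r ltr_pM2l//.
  case: ifPn => _; last by rewrite mule0.
  rewrite -!EFinB -EFinM; congr (_%:E); field; rewrite gt_eqF//.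
rewrite /nu /mscale /= /pushforward => ->; rewrite muleA -EFinM divff ?gt_eqF//.
by rewrite mul1e.
Qed.

End uniform.

Section inverse.
Context d (Y : measurableType d) (R : realType).

Lemma measurable_funV_ge0 (f : Y -> R) : (forall y, 0 <= f y) ->
  measurable_fun [set: Y] f -> measurable_fun [set: Y] (fun y => (f y)^-1).
Proof.
move=> f0 mf; rewrite (_ : (fun y => (f y)^-1) = (fun y => f y `^ (-1))).
  exact: measurableT_comp (measurable_powR _) mf.
by apply/funext => y; rewrite powR_inv1.
Qed.

Lemma measurable_lt_set (f g : Y -> R) : measurable_fun [set: Y] f ->
  measurable_fun [set: Y] g -> measurable [set y | f y < g y].
Proof.
move=> mf mg; have := measurable_fun_ltr mf mg.
by move=> /(_ measurableT [set true]); rewrite setTI; apply.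
Qed.

Lemma measurable_le_set (f g : Y -> R) : measurable_fun [set: Y] f ->
  measurable_fun [set: Y] g -> measurable [set y | f y <= g y].
Proof.
move=> mf mg; have := measurable_fun_ler mf mg.
by move=> /(_ measurableT [set true]); rewrite setTI; apply.
Qed.

End inverse.

Section nat_valued.
Context d (Y : measurableType d).

Lemma measurable_fun_nat (f : Y -> nat) :
  (forall m, measurable [set y | f y = m]) -> measurable_fun [set: Y] f.
Proof.
move=> mf _ A _; rewrite setTI.
rewrite (_ : f @^-1` A = \bigcup_(m in A) [set y | f y = m]).
  by apply: bigcup_measurable => m _; exact: mf.
by apply/seteqP; split => [y Ay|y [m Am] /= ->//]; exists (f y).
Qed.

Lemma measurable_fun_case d' (Z : measurableType d') (D : Y -> nat)
    (g : nat -> Y -> Z) : measurable_fun [set: Y] D ->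
  (forall m, measurable_fun [set: Y] (g m)) ->
  measurable_fun [set: Y] (fun y => g (D y) y).
Proof.
move=> mD mg _ A mA; rewrite setTI.
rewrite (_ : _ @^-1` A = \bigcup_m (D @^-1` [set m] `&` g m @^-1` A)).
  apply: bigcup_measurable => m _; apply: measurableI.
    by rewrite -[X in measurable X]setTI; exact: mD.
  by rewrite -[X in measurable X]setTI; exact: mg.
by apply/seteqP; split => [y Ay|y [m _ [/= ->]]//]; exists (D y).
Qed.

End nat_valued.

Section digits.
Context (R : realType).
Local Notation Rm := (measurableTypeR R).

Definition cumul (c : nat -> R) (m : nat) : R := \sum_(j < m) c j.

(** Inversion of the distribution function. The default 0 is taken when no partial sum exceeds x,
    which for a probability law requires x >= 1. *)
Definition digit (c : nat -> R) (x : R) : nat :=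
  if pselect (exists m, x < cumul c m.+1) is left e then ex_minn e else 0%N.

(** The relative position of x in the interval of its digit: for uniform x it is again uniform and
    independent of the digit, so it can produce the next one. *)
Definition remainder (c : nat -> R) (x : R) : R :=
  (x - cumul c (digit c x)) / c (digit c x).

Lemma digitE c x m : digit c x = m <->
  (x < cumul c m.+1 /\ forall j, (j < m)%N -> cumul c j.+1 <= x) \/
  (m = 0%N /\ forall j, cumul c j.+1 <= x).
Proof.
rewrite /digit; case: pselect => [e|ne].
  case: ex_minnP => k xk kmin; split=> [<-|[[xm mmin]|[_ h]]].
  - left; split => // j jk; rewrite leNgt; apply/negP => /kmin.
    by rewrite leqNgt jk.
  - apply/eqP; rewrite eqn_leq kmin//= leqNgt; apply/negP => /mmin.
    by rewrite leNgt xk.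
  - by have := h k; rewrite leNgt xk.
split=> [<-|[[xm _]|[-> //]]]; last by case: ne; exists m.
by right; split => // j; rewrite leNgt; apply/negP => xj; apply: ne; exists j.
Qed.

Section measurability.
Context d (Y : measurableType d) (c : Y -> nat -> R) (z : Y -> Rm).
Hypothesis mc : forall m, measurable_fun [set: Y] (fun y => c y m : Rm).
Hypothesis c_ge0 : forall y m, 0 <= c y m.
Hypothesis mz : measurable_fun [set: Y] z.

Let mcumul m : measurable_fun [set: Y] (fun y => cumul (c y) m : Rm).
Proof. by apply: measurable_sum => j; exact: mc. Qed.

Let mlt j : measurable [set y | z y < cumul (c y) j.+1].
Proof. exact: (@measurable_lt_set _ Y R z (fun y => cumul (c y) j.+1) mz (mcumul j.+1)). Qed.

Let mge j : measurable [set y | cumul (c y) j.+1 <= z y].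
Proof. exact: (@measurable_le_set _ Y R (fun y => cumul (c y) j.+1) z (mcumul j.+1) mz). Qed.

Lemma measurable_digit : measurable_fun [set: Y] (fun y => digit (c y) (z y)).
Proof.
apply: measurable_fun_nat => m.
rewrite (_ : [set y | _] =
  ([set y | z y < cumul (c y) m.+1] `&`
    \bigcap_(j in [set j | (j < m)%N]) [set y | cumul (c y) j.+1 <= z y]) `|`
  (if m == 0%N then \bigcap_j [set y | cumul (c y) j.+1 <= z y] else set0)).
  apply: measurableU; last by case: ifP => // _; exact: bigcap_measurableType.
  by apply: measurableI => //; exact: bigcap_measurableType.
apply/seteqP; split => y /=.
  move=> /digitE[[h1 h2]|[-> h]]; first by left; split => // j; exact: h2.
  by right=> j _; exact: h.
move=> [[h1 h2]|]; first by apply/digitE; left; split => // j jm; exact: h2.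
by case: eqP => // -> h; apply/digitE; right; split => // j; exact: h.
Qed.

Lemma measurable_remainder :
  measurable_fun [set: Y] (fun y => remainder (c y) (z y) : Rm).
Proof.
pose g m y : Rm := (z y - cumul (c y) m) / c y m.
apply: (measurable_fun_case (g := g) measurable_digit) => m.
have h1 : measurable_fun [set: Y] (fun y => (z y : R) - cumul (c y) m).
  exact: (measurable_funB mz (mcumul m)).
have h2 : measurable_fun [set: Y] (fun y => (c y m)^-1).
  exact: (measurable_funV_ge0 (c_ge0^~ m) (mc m)).
exact: measurable_funM h1 h2.
Qed.

End measurability.
End digits.

Section digit_law.
Context (R : realType) (c : nat -> R).
Hypotheses (c_ge0 : forall m, 0 <= c m) (c_cvg : cumul c N @[N --> \oo] --> (1 : R)).
Local Notation Rm := (measurableTypeR R).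

Let cumul_mono m p : (m <= p)%N -> cumul c m <= cumul c p.
Proof.
move=> mp; rewrite /cumul (big_ord_widen _ c mp) big_mkcond/=.
by apply: ler_sum => i _; case: ifP.
Qed.

Let cumul_le1 m : cumul c m <= 1.
Proof.
rewrite -(cvg_lim _ c_cvg)//; apply: nondecreasing_cvgn_le; first exact: cumul_mono.
by apply/cvg_ex; exists 1.
Qed.

Let cumul_lt x : x < 1 -> exists m, x < cumul c m.+1.
Proof.
move=> x1; have /cvgr_gt/(_ x x1)[N _ hN] := c_cvg.
by exists N; apply: hN => /=; exact: leqnSn.
Qed.

Let digit_itv x m : 0 <= x < 1 -> digit c x = m <-> cumul c m <= x < cumul c m.+1.
Proof.
move=> /andP[x0 x1]; rewrite digitE; split=> [[[xm h]|[_ h]]|/andP[mx xm]].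
- rewrite xm andbT; case: m xm h => [|m] xm h; first by rewrite /cumul big_ord0.
  exact: h.
- by have [k xk] := cumul_lt x1; have := h k; rewrite leNgt xk.
- by left; split => // j jm; apply: le_trans mx; exact: cumul_mono.
Qed.

Let mdigit : measurable_fun [set: Rm] (digit c).
Proof. by apply: (@measurable_digit R _ Rm (fun=> c) id) => // m; exact: measurable_cst. Qed.

Let mremainder : measurable_fun [set: Rm] (remainder c : Rm -> Rm).
Proof. by apply: (@measurable_remainder R _ Rm (fun=> c) id) => // m; exact: measurable_cst. Qed.

Let cumulS m : cumul c m.+1 = cumul c m + c m.
Proof. by rewrite /cumul big_ord_recr. Qed.

Lemma measurable_digit_pre A : measurable (digit c @^-1` A : set Rm).
Proof. by rewrite -[X in measurable X]setTI; exact: mdigit. Qed.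

Lemma measurable_remainder_pre (B : set Rm) : measurable B -> measurable (remainder c @^-1` B : set Rm).
Proof. by move=> mB; rewrite -[X in measurable X]setTI; exact: mremainder. Qed.

Lemma unif_digit1 m (B : set Rm) : measurable B ->
  unif R (digit c @^-1` [set m] `&` remainder c @^-1` B) = ((c m)%:E * unif R B)%E.
Proof.
move=> mB; rewrite !unifE//; last by apply: measurableI; [exact: measurable_digit_pre|exact: measurable_remainder_pre].
(* A digit of probability 0 has an empty interval, so the division by [c m] never matters on it. *)
have [c0|c0] := eqVneq (c m) 0.
  rewrite c0 mul0e (_ : _ `&` _ = set0) ?measure0//; apply/seteqP; split => // x.
  move=> [[/= dm _]]; rewrite in_itv/= => x01; have /(digit_itv _ x01) := dm.
  by rewrite cumulS c0 addr0 => /andP[/le_lt_trans h /h]; rewrite ltxx.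
have cm0 : 0 < c m by rewrite lt_neqAle eq_sym c0 c_ge0.
rewrite -(lebesgue_affine (cumul c m) cm0); last exact: measurableI.
congr (lebesgue_measure _); apply/seteqP; split => x /=.
  move=> [[dm]]; rewrite /remainder dm => Bx x01; split => //.
  move: x01; rewrite !in_itv/= => x01; have /(digit_itv _ x01) := dm.
  by rewrite cumulS => /andP[? ?]; rewrite ler_pdivlMr// ltr_pdivrMr//; apply/andP; split; lra.
rewrite in_itv/= ler_pdivlMr// ltr_pdivrMr// mul0r mul1r => -[Bx /andP[h1 h2]].
have x01 : 0 <= x < 1.
  have := cumul_le1 m.+1; have := cumul_mono (leq0n m).
  by rewrite cumulS /cumul big_ord0 -/(cumul c m) => ? ?; apply/andP; split; lra.
have dm : digit c x = m by apply/(digit_itv _ x01); rewrite cumulS; apply/andP; split; lra.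
by split; [split => //; rewrite /remainder dm|rewrite in_itv/=].
Qed.

Lemma unif_digitE m : unif R (digit c @^-1` [set m]) = (c m)%:E.
Proof.
have := @unif_digit1 m setT measurableT.
by rewrite preimage_setT setIT probability_setT mule1.
Qed.

Lemma unif_digit (A : set nat) (B : set Rm) : measurable B ->
  unif R (digit c @^-1` A `&` remainder c @^-1` B) =
  (unif R (digit c @^-1` A) * unif R B)%E.
Proof.
move=> mB.
have decomp (C : set Rm) : measurable C -> unif R (digit c @^-1` A `&` C) =
    (\sum_(m <oo | m \in A) unif R (digit c @^-1` [set m] `&` C))%E.
  move=> mC; rewrite (_ : digit c @^-1` A `&` C =
      \bigcup_(m in A) (digit c @^-1` [set m] `&` C)).
    rewrite measure_bigcup//; first by move=> m _; apply: measurableI => //; exact: measurable_digit_pre.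
    by apply/trivIsetP => i j _ _ ij; apply/seteqP; split => // x [[/= e1 _] [/= e2 _]]; move/eqP: ij; rewrite -e1 -e2.
  apply/seteqP; split => [x [Ax Cx]|x [m Am [/= dm Cx]]]; first by exists (digit c x).
  by split => //=; rewrite dm.
have := decomp setT measurableT; rewrite setIT => ->.
rewrite decomp; last exact: measurable_remainder_pre.
under eq_eseriesr do rewrite unif_digit1//.
under [in RHS]eq_eseriesr do rewrite setIT unif_digitE.
have fB : unif R B \is a fin_num by exact: fin_num_measure.
rewrite -(fineK fB) muleC -nneseriesZl; last by move=> m _; rewrite lee_fin.
by apply: eq_eseriesr => m _; rewrite muleC.
Qed.

End digit_law.

Section digit_sequence.
Context (R : realType).
Local Notation Rm := (measurableTypeR R).

Fixpoint digit_state (c : nat -> nat -> R) (x : R) (i : nat) : R :=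
  if i is i'.+1 then remainder (c i') (digit_state c x i') else x.

Definition digits (c : nat -> nat -> R) (x : R) (i : nat) : nat :=
  digit (c i) (digit_state c x i).

Section measurability.
Context d (Y : measurableType d) (c : Y -> nat -> nat -> R) (z : Y -> Rm).
Hypothesis mc : forall i m, measurable_fun [set: Y] (fun y => c y i m : Rm).
Hypothesis c_ge0 : forall y i m, 0 <= c y i m.
Hypothesis mz : measurable_fun [set: Y] z.

Lemma measurable_digit_state i :
  measurable_fun [set: Y] (fun y => digit_state (c y) (z y) i : Rm).
Proof.
elim: i => //= i IH; apply: (measurable_remainder (c := fun y => c y i)) => //.
Qed.

Lemma measurable_digits i :
  measurable_fun [set: Y] (fun y => digits (c y) (z y) i).
Proof.
apply: (measurable_digit (c := fun y => c y i)) => //; exact: measurable_digit_state.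
Qed.

End measurability.

Context (c : nat -> nat -> R).
Hypotheses (c_ge0 : forall i m, 0 <= c i m)
  (c_cvg : forall i, cumul (c i) N @[N --> \oo] --> (1 : R)).

(** The conditions on digit k and on the state after it form a single event on the state before it,
    to which the induction hypothesis applies. *)
Let digits_prefix k (A : nat -> set nat) (B : set Rm) : measurable B ->
  unif R (\bigcap_(i in [set i | (i < k)%N]) ((digits c)^~ i @^-1` A i) `&`
          (fun x => digit_state c x k) @^-1` B) =
  (\prod_(i < k) unif R (digit (c i) @^-1` A i) * unif R B)%E.
Proof.
elim: k B => [|k IH] B mB.
  rewrite big_ord0 mul1e; congr (unif R _); apply/seteqP; split => [x []//|x Bx].
  by split.
have mB' : measurable (digit (c k) @^-1` A k `&` remainder (c k) @^-1` B : set Rm).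
  by apply: measurableI; [exact: measurable_digit_pre|exact: measurable_remainder_pre].
rewrite big_ord_recr/= -muleA -unif_digit// -IH//; congr (unif R _).
apply/seteqP; split => x [h1 /= h2]; split.
- by move=> i /= ik; apply: h1; exact: ltnW.
- by split => //; exact: (h1 k (ltnSn k)).
- move=> i /=; rewrite ltnS leq_eqVlt => /predU1P[->|ik]; first by case: h2.
  exact: h1.
- by case: h2.
Qed.

Lemma unif_digitsE i (A : set nat) :
  unif R ((digits c)^~ i @^-1` A) = unif R (digit (c i) @^-1` A).
Proof.
have := @digits_prefix i.+1 (fun j => if j == i then A else setT) setT measurableT.
rewrite big_ord_recr/= eqxx probability_setT mule1 big1 ?mul1e.
  move=> <-; congr (unif R _); rewrite preimage_setT setIT.
  apply/seteqP; split => [x Ax j /= ji|x /(_ i (ltnSn i))/=]; last by rewrite eqxx.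
  by case: eqP => [->|].
by move=> j _; rewrite ltn_eqF// preimage_setT probability_setT.
Qed.

Lemma unif_digits_indep (J : seq nat) (A : nat -> set nat) : uniq J ->
  unif R (\bigcap_(i in [set i | i \in J]) ((digits c)^~ i @^-1` A i)) =
  (\prod_(i <- J) unif R ((digits c)^~ i @^-1` A i))%E.
Proof.
(* Indices below k outside [J] receive the trivial event. *)
move=> uJ; pose k := (\max_(i <- J) i).+1.
have Jk i : i \in J -> (i < k)%N by move=> iJ; rewrite ltnS leq_bigmax_seq.
have := @digits_prefix k (fun i => if i \in J then A i else setT) setT measurableT.
rewrite probability_setT mule1 preimage_setT setIT.
rewrite (_ : \bigcap_(i in _) _ =
    \bigcap_(i in [set i | i \in J]) ((digits c)^~ i @^-1` A i)); last first.
  apply/seteqP; split => x h i /=.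
    by move=> iJ; have := h i (Jk i iJ); rewrite /= iJ.
  by move=> ik; case: ifP => // iJ; exact: h.
move=> ->.
rewrite (bigID (fun i : 'I_k => val i \in J))/= [X in (_ * X)%E]big1 ?mule1; last first.
  by move=> i /negPf ->; rewrite preimage_setT probability_setT.
rewrite (eq_bigr (fun i : 'I_k => unif R ((digits c)^~ i @^-1` A i))); last first.
  by move=> i iJ; rewrite iJ unif_digitsE.
rewrite -(big_mkord (fun i => i \in J) (fun i => unif R ((digits c)^~ i @^-1` A i))).
rewrite -big_filter; apply: perm_big; apply: uniq_perm => //.
  by rewrite filter_uniq// iota_uniq.
move=> i; rewrite mem_filter mem_index_iota /=.
by apply/andP/idP => [[]//|iJ]; split => //; exact: Jk.
Qed.

End digit_sequence.

(* Completion of a partial coupling: [mu h] is the mass of the history [h],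
   [P g * ow g h] the joint weight of a graph and a history, and [z h] the
   conditional weight of [h] given the trees. *)
Section gluing.
Context (R : realType) (H : eqType) (Gr : finType) (hs : seq H).
Context (mu : H -> R) (P : Gr -> R) (ow : Gr -> H -> R).

Definition completion_marginal (h : H) : R := \sum_g P g * ow g h.

Definition completion_cond (h : H) (g : Gr) : R := P g * ow g h / completion_marginal h.

Definition completion_mass : R := \sum_(h <- hs) mu h.

(** What is missing to restore [P], normalised. At mass 1 nothing is missing, and [P] serves as an
    arbitrary probability law. *)
Definition completion_residual (g : Gr) : R :=
  if completion_mass == 1 then P g
  else (P g - \sum_(h <- hs) mu h * completion_cond h g) / (1 - completion_mass).

Definition completion (z : H -> R) (g : Gr) : R :=
  \sum_(h <- hs) z h * completion_cond h g +
  (1 - \sum_(h <- hs) z h) * completion_residual g.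

Hypotheses (P_ge0 : forall g, 0 <= P g) (P_sum : \sum_g P g = 1).
Hypotheses (ow_ge0 : forall g h, 0 <= ow g h)
  (ow_sum : forall g, \sum_(h <- hs) ow g h <= 1).
Hypotheses (mu_ge0 : forall h, 0 <= mu h)
  (mu_le : forall h, h \in hs -> mu h <= completion_marginal h).

Let marginal_ge0 h : 0 <= completion_marginal h.
Proof. by apply: sumr_ge0 => g _; rewrite mulr_ge0. Qed.

Lemma completion_cond_ge0 h g : 0 <= completion_cond h g.
Proof. by rewrite divr_ge0 ?mulr_ge0. Qed.

Lemma completion_cond_sum h : h \in hs -> mu h != 0 -> \sum_g completion_cond h g = 1.
Proof.
move=> hh m0; rewrite -mulr_suml divff// gt_eqF// (lt_le_trans _ (mu_le hh))//.
by rewrite lt_neqAle eq_sym m0 mu_ge0.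
Qed.

(** No graph is overspent: [mu] is below the marginal, and the histories of one graph weigh at most
    1 together. *)
Let sub_le g : \sum_(h <- hs) mu h * completion_cond h g <= P g.
Proof.
apply: (@le_trans _ _ (\sum_(h <- hs) P g * ow g h)); last first.
  by rewrite -mulr_sumr ler_piMr.
rewrite big_seq [leRHS]big_seq; apply: ler_sum => h hh.
rewrite /completion_cond mulrCA ler_piMr ?mulr_ge0//.
have [m0|m0] := eqVneq (completion_marginal h) 0; first by rewrite m0 invr0 mulr0.
have mp : 0 < completion_marginal h by rewrite lt_neqAle eq_sym m0 marginal_ge0.
by rewrite ler_pdivrMr// mul1r mu_le.
Qed.

Let sub_sum : \sum_g \sum_(h <- hs) mu h * completion_cond h g = completion_mass.
Proof.
rewrite exchange_big/= /completion_mass big_seq [RHS]big_seq; apply: eq_bigr => h hh.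
rewrite -mulr_sumr; have [->|m0] := eqVneq (mu h) 0; first by rewrite mul0r.
by rewrite completion_cond_sum ?mulr1.
Qed.

Lemma completion_mass_le1 : completion_mass <= 1.
Proof. by rewrite -sub_sum -P_sum; apply: ler_sum => g _; exact: sub_le. Qed.

Let mass_lt1 : completion_mass != 1 -> 0 < 1 - completion_mass.
Proof. by move=> m1; rewrite subr_gt0 lt_neqAle m1 completion_mass_le1. Qed.

Lemma completion_residual_ge0 g : 0 <= completion_residual g.
Proof.
rewrite /completion_residual; case: ifPn => // /mass_lt1/ltW m1.
by rewrite divr_ge0// subr_ge0.
Qed.

Lemma completion_residual_sum : \sum_g completion_residual g = 1.
Proof.
rewrite /completion_residual; case: eqP => [//|/eqP/mass_lt1 m1].
by rewrite -mulr_suml sumrB P_sum sub_sum divff// gt_eqF.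
Qed.

Lemma completion_residualE g :
  \sum_(h <- hs) mu h * completion_cond h g + (1 - completion_mass) * completion_residual g = P g.
Proof.
rewrite /completion_residual; case: eqP => [m1|/eqP/mass_lt1 m1]; last first.
  by rewrite mulrC divfK ?gt_eqF// addrC subrK.
rewrite m1 subrr mul0r addr0.
(* At mass 1 these nonnegative deficits add up to 0, so each vanishes. *)
have : \sum_g (P g - \sum_(h <- hs) mu h * completion_cond h g) = 0.
  by rewrite sumrB P_sum sub_sum m1 subrr.
move/eqP; rewrite psumr_eq0 => [/allP/(_ g)|g' _]; last by rewrite subr_ge0.
by rewrite mem_index_enum subr_eq0 => /(_ isT)/eqP.
Qed.

Context (z : H -> R).
Hypotheses (z_ge0 : forall h, 0 <= z h) (z_sum : \sum_(h <- hs) z h <= 1)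
  (z_mu : forall h, mu h = 0 -> z h = 0).

Lemma completion_ge0 g : 0 <= completion z g.
Proof.
rewrite addr_ge0 ?mulr_ge0 ?subr_ge0 ?completion_residual_ge0//.
by apply: sumr_ge0 => h _; rewrite mulr_ge0 ?completion_cond_ge0.
Qed.

Let z_cond : \sum_g \sum_(h <- hs) z h * completion_cond h g = \sum_(h <- hs) z h.
Proof.
rewrite exchange_big/= big_seq [RHS]big_seq; apply: eq_bigr => h hh.
rewrite -mulr_sumr; have [m0|m0] := eqVneq (mu h) 0.
  by rewrite z_mu ?mul0r.
by rewrite completion_cond_sum ?mulr1.
Qed.

Lemma completion_sum : \sum_g completion z g = 1.
Proof. by rewrite /completion big_split/= z_cond -mulr_sumr completion_residual_sum mulr1 addrC subrK. Qed.

(** The components of the histories are carried by graphs outside [F], which therefore receive at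
    least the sum of [z]. *)
Lemma completion_failure_le (F : pred Gr) :
  (forall g h, h \in hs -> z h != 0 -> ow g h != 0 -> ~~ F g) ->
  \sum_(g | F g) completion z g <= 1 - \sum_(h <- hs) z h.
Proof.
move=> hF; rewrite lerBrDr -[leRHS]completion_sum [leRHS](bigID F)/= lerD2l.
apply: (@le_trans _ _ (\sum_(g | ~~ F g) \sum_(h <- hs) z h * completion_cond h g)).
  rewrite -[leLHS]z_cond [leLHS](bigID F)/= big1 ?add0r// => g Fg.
  rewrite big_seq big1// => h hh.
  have [->|z0] := eqVneq (z h) 0; first by rewrite mul0r.
  have [ow0|ow0] := eqVneq (ow g h) 0; first by rewrite /completion_cond ow0 mulr0 mul0r mulr0.
  by have := hF g h hh z0 ow0; rewrite Fg.
apply: ler_sum => g _; rewrite /completion lerDl mulr_ge0 ?subr_ge0//.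
exact: completion_residual_ge0.
Qed.

End gluing.

(** * The coupling kernel *)

Section parameter_measurability.
Context (R : realType) (nu : probability R R).
Hypothesis nu_pos : nu `]0, +oo[%classic = 1%E.
Hypothesis nu_mean : (0 < \int[nu]_x x%:E < +oo)%E.
Context (n l : nat) (V : {set 'I_n}) (n_gt0 : (0 < n)%N).
Context d (Y : measurableType d) (w : Y -> 'I_n -> R).
Hypothesis mw : forall v, measurable_fun [set: Y] (fun y => w y v).
Hypothesis w_gt0 : forall y v, 0 < w y v.

Let theta := mean nu.
Let nt := n%:R * theta.
Let theta_gt0 : 0 < theta := mean_gt0 nu_mean.
Let nt_gt0 : 0 < nt. Proof. by rewrite mulr_gt0// ltr0n. Qed.

Definition histories : seq (seq (step 'I_n)) := runs #|'I_n| (root_nodes l V) V.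

Definition node_pois (y : Y) (i : 'I_n * seq nat) (m : nat) : R :=
  if i.2 == [::] then pois (w y i.1) m else mixed_pois nu m.

Definition mass (y : Y) (h : seq (step 'I_n)) : R :=
  \prod_(s <- h) step_weight (w y) nt (accept nu (w y)) s.

Definition tree_prob (y : Y) (h : seq (step 'I_n)) : R :=
  \prod_(s <- h) node_pois y (addr s.1) (size s.2).

Definition ordering (g : graph n) (h : seq (step 'I_n)) : R :=
  \prod_(s <- h) order_weight R g s.

Let acc01 y := accept01 nu_mean n_gt0 (w_gt0 y).

Let msum (f : Y -> 'I_n -> R) : (forall v, measurable_fun [set: Y] (fun y => f y v)) ->
  measurable_fun [set: Y] (fun y => \sum_v f y v).
Proof. by move=> mf; apply: measurable_sum. Qed.

Lemma measurable_fun_pois (f : Y -> R) m : measurable_fun [set: Y] f ->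
  measurable_fun [set: Y] (fun y => pois (f y) m).
Proof.
move=> mf; apply: measurable_funM; first apply: measurable_funM => //.
  exact: measurable_funX.
apply: measurableT_comp => //; exact: measurable_funN.
Qed.

Let mG1w x : measurable_fun [set: Y] (fun y => (\sum_v w y v) / nt * w y x).
Proof. by apply: measurable_funM => //; apply: measurable_funM => //; exact: msum. Qed.

Let G1w_ge0 y x : 0 <= (\sum_v w y v) / nt * w y x.
Proof.
apply: mulr_ge0; last exact: ltW.
by apply: divr_ge0; [apply: sumr_ge0 => v _|]; exact: ltW.
Qed.

Let mp x : measurable_fun [set: Y] (fun y => w y x / \sum_v w y v).
Proof.
apply: measurable_funM => //; apply: measurable_funV_ge0; last exact: msum.
by move=> y; apply: sumr_ge0 => v _; exact: ltW.
Qed.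

Let memp m : measurable_fun [set: Y] (fun y => empirical_mixed_pois nu (w y) m).
Proof.
by apply: msum => v; apply: measurable_funM => //; exact: measurable_fun_pois.
Qed.

Let maccept b x m : measurable_fun [set: Y] (fun y => accept nu (w y) b x m).
Proof.
rewrite /accept; case: b; apply: measurable_minr => //; apply: measurable_funM => //.
- exact: measurable_fun_pois.
- apply: measurable_funV_ge0; last exact: measurable_fun_pois.
  by move=> y; exact: pois_ge0.
- apply: measurable_funV_ge0 => // y; apply: sumr_ge0 => v _.
  apply: mulr_ge0; last exact: pois_ge0.
  by apply: divr_ge0; [exact: ltW|apply: sumr_ge0 => u _; exact: ltW].
Qed.

Let moverlap x z b : measurable_fun [set: Y] (fun y => overlap (w y x * w y z / nt) b).
Proof.
have mlam : measurable_fun [set: Y] (fun y => w y x * w y z / nt).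
  by apply: measurable_funM => //; exact: measurable_funM.
rewrite /overlap; case: b.
  apply: measurable_funM => //; apply: measurableT_comp => //; exact: measurable_funN.
by apply: measurable_maxr => //; exact: measurable_funB.
Qed.

Lemma measurable_mass h : measurable_fun [set: Y] (fun y => mass y h).
Proof.
apply: measurable_prod => s _; apply: measurable_funM => //.
by apply: measurable_funM => //; apply: measurable_prod => z _; exact: moverlap.
Qed.

Lemma node_pois_ge0 y i m : 0 <= node_pois y i m.
Proof. by rewrite /node_pois; case: ifP => _; [apply: pois_ge0; exact: ltW|exact: mixed_pois_ge0]. Qed.

Lemma measurable_node_pois i m : measurable_fun [set: Y] (fun y => node_pois y i m).
Proof. by rewrite /node_pois; case: (i.2 == [::]) => //; exact: measurable_fun_pois. Qed.

Lemma tree_prob_ge0 y h : 0 <= tree_prob y h.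
Proof. by apply: prodr_ge0 => s _; exact: node_pois_ge0. Qed.

Lemma measurable_mass_ratio h :
  measurable_fun [set: Y] (fun y => mass y h / tree_prob y h).
Proof.
apply: measurable_funM; first exact: measurable_mass.
apply: measurable_funV_ge0; first by move=> y; exact: tree_prob_ge0.
by apply: measurable_prod => s _; exact: measurable_node_pois.
Qed.

Lemma measurable_graph_prob g : measurable_fun [set: Y] (fun y => graph_prob (w y) theta g).
Proof.
have mp01 e : measurable_fun [set: Y] (fun y => edge_prob (w y) theta e.1 e.2).
  apply: measurable_minr => //; apply: measurable_funM => //; exact: measurable_funM.
apply: measurable_prod => e _; case: (g e) => //.
exact: measurable_funB.
Qed.

Let marg y := completion_marginal (graph_prob (w y) theta) ordering.

Let ordering_ge0 g h : 0 <= ordering g h.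
Proof. by apply: prodr_ge0 => s _; exact: order_weight_ge0. Qed.

Let gp_ge0 y g : 0 <= graph_prob (w y) theta g.
Proof. exact: graph_prob_ge0 (w_gt0 y) theta_gt0 _. Qed.

Let gp_sum y : \sum_g graph_prob (w y) theta g = 1.
Proof. exact: sum_graph_prob. Qed.

Let mass_ge0 y h : 0 <= mass y h.
Proof. by apply: prodr_ge0 => s _; exact: (step_weight_ge0 (w_gt0 y) nt_gt0 (acc01 y)). Qed.

Let ordering_sum g : \sum_(h <- histories) ordering g h <= 1.
Proof.
apply: runs_order_weight_le1 => nd /mapP[v]; rewrite mem_enum => vV ->.
by split.
Qed.

Let mass_le y h : h \in histories -> mass y h <= marg y h.
Proof.
move=> hh; apply: le_trans (history_prob_ge (w_gt0 y) theta_gt0 _ _); last 2 first.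
- exact: slab_uniq hh.
- by move=> s s'; exact: step_par hh _ _.
apply: ler_prod => s _; rewrite (step_weight_ge0 (w_gt0 y) nt_gt0 (acc01 y))//=.
rewrite /step_weight ler_piMl ?arrange_weight_ge0//.
by case/andP: (acc01 y (par s.1 == None) (lab s.1) (size s.2)).
Qed.

Definition tree_weight (y : Y) (M : 'I_n * seq nat -> nat) (h : seq (step 'I_n)) : R :=
  (all (conform_tree M) h)%:R * (mass y h / tree_prob y h).

Lemma tree_weight_ge0 y M h : 0 <= tree_weight y M h.
Proof. by rewrite mulr_ge0// divr_ge0// tree_prob_ge0. Qed.

(** [tree_weight] is the product of the [label_weight] of the steps, once [node_pois] and [node_law]
    are matched by [step_rootP]. *)
Lemma tree_weight_sum y M : \sum_(h <- histories) tree_weight y M h <= 1.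
Proof.
have fuel : (size (root_nodes l V) + #|~: V| <= #|'I_n|)%N.
  by rewrite size_map -cardE cardsC.
have pr0 nd : nd \in root_nodes l V -> par nd = None by move=> /mapP[v _ ->].
have := @runs_label_weight_le1 _ R (w y) nt (w_gt0 y) nt_gt0 (accept nu (w y))
  (fun x => pois (w y x)) (mixed_pois nu) (acc01 y)
  (fun x m => pois_ge0 m (ltW (w_gt0 y x))) (mixed_pois_ge0 nu)
  (accept_root nu_mean n_gt0 (w_gt0 y)) (accept_inner nu_mean n_gt0 (w_gt0 y))
  M _ _ _ fuel pr0.
apply: le_trans; rewrite big_seq [leRHS]big_seq; apply: ler_sum => h hh.
rewrite /tree_weight /label_weight big_split/=.
have -> : (all (conform_tree M) h)%:R = \prod_(s <- h) (conform_tree M s)%:R :> R.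
  elim: (h) => [|s h' IH]; first by rewrite big_nil.
  by rewrite big_cons /= -IH; case: (conform_tree M s); rewrite ?mul1r ?mul0r.
apply: ler_wpM2l; first by apply: prodr_ge0.
rewrite big_split/= /mass ler_wpM2l//; first by apply: prodr_ge0 => s _; exact: (step_weight_ge0 (w_gt0 y) nt_gt0 (acc01 y)).
rewrite /tree_prob -prodfV le_eqVlt; apply/orP; left; apply/eqP.
rewrite big_seq [RHS]big_seq; apply: eq_bigr => s sh; congr (_^-1).
have [e1 e2] := step_rootP hh sh; rewrite /node_pois /node_law e1.
by case: ifP => // /e2 ->.
Qed.

Lemma tree_weight_mass y M h : mass y h = 0 -> tree_weight y M h = 0.
Proof. by move=> m0; rewrite /tree_weight m0 mul0r mulr0. Qed.

Definition coupling_weight (y : Y) (M : 'I_n * seq nat -> nat) : graph n -> R :=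
  completion histories (mass y) (graph_prob (w y) theta) ordering (tree_weight y M).

Lemma coupling_weight_ge0 y M g : 0 <= coupling_weight y M g.
Proof.
by apply: completion_ge0 => //; [exact: mass_le|exact: tree_weight_ge0|exact: tree_weight_sum].
Qed.

Lemma coupling_weight_sum y M : \sum_g coupling_weight y M g = 1.
Proof.
by apply: completion_sum => //; [exact: mass_le|exact: tree_weight_mass].
Qed.

Lemma coupling_weight_residual y g :
  \sum_(h <- histories) mass y h * completion_cond (graph_prob (w y) theta) ordering h g +
  (1 - completion_mass histories (mass y)) *
    completion_residual histories (mass y) (graph_prob (w y) theta) ordering g =
  graph_prob (w y) theta g.
Proof. by apply: completion_residualE => //; exact: mass_le. Qed.

Lemma coupling_weight_failure y M (F : pred (graph n)) :
  (forall g h, h \in histories -> all (conform_tree M) h -> all (conform g) h -> ~~ F g) ->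
  \sum_(g | F g) coupling_weight y M g <= 1 - \sum_(h <- histories) tree_weight y M h.
Proof.
move=> hF; apply: completion_failure_le => //.
- exact: mass_le.
- exact: tree_weight_sum.
- exact: tree_weight_mass.
move=> g h hh; rewrite /tree_weight mulf_eq0 negb_or => /andP[].
case: allP => [/allP Mh _ _|]; last by rewrite eqxx.
rewrite /ordering prodf_seq_neq0 => /allP gh; apply: (hF g h hh Mh).
by apply/allP => s /gh /=; rewrite /order_weight; case: (conform g s); rewrite ?mul0r ?eqxx.
Qed.

Lemma measurable_completion_cond h g : measurable_fun [set: Y]
  (fun y => completion_cond (graph_prob (w y) theta) ordering h g).
Proof.
apply: measurable_funM.
  by apply: measurable_funM => //; exact: measurable_graph_prob.
apply: measurable_funV_ge0.
  by move=> y; apply: sumr_ge0 => g' _; rewrite mulr_ge0.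
by apply: measurable_sum => g'; apply: measurable_funM => //; exact: measurable_graph_prob.
Qed.

Lemma measurable_completion_residual g : measurable_fun [set: Y]
  (fun y => completion_residual histories (mass y) (graph_prob (w y) theta) ordering g).
Proof.
have mmass : measurable_fun [set: Y] (fun y => completion_mass histories (mass y)).
  by apply: measurable_sum => h; exact: measurable_mass.
rewrite /completion_residual; apply: measurable_fun_ifT.
- apply: measurable_fun_eqr => //.
- exact: measurable_graph_prob.
apply: measurable_funM.
  apply: measurable_funB; first exact: measurable_graph_prob.
  apply: measurable_sum => h; apply: measurable_funM; first exact: measurable_mass.
  exact: measurable_completion_cond.
apply: measurable_funV_ge0; last exact: measurable_funB.
by move=> y; rewrite subr_ge0; apply: (@completion_mass_le1 _ _ _ _ _ (graph_prob (w y) theta) ordering) => //; exact: mass_le.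
Qed.

End parameter_measurability.

(** Graphs are stored as natural numbers, the discrete factor of the coupling space. *)
Definition fin_code (F : finType) (f : F) : nat := enum_rank f.

Definition fin_decode (F : finType) (f0 : F) (k : nat) : F := nth f0 (enum F) k.

Lemma fin_codeK (F : finType) (f0 f : F) : fin_decode f0 (fin_code f) = f.
Proof. exact: nth_enum_rank. Qed.

Section finite_mixture.
Context d (Z : measurableType d) (R : realType) (F : finType) (f0 : F).
Context (c : Z -> F -> R).

(* The unused arguments are the side conditions of the kernel structure, which
   has to recover them from the term. *)
Definition mixture (mc : forall f, measurable_fun [set: Z] (fun z => c z f))
    (c_ge0 : forall z f, 0 <= c z f) (c_sum : forall z, \sum_f c z f = 1) (z : Z) :
    {measure set (Z * nat) -> \bar R} :=
  msum (fun k => mscale (NngNum (c_ge0 z (fin_decode f0 k))) (dirac (z, k))) #|F|.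

Hypotheses (mc : forall f, measurable_fun [set: Z] (fun z => c z f))
  (c_ge0 : forall z f, 0 <= c z f) (c_sum : forall z, \sum_f c z f = 1).

Lemma mixtureE z A :
  mixture mc c_ge0 c_sum z A = (\sum_f c z f * \1_A (z, fin_code f))%:E.
Proof.
rewrite /mixture/= /msum (reindex (@enum_rank F))/=; last first.
  exact: onW_bij (enum_rank_bij _).
rewrite -sumEFin; apply: eq_bigr => f _; rewrite /mscale/= diracE.
by rewrite -/(fin_code f) fin_codeK indicE.
Qed.

Let measurable_mixture A : measurable A ->
  measurable_fun [set: Z] ((mixture mc c_ge0 c_sum) ^~ A).
Proof.
move=> mA; apply: (eq_measurable_fun (fun z => (\sum_f c z f * \1_A (z, fin_code f))%:E)).
  by move=> z _; rewrite mixtureE.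
apply/measurable_EFinP; apply: measurable_sum => f; apply: measurable_funM => //.
exact: (@measurableT_comp _ _ _ _ _ _ (\1_A : Z * nat -> R)).
Qed.

HB.instance Definition _ := isKernel.Build _ _ Z (Z * nat)%type R
  (mixture mc c_ge0 c_sum) measurable_mixture.

Let mixture_setT z : mixture mc c_ge0 c_sum z [set: Z * nat] = 1%E.
Proof.
by rewrite mixtureE; under eq_bigr do rewrite indicT mulr1; rewrite c_sum.
Qed.

HB.instance Definition _ := Kernel_isProbability.Build _ _ Z (Z * nat)%type R
  (mixture mc c_ge0 c_sum) mixture_setT.

End finite_mixture.

Section randomized_mixture.
Context d (Y : measurableType d) (R : realType) (F : finType) (f0 : F).
Local Notation Rm := (measurableTypeR R).
Context (c : Y * Rm -> F -> R).

Definition randomized_mixture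
    (mc : forall f, measurable_fun [set: Y * Rm] (fun z => c z f))
    (c_ge0 : forall z f, 0 <= c z f) (c_sum : forall z, \sum_f c z f = 1) :
    Y -> {measure set (Y * Rm * nat) -> \bar R} :=
  mkcomp (kprobability (measurable_cst (unif R : pprobability Rm R)))
    (mixture f0 mc c_ge0 c_sum).

Hypotheses (mc : forall f, measurable_fun [set: Y * Rm] (fun z => c z f))
  (c_ge0 : forall z f, 0 <= c z f) (c_sum : forall z, \sum_f c z f = 1).
Local Notation Q := (randomized_mixture mc c_ge0 c_sum).

Lemma randomized_mixtureE y A : Q y A =
  (\int[unif R]_x (\sum_f c (y, x) f * \1_A (y, x, fin_code f))%:E)%E.
Proof. by apply: eq_integral => x _; rewrite mixtureE. Qed.

HB.instance Definition _ := Kernel.on Q.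

Let Q_setT y : Q y [set: Y * Rm * nat] = 1%E.
Proof.
rewrite randomized_mixtureE; under eq_integral.
  move=> x _; under eq_bigr do rewrite indicT mulr1.
  rewrite c_sum; over.
by rewrite integral_cst// mul1e; exact: probability_setT.
Qed.

HB.instance Definition _ := Kernel_isProbability.Build _ _ Y (Y * Rm * nat)%type R Q Q_setT.

Lemma randomized_mixture_fst y (A : set (Y * Rm)) :
  measurable [set x | A (y, x)] -> Q y [set s | A s.1] = unif R [set x | A (y, x)].
Proof.
move=> mA; rewrite randomized_mixtureE -[[set x | A (y, x)] in RHS]setIT -integral_indic//.
apply: eq_integral => x _; congr (_%:E).
rewrite (eq_bigr (fun f => c (y, x) f * \1_[set x | A (y, x)] x)).
  by rewrite -mulr_suml c_sum mul1r.
by move=> f _; congr (_ * _); rewrite !indicE /= !in_setE.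
Qed.

End randomized_mixture.

Section integral_indicators.
Context d (T : measurableType d) (R : realType) (mu : probability T R).

(** The coefficients may be negative, so the proof carries integrability along. *)
Lemma integral_sum_indic (I : Type) (s : seq I) (E : I -> set T) (a : I -> R) (b : R) :
  (forall i, measurable (E i)) ->
  (\int[mu]_x (b + \sum_(i <- s) a i * \1_(E i) x)%:E)%E =
  (b + \sum_(i <- s) a i * fine (mu (E i)))%:E.
Proof.
move=> mE; pose f (s : seq I) x := (b + \sum_(i <- s) a i * \1_(E i) x)%:E.
have int1 i : mu.-integrable [set: T] (fun x => (a i * \1_(E i) x)%:E).
  under eq_fun do rewrite EFinM; apply: integrableZl => //.
  exact: integrable_indic.
suff: mu.-integrable [set: T] (f s) /\ (\int[mu]_x f s x)%E =
    (b + \sum_(i <- s) a i * fine (mu (E i)))%:E by case.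
elim: s => [|i s [IH1 IH2]].
  rewrite big_nil addr0; have fE : f [::] = cst b%:E.
    by apply/funext => x; rewrite /f big_nil addr0.
  rewrite fE; split; first exact: finite_measure_integrable_cst.
  by rewrite integral_cst// [X in (_ * X)%E]probability_setT mule1.
have fE : f (i :: s) = (fun x => (a i * \1_(E i) x)%:E + f s x)%E.
  by apply/funext => x; rewrite /f big_cons addrCA EFinD.
rewrite fE; split; first exact: integrableD.
rewrite integralD// IH2 big_cons addrCA [RHS]EFinD; congr (_ + _)%E.
under eq_integral do rewrite EFinM.
rewrite integralZl//; last exact: integrable_indic.
by rewrite integral_indic// setIT EFinM fineK// fin_num_measure.
Qed.

End integral_indicators.

Lemma in_set_bool (T : Type) (p : pred T) (x : T) : (x \in [set y | p y]) = p x.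
Proof. by apply/idP/idP; rewrite in_setE. Qed.

Lemma uniq_map_inj (T U : eqType) (f : T -> U) (s : seq T) :
  uniq (map f s) -> {in s &, injective f}.
Proof.
elim: s => //= x s IH /andP[fx us] y z; rewrite !inE => /predU1P[->|ys] /predU1P[->|zs]//.
- by move=> e; move: fx; rewrite e map_f.
- by move=> e; move: fx; rewrite -e map_f.
- exact: IH.
Qed.

(** * Joint law of the offspring numbers and the graph *)

Section coupled_law.
Context (R : realType) (nu : probability R R).
Hypothesis nu_pos : nu `]0, +oo[%classic = 1%E.
Hypothesis nu_mean : (0 < \int[nu]_x x%:E < +oo)%E.
Context (n l : nat) (V : {set 'I_n}) (n_gt0 : (0 < n)%N).
Context d (Y : measurableType d) (w : Y -> 'I_n -> R).
Hypothesis mw : forall v, measurable_fun [set: Y] (fun y => w y v).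
Hypothesis w_gt0 : forall y v, 0 < w y v.
Local Notation Rm := (measurableTypeR R).
Local Notation hs := (histories l V).

(** Addresses are numbered by [pickle]. A number encoding no address still gets a probability law,
    as successive inversion asks for one at every index. *)
Definition label_law (y : Y) (k : nat) (m : nat) : R :=
  if (choice.unpickle k : option ('I_n * seq nat)) is Some i then node_pois nu w y i m
  else mixed_pois nu m.

Let law_ge0 y k m : 0 <= label_law y k m.
Proof.
by rewrite /label_law; case: choice.unpickle => [i|]; [exact: node_pois_ge0|exact: mixed_pois_ge0].
Qed.

Let law_cvg y k : cumul (label_law y k) N @[N --> \oo] --> (1 : R).
Proof.
rewrite /label_law; case: choice.unpickle => [i|]; last exact: cvg_sum_mixed_pois.
rewrite /node_pois; case: (i.2 == [::]); last exact: cvg_sum_mixed_pois.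
exact: cvg_sum_pois.
Qed.

Let mlaw k m : measurable_fun [set: Y] (fun y => label_law y k m).
Proof.
by rewrite /label_law; case: choice.unpickle => [i|]//; exact: measurable_node_pois.
Qed.

Definition labels (z : Y * Rm) (i : 'I_n * seq nat) : nat :=
  digits (label_law z.1) z.2 (choice.pickle i).

Lemma measurable_labels i : measurable_fun [set: Y * Rm] (fun z => labels z i).
Proof.
apply: (@measurable_digits R _ (Y * Rm)%type (fun z => label_law z.1) snd).
- by move=> k m; apply: (measurableT_comp (mlaw k m)); exact: measurable_fst.
- by move=> z k m; exact: law_ge0.
- exact: measurable_snd.
Qed.

Lemma measurable_labels_pre i A : measurable [set z | A (labels z i)].
Proof. by rewrite -[X in measurable X]setTI; exact: measurable_labels. Qed.

Let section_measurable y (B : set (Y * Rm)) : measurable B ->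
  measurable [set x : Rm | B (y, x)].
Proof.
by move=> mB; rewrite -[X in measurable X]setTI; exact: (@pair1_measurable _ _ Y Rm y).
Qed.

Definition conformal (h : seq (step 'I_n)) : set (Y * Rm) :=
  [set z | all (conform_tree (labels z)) h].

Lemma measurable_conformal h : measurable (conformal h).
Proof.
elim: h => [|s h IH]; first by rewrite (_ : conformal _ = setT)//; apply/seteqP.
rewrite (_ : conformal _ =
    [set z | labels z (addr s.1) = size s.2] `&` conformal h).
  apply: measurableI => //; exact: (measurable_labels_pre _ [set m | m = size s.2]).
by apply/seteqP; split => z /=; [move=> /andP[/eqP]|move=> [/eqP ? ?]; apply/andP].
Qed.

Lemma label_lawE y i m : unif R [set x | labels (y, x) i = m] = (node_pois nu w y i m)%:E.
Proof.
rewrite (unif_digitsE (law_ge0 y) (law_cvg y) (choice.pickle i) [set m]).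
by rewrite unif_digitE// /label_law choice.pickleK.
Qed.

Lemma labels_indep y (J : seq ('I_n * seq nat)) (A : 'I_n * seq nat -> set nat) :
  uniq J ->
  unif R [set x | forall i, i \in J -> A i (labels (y, x) i)] =
  (\prod_(i <- J) unif R [set x | A i (labels (y, x) i)])%E.
Proof.
move=> uJ; pose B k := if (choice.unpickle k : option ('I_n * seq nat)) is Some i then A i else setT.
have := @unif_digits_indep R (label_law y) (law_ge0 y) (law_cvg y) (map choice.pickle J) B.
have pickle_inj : injective (choice.pickle : 'I_n * seq nat -> nat) := pcan_inj choice.pickleK.
rewrite (map_inj_uniq pickle_inj).
move=> /(_ uJ); rewrite big_map => e.
rewrite (eq_bigr (fun i => unif R ((digits (label_law y))^~ (choice.pickle i) @^-1` B (choice.pickle i)))).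
  rewrite -e; congr (unif R _); apply/seteqP; split => x /= h.
    by move=> _ /mapP[i iJ ->]; rewrite /= /B choice.pickleK; exact: h.
  by move=> i iJ; have := h _ (map_f choice.pickle iJ); rewrite /B/= choice.pickleK.
by move=> i _; congr (unif R _); apply/seteqP; split => x /=; rewrite /B choice.pickleK.
Qed.

(** The addresses along a history are distinct, so its conditions bear on independent offspring
    numbers. *)
Lemma conformal_prob y h : h \in hs ->
  unif R [set x | conformal h (y, x)] = (tree_prob nu w y h)%:E.
Proof.
move=> hh; have uh := step_addr_uniq hh.
pose M i := head 0%N [seq size s.2 | s <- h & addr s.1 == i].
have ME s : s \in h -> M (addr s.1) = size s.2.
  move=> sh; rewrite /M (_ : [seq _ <- _ | _] = [:: s])//.
  rewrite (eq_in_filter (a2 := pred1 s)).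
    by rewrite filter_pred1_uniq// (map_uniq uh).
  by move=> s' s'h /=; apply/eqP/eqP => [e|->//]; exact: uniq_map_inj uh _ _ s'h sh e.
have -> : [set x | conformal h (y, x)] =
    [set x | forall i, i \in [seq addr s.1 | s <- h] -> [set m | m = M i] (labels (y, x) i)].
  apply/seteqP; split => x /=.
    by move=> /allP H _ /mapP[s sh ->]; rewrite ME//; exact/eqP/H.
  by move=> H; apply/allP => s sh; apply/eqP; rewrite -(ME s sh); apply: H; exact: map_f.
rewrite (labels_indep y (fun i => [set m | m = M i]) uh) big_map /tree_prob -prodEFin big_seq [RHS]big_seq.
by apply: eq_bigr => s sh; rewrite /= label_lawE ME.
Qed.

Let ratio y h := mass nu w y h / tree_prob nu w y h.

Let cond y h g := completion_cond (graph_prob (w y) (mean nu)) (ordering R (n := n)) h g.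

Let res y g := completion_residual hs (mass nu w y) (graph_prob (w y) (mean nu))
  (ordering R (n := n)) g.

(** If the tree probability is 0, some inner step has limiting probability 0, hence acceptance 0,
    and the mass vanishes too; root factors are positive. *)
Let mass_ratioK y h : h \in hs -> ratio y h * tree_prob nu w y h = mass nu w y h.
Proof.
move=> hh; rewrite /ratio; have [t0|t0] := eqVneq (tree_prob nu w y h) 0; last by rewrite divfK.
rewrite t0 mulr0; move/eqP: t0; rewrite prodf_seq_eq0 => /hasP[s sh /= s0].
apply/esym/eqP; rewrite /mass prodf_seq_eq0; apply/hasP; exists s => //=.
have [e1 e2] := step_rootP hh sh.
move: s0; rewrite /node_pois /step_weight e1; case: ifP => _.
  by rewrite gt_eqF// pois_gt0.
by move=> /eqP s0; rewrite /accept s0 mul0r min_r// mul0r.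
Qed.

Definition coupled_weight (z : Y * Rm) (g : graph n) : R :=
  coupling_weight nu l V w z.1 (labels z) g.

Let tree_weightE z h :
  tree_weight nu w z.1 (labels z) h = \1_(conformal h) z * ratio z.1 h.
Proof. by rewrite /tree_weight indicE in_set_bool. Qed.

(** Affine in the indicators of [conformal], so that integrating over the uniform variable only
    requires their probabilities. *)
Let coupled_weightE z g : coupled_weight z g =
  res z.1 g + \sum_(h <- hs) ratio z.1 h * (cond z.1 h g - res z.1 g) * \1_(conformal h) z.
Proof.
rewrite /coupled_weight /coupling_weight /completion mulrBl mul1r addrCA.
congr (_ + _); rewrite mulr_suml -sumrB; apply: eq_bigr => h _.
rewrite tree_weightE -/(cond z.1 h g) -/(res z.1 g); ring.
Qed.

Let measurable_snd1 (f : Y -> R) : measurable_fun [set: Y] f ->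
  measurable_fun [set: Y * Rm] (fun z => f z.1).
Proof. by move=> mf; apply: (measurableT_comp mf); exact: measurable_fst. Qed.

Lemma measurable_coupled_weight g : measurable_fun [set: Y * Rm] (fun z => coupled_weight z g).
Proof.
under eq_fun do rewrite coupled_weightE.
have mres : measurable_fun [set: Y * Rm] (fun z => res z.1 g).
  by apply: (measurable_snd1 (f := fun y => res y g)); exact: measurable_completion_residual.
apply: measurable_funD => //; apply: measurable_sum => h; apply: measurable_funM; last first.
  exact: measurable_indic (measurable_conformal h).
apply: measurable_funM; first by apply: (measurable_snd1 (f := ratio^~ h)); exact: measurable_mass_ratio.
apply: measurable_funB => //; apply: (measurable_snd1 (f := fun y => cond y h g)).
exact: measurable_completion_cond.
Qed.

Let weight_ge0 z g : 0 <= coupled_weight z g.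
Proof. exact: coupling_weight_ge0. Qed.

Let weight_sum z : \sum_g coupled_weight z g = 1.
Proof. exact: coupling_weight_sum. Qed.

Definition no_edges : graph n := [ffun=> false].

Definition coupling : R.-pker Y ~> (Y * Rm * nat)%type :=
  randomized_mixture no_edges measurable_coupled_weight weight_ge0 weight_sum.

Lemma coupling_fst y (A : set (Y * Rm)) : measurable A ->
  coupling y [set s | A s.1] = unif R [set x | A (y, x)].
Proof. by move=> mA; apply: randomized_mixture_fst; exact: section_measurable. Qed.

Let integral_conformal y (a : seq (step 'I_n) -> R) (b : R) :
  (\int[unif R]_x (b + \sum_(h <- hs) a h * ratio y h * \1_(conformal h) (y, x))%:E)%E =
  (b + \sum_(h <- hs) a h * mass nu w y h)%:E.
Proof.
transitivity (\int[unif R]_x (b + \sum_(h <- hs) a h * ratio y h *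
    \1_[set x | conformal h (y, x)] x)%:E)%E.
  by apply: eq_integral.
rewrite integral_sum_indic; last first.
  by move=> h; exact: section_measurable (measurable_conformal h).
congr (_ + _)%:E; rewrite big_seq [RHS]big_seq; apply: eq_bigr => h hh.
by rewrite conformal_prob//= -mulrA mass_ratioK.
Qed.

(** Averaging over the uniform variable turns tree weights into masses; the residual law then
    completes them to the law of the graph. *)
Lemma coupling_graph y (E : pred (graph n)) :
  coupling y [set s | E (fin_decode no_edges s.2)] = (\sum_(g | E g) graph_prob (w y) (mean nu) g)%:E.
Proof.
rewrite [LHS]randomized_mixtureE.
transitivity (\int[unif R]_x (\sum_(g | E g) res y g + \sum_(h <- hs)
    (\sum_(g | E g) (cond y h g - res y g)) * ratio y h * \1_(conformal h) (y, x))%:E)%E.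
  apply: eq_integral => x _; congr (_%:E).
  rewrite (eq_bigr (fun g => if E g then coupled_weight (y, x) g else 0)); last first.
    by move=> g _; rewrite indicE in_set_bool /= fin_codeK; case: (E g); rewrite ?mulr1 ?mulr0.
  rewrite -big_mkcond/=; under eq_bigr do rewrite coupled_weightE.
  rewrite big_split/= exchange_big/=; congr (_ + _); apply: eq_bigr => h _.
  by rewrite -!mulr_suml; congr (_ * _); rewrite mulrC mulr_sumr.
rewrite integral_conformal; congr (_%:E).
under [X in _ + X]eq_bigr do rewrite mulr_suml.
rewrite exchange_big/= -big_split/=; apply: eq_bigr => g _.
rewrite -(coupling_weight_residual nu_mean l V n_gt0 w_gt0 y g) -/(res y g).
rewrite mulrBl mul1r addrCA; congr (_ + _).
rewrite /completion_mass mulr_suml -sumrB; apply: eq_bigr => h _.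
by rewrite -/(cond y h g); ring.
Qed.

Lemma coupling_failure_le y (F : set (Y * Rm * nat)) : measurable F ->
  (forall x g h, h \in hs -> conformal h (y, x) -> all (conform g) h ->
    ~ F (y, x, fin_code g)) ->
  (coupling y F <= (1 - \sum_(h <- hs) mass nu w y h)%:E)%E.
Proof.
move=> mF hF; rewrite [leLHS]randomized_mixtureE.
have := integral_conformal y (fun=> -1) 1.
under [in X in _ = X]eq_bigr do rewrite mulN1r.
rewrite sumrN => <-; apply: ge0_le_integral => //.
- by move=> x _; rewrite lee_fin; apply: sumr_ge0 => g _; rewrite mulr_ge0.
- apply/measurable_EFinP; apply: measurable_sum => g; apply: measurable_funM.
    by apply: (measurableT_comp (measurable_coupled_weight g)); exact: pair1_measurable.
  apply: (@measurableT_comp _ _ _ _ _ _ (\1_F : Y * Rm * nat -> R) _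
    (fun x => (y, x, fin_code g))); first exact: measurable_indic.
  by apply: measurable_fun_pair => //; exact: pair1_measurable.
- apply/measurable_EFinP; apply: measurable_funD => //; apply: measurable_sum => h.
  apply: measurable_funM => //; apply: (@measurableT_comp _ _ _ _ _ _ (\1_(conformal h) : Y * Rm -> R) _ (pair y)).
    exact: measurable_indic (measurable_conformal h).
  exact: pair1_measurable.
move=> x _; rewrite lee_fin.
have h1 := @coupling_weight_failure R nu nu_mean n l V n_gt0 _ _ w w_gt0 y (labels (y, x))
  (fun g => `[< F (y, x, fin_code g) >]).
rewrite [X in _ <= 1 + X](_ : _ = - \sum_(h <- hs) tree_weight nu w y (labels (y, x)) h); last first.
  rewrite -sumrN; apply: eq_bigr => h _.
  by rewrite (tree_weightE (y, x)) mulN1r mulNr mulrC.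
apply: le_trans (h1 _); last first.
  by move=> g h hh hM hg; apply/asboolPn; exact: hF hh hM hg.
rewrite [leRHS]big_mkcond/=; apply: ler_sum => g _; rewrite indicE.
case: asboolP => Fg.
  by rewrite mem_set// mulr1; exact: le_refl.
by rewrite memNset// mulr0.
Qed.

End coupled_law.

(** * Measurability of events on cut trees *)

Section measurable_finite_sets.
Context d (Z : measurableType d).

Lemma countable_bigcup_measurable (X : countType) (P : set X) (F : X -> set Z) :
  (forall x, P x -> measurable (F x)) -> measurable (\bigcup_(x in P) F x).
Proof.
move=> mF; rewrite bigcup_mkcond; apply: countable_bigcupT_measurable => // x.
by case: ifPn => // /set_mem; exact: mF.
Qed.

Lemma countable_bigcap_measurable (X : countType) (P : set X) (F : X -> set Z) :
  (forall x, P x -> measurable (F x)) -> measurable (\bigcap_(x in P) F x).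
Proof.
move=> mF; rewrite -[X in measurable X]setCK setC_bigcap; apply: measurableC.
by apply: countable_bigcup_measurable => x Px; apply: measurableC; exact: mF.
Qed.

(** Only countably many values occur, all finite, so the event is a countable union over the
    admissible values. *)
Lemma measurable_finite_set_valued (X : countType) (A : Z -> set X) (P : set X -> Prop) :
  (forall x, measurable [set z | A z x]) ->
  (forall z, exists L : seq X, A z `<=` [set` L]) -> measurable [set z | P (A z)].
Proof.
move=> mA finA.
rewrite (_ : [set z | _] = \bigcup_(L in [set L : seq X | P [set` L]])
    \bigcap_(x in [set: X]) [set z | A z x <-> x \in L]).
  apply: countable_bigcup_measurable => L _.
  apply: countable_bigcap_measurable => x _.
  have [xL|xL] := boolP (x \in L).
    rewrite (_ : [set z | _] = [set z | A z x])//.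
    by apply/seteqP; split => z /= => [[_ h]|Az]; [exact: h|split].
  rewrite (_ : [set z | _] = ~` [set z | A z x]); first exact: measurableC.
  by apply/seteqP; split => z /= => [[h _] /h|nA]//; split.
have AE z (L : seq X) : (forall x, A z x <-> x \in L) -> A z = [set` L].
  by move=> h; apply/seteqP; split => x /h.
apply/seteqP; split => z /=.
  move=> PA; have [L AL] := finA z.
  have hL x : A z x <-> x \in [seq x <- L | `[< A z x >]].
    rewrite mem_filter; split=> [Ax|/andP[/asboolP]//].
    by apply/andP; split; [exact/asboolP|exact: AL].
  have PL : P [set` [seq x <- L | `[< A z x >]]] by rewrite -(AE z _ hL).
  by exists [seq x <- L | `[< A z x >]] => // x _; exact: hL.
by move=> [L PL h]; rewrite (AE z L)// => x; exact: h.
Qed.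

Context (N : Z -> seq nat -> nat).
Hypothesis mN : forall u, measurable_fun [set: Z] (fun z => N z u).

(** A cut tree is determined by its vertex set, which is finite because every individual has
    finitely many children. *)
Lemma measurable_tree_cut (P : rooted_graph (seq nat) -> Prop) l :
  measurable [set z | P (tree_cut (tree_of_offspring (N z)) l)].
Proof.
apply: (measurable_finite_set_valued
  (A := fun z => [set u | tree_of_offspring (N z) u /\ (size u <= l)%N])
  (fun A => P (RootedGraph [::] A (fun x y =>
    [/\ A x, A y & exists i, y = rcons x i \/ x = rcons y i])))) => [u|z].
  rewrite (_ : [set z | _] = [set z | tree_of_offspring (N z) u] `&`
      (if (size u <= l)%N then setT else set0)); last first.
    by apply/seteqP; split => z /= [Tu]; case: ifP.
  apply: measurableI; last by case: ifP.
  rewrite (_ : [set z | _] = \bigcap_(p in [set p : seq nat * nat | prefix (rcons p.1 p.2) u])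
      [set z | (p.2 < N z p.1)%N]).
    apply: countable_bigcap_measurable => p _.
    rewrite -[X in measurable X]setTI.
    exact: (@mN p.1 measurableT [set m | (p.2 < m)%N]).
  by apply/seteqP; split => z /= h => [[s i]|s i si]; [exact: h|exact: (h (s, i))].
elim: l => [|l [L hL]].
  by exists [:: [::]] => u /= [_]; rewrite leqn0 size_eq0 inE.
exists (L ++ flatten [seq [seq rcons u i | i <- iota 0 (N z u)] | u <- L]) => u /= [Tu].
rewrite mem_cat leq_eqVlt => /predU1P[|ul]; last by rewrite hL.
case/lastP: u Tu => // u i Tu; rewrite size_rcons => -[ul].
apply/orP; right; apply/flattenP; exists [seq rcons u i | i <- iota 0 (N z u)].
  apply/map_f; apply: hL; split; last by rewrite ul.
  by move=> s j sj; apply: Tu; exact: prefix_trans sj (prefix_rcons _ _).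
by apply/map_f; rewrite mem_iota; apply: (Tu u i); exact: prefix_refl.
Qed.

End measurable_finite_sets.

(** * The coupled graph and trees *)

Section coupled_model.
Context (R : realType) (nu : probability R R).
Hypothesis nu_pos : nu `]0, +oo[%classic = 1%E.
Hypothesis nu_mean : (0 < \int[nu]_x x%:E < +oo)%E.
Context (n l : nat) (V : {set 'I_n}) (n_gt0 : (0 < n)%N).
Context d (Y : measurableType d) (w : Y -> 'I_n -> R).
Hypothesis mw : forall v, measurable_fun [set: Y] (fun y => w y v).
Hypothesis w_gt0 : forall y v, 0 < w y v.
Local Notation Rm := (measurableTypeR R).
Local Notation S := (Y * Rm * nat)%type.
Local Notation Q := (coupling nu_mean l V n_gt0 mw w_gt0).
Local Notation label := (labels nu w).

Definition coupled_graph (s : S) : rel 'I_n := adj (fin_decode (no_edges n) s.2).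

Definition coupled_tree (v : 'I_n) (s : S) : set (seq nat) :=
  tree_of_offspring (fun u => label s.1 (v, u)).

Let measurable_graph (E : pred (graph n)) :
  measurable [set s : S | E (fin_decode (no_edges n) s.2)].
Proof.
rewrite -[X in measurable X]setTI.
exact: (@measurable_snd _ _ (Y * Rm)%type nat measurableT [set k | E (fin_decode (no_edges n) k)]).
Qed.

Lemma coupled_graphP y : rank_one_graph (Q y) (mean nu) (w y) coupled_graph.
Proof.
have adjE (g : graph n) (e : 'I_n * 'I_n) : (e.1 < e.2)%N -> adj g e.1 e.2 = g e.
  by rewrite /adj -surjective_pairing => ->.
have edgeE (e : 'I_n * 'I_n) : (e.1 < e.2)%N ->
    Q y [set s | coupled_graph s e.1 e.2] = (edge_prob (w y) (mean nu) e.1 e.2)%:E.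
  move=> ltE; rewrite (coupling_graph nu_pos nu_mean l V n_gt0 mw w_gt0 y (fun g => adj g e.1 e.2)).
  have := graph_prob_cylinder (w y) (mean nu) (pred1 e) predT.
  rewrite big_pred1_eq/= => <-; congr (_%:E); apply: eq_bigl => g.
  rewrite adjE//; apply/idP/forallP => [ge e'|/(_ e)]; last by rewrite eqxx => /eqP.
  by apply/implyP => /eqP ->; rewrite ge.
split.
- by move=> s; split; [exact: adj_sym|exact: adj_irrefl].
- by move=> u v; exact: (measurable_graph (fun g => adj g u v)).
- move=> u v; rewrite neq_ltn => /orP[uv|vu]; first exact: (edgeE (u, v)).
  rewrite (_ : edge_prob _ _ u v = edge_prob (w y) (mean nu) v u); last first.
    by rewrite /edge_prob (mulrC (w y u)).
  rewrite -(edgeE (v, u))//; congr (Q y _); apply/seteqP.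
  by split => s /=; rewrite /coupled_graph adj_sym.
move=> J JD.
have Jlt e : e \in J -> (e.1 < e.2)%N by exact: JD.
rewrite (_ : \bigcap_(i in _) _ = [set s | [forall e, (e \in J) ==>
    (fin_decode (no_edges n) s.2 e == true)]]); last first.
  apply/seteqP; split => s /= h.
    by apply/forallP => e; apply/implyP => eJ; rewrite -adjE ?Jlt//; exact/eqP/h.
  by move=> e eJ; move/forallP/(_ e)/implyP/(_ eJ)/eqP: h => h; rewrite /= /coupled_graph adjE// Jlt.
rewrite (coupling_graph nu_pos nu_mean l V n_gt0 mw w_gt0 y
  (fun g : graph n => [forall e, (e \in J) ==> (g e == true)])).
rewrite (graph_prob_cylinder (w y) (mean nu) (mem J) predT) -prodEFin.
rewrite -big_uniq ?fset_uniq// big_seq [RHS]big_seq.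
by apply: eq_bigr => e eJ; rewrite edgeE// Jlt.
Qed.

Lemma coupled_treeP y : independent_gw_trees (Q y) nu (w y) V coupled_tree.
Proof.
exists (fun v u s => label s.1 (v, u)); split => //.
- move=> v u _; apply: (measurableT_comp (measurable_labels nu mw w_gt0 (v, u))) => //.
- move=> v k _.
  rewrite (coupling_fst nu_mean l V n_gt0 mw w_gt0 y (A := [set z | label z (v, [::]) = k])).
    by rewrite label_lawE// /node_pois/= poisson_pmfE.
  exact: (measurable_labels_pre nu mw w_gt0 (v, [::]) [set m | m = k]).
- move=> v u k _ u0.
  rewrite (coupling_fst nu_mean l V n_gt0 mw w_gt0 y (A := [set z | label z (v, u) = k])).
    by rewrite label_lawE// /node_pois/= (negPf u0) mixed_poisE.
  exact: (measurable_labels_pre nu mw w_gt0 (v, u) [set m | m = k]).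
move=> A J _.
have mA i : measurable [set z | A i (label z i)] by exact: measurable_labels_pre.
transitivity (Q y [set s | (\bigcap_(i in [set` J]) [set z | A i (label z i)]) s.1]).
  by congr (Q y _); apply/seteqP; split => s /= h i iJ; have := h i iJ; rewrite /= -surjective_pairing.
rewrite coupling_fst; last by apply: fin_bigcap_measurable => //; exact: finite_fset.
rewrite (labels_indep nu_pos nu_mean w_gt0 y A (fset_uniq J)); apply: eq_bigr => i _.
by rewrite -(coupling_fst nu_mean l V n_gt0 mw w_gt0 y (A := [set z | A i (label z i)]))// -surjective_pairing.
Qed.

Let failure : set S := coupling_failure l V coupled_graph coupled_tree.

Lemma measurable_coupling_failure : measurable failure.
Proof.
apply: fin_bigcup_measurable => // v _.
pose F g := [set z | ~ rg_iso (neighbourhood (adj g) l v)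
  (tree_cut (tree_of_offspring (fun u => label z (v, u))) l)].
have mF g : measurable (F g).
  apply: (measurable_tree_cut (N := fun z u => label z (v, u)) _
    (fun t => ~ rg_iso (neighbourhood (adj g) l v) t)).
  by move=> u; exact: measurable_labels.
(* The graph takes finitely many values; once it is fixed, only the cut tree is random. *)
rewrite (_ : [set s | _] = \bigcup_(g in [set: graph n])
    ([set s | fin_decode (no_edges n) s.2 == g] `&` [set s | F g s.1])).
  apply: fin_bigcup_measurable => [|g _]; [exact: finite_finset|apply: measurableI].
    exact: (measurable_graph (pred1 g)).
  by rewrite -[X in measurable X]setTI; exact: measurable_fst.
apply/seteqP; split => s /=.
  by move=> h; exists (fin_decode (no_edges n) s.2) => //; split => /=; first exact: eqxx.
by move=> [g _ [/eqP <-]].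
Qed.

Lemma coupled_failure_le y (alpha k : R) :
  (wasserstein1 (empirical (w y)) nu <= alpha%:E)%E ->
  (wasserstein1 (empirical_size_biased (w y)) (size_biased nu) <= alpha%:E)%E ->
  0 < k -> (Q y failure <= (coupling_bound nu (w y) V l alpha k)%:E)%E.
Proof.
move=> w_nu w_sb k0.
apply: (@le_trans _ _ (1 - \sum_(h <- histories l V) mass nu w y h)%:E).
  apply: (coupling_failure_le nu_pos); first exact: measurable_coupling_failure.
  move=> x g h hh /allP hM /allP hg [v vV]; apply.
  rewrite /coupled_graph fin_codeK; exact: (conform_iso hh hg hM vV).
rewrite lee_fin lerBlDr -lerBlDl.
exact: (runs_mass_ge nu_pos nu_mean n_gt0 (w_gt0 y) w_nu w_sb l V k0).
Qed.

End coupled_model.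

Theorem proposition2p10 (R : realType)
    (d : measure_display) (Omega : measurableType d) (P : probability Omega R)
    (W : forall n : nat, 'I_n -> {RV P >-> R})
    (nu : probability R R) (alpha : nat -> Omega -> R)
    (HA : assumptionA W nu alpha)
    (V : forall n : nat, {set 'I_n}) (l n : nat) (n_gt0 : (0 < n)%N) :
  exists (d' : measure_display) (S : measurableType d')
    (Q : R.-pker weights_sigmaType (W n) ~> S)
    (G : S -> rel 'I_n) (T : 'I_n -> S -> set (seq nat)),
    measurable (coupling_failure l (V n) G T) /\
    {ae P, forall omega : Omega,
      let w := fun v => W n v omega in
      [/\ rank_one_graph (Q omega) (mean nu) w G,
          independent_gw_trees (Q omega) nu w (V n) T &
          forall k : nat -> R, (forall m, 0 < k m) ->
            (Q omega (coupling_failure l (V n) G T)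
              <= (coupling_bound nu w (V n) l (alpha n omega) (k n))%:E)%E]}.
Proof.
have [W_gt0 nu_pos nu_mean _ _ W_nu W_sb _] := HA.
(* The parameter space is [Omega] with the sigma-algebra of the weights, so the kernel is measurable
   with respect to it. The coupling is built without reference to [alpha] and [k], so a single one
   serves every sequence [k]. *)
pose Y := weights_sigmaType (W n).
pose w (omega : Y) v := W n v omega.
have mw v : measurable_fun [set: Y] (fun omega => w omega v).
  move=> _ A mA; rewrite setTI; apply: sub_sigma_algebra; apply: sub_sigma_algebra.
  rewrite -bigcup_seq; exists v; first exact: mem_index_enum.
  by exists A => //; rewrite setTI.
have w_gt0 omega v : 0 < w omega v by exact: W_gt0.
exists _, _, (coupling nu_mean l (V n) n_gt0 mw w_gt0),
  (@coupled_graph R n _ Y), (coupled_tree nu w).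
split; first exact: measurable_coupling_failure.
have := W_nu n n_gt0; apply: filterS2 (W_sb n n_gt0) => omega w_sb w_nu.
split; [exact: coupled_graphP|exact: coupled_treeP|move=> k k_gt0].
exact: coupled_failure_le.
Qed.
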